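(* Let $\{u_j,\lambda_{ji}\}$ be the solution of the domain-decomposed weak Galerkin system (DD) described in the context. Let $\beta>0$ be any constant, and let $\{u_j^{(n)},\lambda_{ji}^{(n)}\}_{n\ge 0}$ be the sequence produced by the iterative scheme (IT) described in the context, started from any initial guess $u_j^{(0)}=\{u_{j,0}^{(0)},u_{j,b}^{(0)}\}\in W_h(\Omega_j)$ with $u_{j,b}^{(0)}=Q_bg$ on $\Gamma_j$ and any $\lambda_{ji}^{(0)}\in\Lambda_{ji}$. Then, for all $j$ and all $i$ adjacent to $j$, $$u_j^{(n)}\to u_j \ \text{ in } W_h(\Omega_j),\qquad \lambda_{ji}^{(n)}\to\lambda_{ji}\ \text{ in }\Lambda_{ji},\qquad\text{as } n\to\infty .$$ (All spaces are finite dimensional, so the choice of norm is immaterial.)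
   Context: **Data.** $d\in\{2,3\}$; $\Omega\subset\mathbb R^d$ is a bounded polygonal/polyhedral domain (open, connected). The coefficients satisfy $0<a_0\le a(x)\le a_1<\infty$ and $0\le c(x)\le c_1<\infty$ (measurable); $f\in L^2(\Omega)$, $g\in L^2(\partial\Omega)$. (These are the data of $-\nabla\cdot(a\nabla u)+cu=f$ in $\Omega$, $u=g$ on $\partial\Omega$.) **Mesh.** $\mathcal T_h$ is a fixed finite partition of $\Omega$ into polygons/polyhedra $T$ (open, connected, Lipschitz). The boundary of each $T$ is a union of edges/flat faces $e$ of the partition. Each interior face is shared by exactly two elements; every other face lies on $\partial\Omega$. $h_T$ is the diameter of $T$ and $\mathbf n$ is the outward unit normal on $\partial T$. **Weak functions.** Fix an integer $k\ge1$. $P_r$ denotes polynomials of total degree at most $r$. $W_h$ is the space of pairs $v=\{v_0,v_b\}$ with $v_0|_T\in P_k(T)$ for every $T\in\mathcal T_h$ and $v_b|_e\in P_{k-1}(e)$ for every face $e$, with $v_b$ single-valued on each face. $v_b$ need not be the trace of $v_0$. $Q_b$ is the $L^2$ projection onto $P_{k-1}(e)$ on each face $e$. The discrete weak gradient $\nabla_w v$ is defined on each $T$ by $\nabla_w v|_T\in[P_{k-1}(T)]^d$ and $$(\nabla_w v,\mathbf w)_T=-(v_0,\nabla\cdot\mathbf w)_T+\langle v_b,\mathbf w\cdot\mathbf n\rangle_{\partial T}\quad\forall\,\mathbf w\in[P_{k-1}(T)]^d .$$ Here $(\cdot,\cdot)$ and $\langle\cdot,\cdot\rangle$ are $L^2$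 inner products on volumes and on boundaries. Set $s_T(u,v)=h_T^{-1}\langle Q_bu_0-u_b,\,Q_bv_0-v_b\rangle_{\partial T}$. **Subdomains.** $\Omega_1,\dots,\Omega_M$ are disjoint open connected sets with $\overline\Omega=\bigcup_j\overline{\Omega}_j$, each being (up to closure) a union of elements of $\mathcal T_h$. Write $\mathcal T_h^j$ for the elements contained in $\Omega_j$, $\Gamma_j=\partial\Omega\cap\partial\Omega_j$, and $\Gamma_{ji}=\Gamma_{ij}=\partial\Omega_j\cap\partial\Omega_i$ for $i\ne j$. Indices $j,i$ are called adjacent if $\Gamma_{ji}$ has dimension $d-1$, and every sum over $i$ below runs over the $i\neq j$ adjacent to $j$. $W_h(\Omega_j)$ is the set of restrictions to $\Omega_j$ of functions in $W_h$ (so functions in $W_h(\Omega_j)$ and $W_h(\Omega_i)$ have independent boundary values on $\Gamma_{ji}$). $W_h^0(\Omega_j)=\{v\in W_h(\Omega_j): v_b=0\text{ on }\Gamma_j\}$. $\Lambda_{ji}$ is the space of functions on $\Gamma_{ji}$ that belong to $P_{k-1}(e)$ on each mesh face $e\subset\Gamma_{ji}$; $\Lambda_{ji}$ and $\Lambda_{ij}$ are two separate copies of this space. Put $(\cdot,\cdot)_{\Omega_j}=\sum_{T\in\mathcal T_h^j}(\cdot,\cdot)_T$ and $s_j(u,v)=\sum_{T\in\mathcal T_h^j}s_T(u,v)$. **System (DD).** Find $u_j=\{u_{j,0},u_{j,b}\}\in W_h(\Omega_j)$ with $u_{j,b}=Q_bg$ on $\Gamma_j$, and $\lambda_{ji}\in\Lambda_{ji}$,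 such that for all $j$ $$(a\nabla_wu_j,\nabla_wv_j)_{\Omega_j}+s_j(u_j,v_j)-\sum_i\langle\lambda_{ji},v_{j,b}\rangle_{\Gamma_{ji}}+(cu_{j,0},v_{j,0})_{\Omega_j}=(f,v_{j,0})_{\Omega_j}\quad\forall v_j\in W_h^0(\Omega_j),$$ $$\sum_i\langle\mu_{ji},u_{j,b}-u_{i,b}\rangle_{\Gamma_{ji}}=0\quad\forall\,(\mu_{ji})_i\text{ with }\mu_{ji}\in\Lambda_{ji},\qquad \lambda_{ji}+\lambda_{ij}=0\text{ on }\Gamma_{ji}.$$ **Iteration (IT).** For $n\ge1$, find $u_j^{(n)}\in W_h(\Omega_j)$ with $u_{j,b}^{(n)}=Q_bg$ on $\Gamma_j$, and $\lambda_{ji}^{(n)}\in\Lambda_{ji}$, such that for all $j$ $$(a\nabla_wu_j^{(n)},\nabla_wv_j)_{\Omega_j}+s_j(u_j^{(n)},v_j)+\sum_i\langle\beta u_{j,b}^{(n)},v_{j,b}\rangle_{\Gamma_{ji}}+(cu_{j,0}^{(n)},v_{j,0})_{\Omega_j}$$ $$=\sum_i\langle\beta u_{i,b}^{(n-1)}-\lambda_{ij}^{(n-1)},v_{j,b}\rangle_{\Gamma_{ji}}+(f,v_{j,0})_{\Omega_j}\quad\forall v_j\in W_h^0(\Omega_j),$$ $$\lambda_{ji}^{(n)}=\beta\,(u_{i,b}^{(n-1)}-u_{j,b}^{(n)})-\lambda_{ij}^{(n-1)}\quad\text{on }\Gamma_{ji}.$$ *)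

(* Defs.v *)
(* mpoly is imported without its notations, which clash with those of
   mathcomp-analysis: "mpoly n R" is the type of polynomials in n variables. *)
From HB Require Import structures.
From mathcomp Require Import all_boot all_order all_algebra.
From mathcomp Require Import -(notations) mpoly.
From mathcomp Require Import all_classical all_reals all_analysis.

Set Implicit Arguments.
Unset Strict Implicit.
Unset Printing Implicit Defensive.

Import Order.TTheory GRing.Theory Num.Theory.
Import numFieldNormedType.Exports.

Local Open Scope classical_set_scope.
Local Open Scope ring_scope.

Definition measure_rV_display : measure_display -> measure_display.
Proof. exact. Qed.

Section measurable_rV.
Context {d} {T : sigmaRingType d}.
Variable n : nat.

Let coors : 'I_n -> 'rV[T]_n -> T := fun i x => x ord0 i.

Let rV_set0 : g_sigma_preimage coors set0.
Proof. exact: sigma_algebra0. Qed.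

Let rV_setC A : g_sigma_preimage coors A -> g_sigma_preimage coors (~` A).
Proof. exact: sigma_algebraC. Qed.

Let rV_bigcup (F : _^nat) : (forall i, g_sigma_preimage coors (F i)) ->
  g_sigma_preimage coors (\bigcup_i (F i)).
Proof. exact: sigma_algebra_bigcup. Qed.

(* The product sigma-algebra; over a realType this is the Borel one. *)
HB.instance Definition _ := @isMeasurable.Build (measure_rV_display d)
  'rV[T]_n (g_sigma_preimage coors) rV_set0 rV_setC rV_bigcup.

End measurable_rV.

Section measurable_rV_theory.
Context {d} {T : measurableType d}.

Lemma measurable_rV_coord n (i : 'I_n) :
  measurable_fun [set: 'rV[T]_n] (fun x : 'rV[T]_n => x ord0 i).
Proof.
move=> _ Y mY; rewrite setTI; apply: sub_sigma_algebra => /=.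
rewrite -bigcup_seq/=; exists i => /=; first by rewrite mem_index_enum.
by exists Y => //; rewrite setTI.
Qed.

Lemma measurable_fun_rVP d1 (T1 : measurableType d1) n (f : T1 -> 'rV[T]_n) :
  (forall i, measurable_fun [set: T1] (fun x => f x ord0 i)) ->
  measurable_fun [set: T1] f.
Proof.
move=> mf _ A mA; rewrite setTI.
suff : (@measurable _ 'rV[T]_n) `<=` [set B | measurable (f @^-1` B)].
  by apply.
apply: smallest_sub.
  split => /=.
  - by rewrite preimage_set0.
  - by move=> B mB; rewrite setTD preimage_setC; exact: measurableC.
  - by move=> F mF; rewrite preimage_bigcup; exact: bigcup_measurable.
case: n => [|n] in f mf A mA *; first by rewrite big_ord0.
rewrite -bigcup_mkord_ord; apply: bigcup_sub => i Ii.
move=> B [C mC <-] /=; rewrite setTI -comp_preimage.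
by have := mf (inord i) measurableT C mC; rewrite setTI.
Qed.

End measurable_rV_theory.

Section lebesgue_rV.
Context {R : realType}.

Definition consrV n (p : measurableTypeR R * 'rV[R]_n) : 'rV[R]_n.+1 :=
  row_mx (p.1)%:M p.2 : 'rV_(1 + n).

Definition unconsrV n (x : 'rV[R]_n.+1) : measurableTypeR R * 'rV[R]_n :=
  (x ord0 ord0, rsubmx (x : 'rV_(1 + n))).

Lemma unconsrVK n : cancel (@unconsrV n) (@consrV n).
Proof.
move=> x; apply/rowP => i; rewrite /consrV mxE; case: splitP => j ij.
  by rewrite mxE !ord1 mulr1n; congr (x _ _); apply/val_inj; move: ij => /= ->; rewrite ord1.
by rewrite mxE; congr (x _ _); apply/val_inj.
Qed.

Lemma consrVK n : cancel (@consrV n) (@unconsrV n).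
Proof.
move=> [t y]; rewrite /unconsrV /consrV; congr pair; last exact: row_mxKr.
have -> : (ord0 : 'I_n.+1) = @lshift 1 n ord0 by exact/val_inj.
by rewrite (row_mxEl (t%:M) y) mxE mulr1n.
Qed.

Lemma measurable_consrV n : measurable_fun setT (@consrV n).
Proof.
apply: measurable_fun_rVP => i; case: (@splitP 1 n i) => j ij.
  rewrite (_ : (fun _ => _) = fst); first exact: measurable_fst.
  apply/funext => p; have -> : i = lshift n j by exact/val_inj.
  by rewrite (row_mxEl (p.1)%:M p.2) mxE !ord1 mulr1n.
rewrite (_ : (fun _ => _) = (fun y : 'rV[R]_n => y ord0 j) \o snd).
  apply: measurableT_comp; [exact: measurable_rV_coord|exact: measurable_snd].
apply/funext => p; have -> : i = rshift 1 j by exact/val_inj.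
by rewrite (row_mxEr (p.1)%:M p.2).
Qed.

Lemma measurable_unconsrV n : measurable_fun setT (@unconsrV n).
Proof.
apply/measurable_fun_pairP; split; first exact: measurable_rV_coord.
apply: measurable_fun_rVP => i /=.
rewrite (_ : (fun _ => _) = fun x : 'rV[R]_n.+1 => x ord0 (rshift 1 i : 'I_n.+1)).
  exact: measurable_rV_coord.
by apply/funext => x; rewrite mxE.
Qed.

Section cons_measure.
Variables (n : nat) (mu : {sigma_finite_measure set 'rV[R]_n -> \bar R}).

Definition cons_measure : set 'rV[R]_n.+1 -> \bar R :=
  pushforward (@lebesgue_measure R \x mu)%E (@consrV n).

HB.instance Definition _ := Measure.copy cons_measure
  (@measure_function_pushforward__canonical__measure_function_Measure
     _ _ _ _ _ [the measure _ _ of (@lebesgue_measure R \x mu)%E] (@consrV n)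
     (@measurable_consrV n)).

Let cons_sigma_finite : sigma_finite setT cons_measure.
Proof.
have /sigma_finiteP[F [FT ndF Foo]] := sigma_finiteT (@lebesgue_measure R).
have /sigma_finiteP[G [GT ndG Goo]] := sigma_finiteT mu.
exists (fun i => @unconsrV n @^-1` (F i `*` G i)).
  apply/esym/seteqP; split=> // x _.
  have [i _ Fi] : (\bigcup_i F i) (unconsrV x).1 by rewrite -FT.
  have [j _ Gj] : (\bigcup_i G i) (unconsrV x).2 by rewrite -GT.
  exists (maxn i j) => //; split.
  - by move: Fi; exact/subsetPset/ndF/leq_maxl.
  - by move: Gj; exact/subsetPset/ndG/leq_maxr.
move=> i; have [mF Fi] := Foo i; have [mG Gi] := Goo i.
have mFG : measurable (F i `*` G i) by exact: measurableX.
split; first by have := @measurable_unconsrV n measurableT _ mFG; rewrite setTI.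
rewrite /cons_measure /pushforward -comp_preimage.
rewrite (_ : _ \o _ = id); last by apply/funext => p /=; rewrite consrVK.
by rewrite preimage_id product_measure1E// lte_mul_pinfty// ge0_fin_numE.
Qed.

HB.instance Definition _ :=
  Measure_isSigmaFinite.Build _ _ _ cons_measure cons_sigma_finite.

End cons_measure.

Fixpoint lebesgue_rV (n : nat) : {sigma_finite_measure set 'rV[R]_n -> \bar R} :=
  match n with
  | 0 => [the {sigma_finite_measure set 'rV[R]_0 -> \bar R} of \d_(0 : 'rV[R]_0)]
  | n'.+1 => [the {sigma_finite_measure set 'rV[R]_n'.+1 -> \bar R} of
               cons_measure (lebesgue_rV n')]
  end.

End lebesgue_rV.

Section geometry.
Context {R : realType}.

Definition dot n (x y : 'rV[R]_n) : R := \sum_i x ord0 i * y ord0 i.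

Definition enorm n (x : 'rV[R]_n) : R := Num.sqrt (dot x x).

Definition diam n (A : set 'rV[R]_n) : R :=
  sup [set r | exists x y, [/\ A x, A y & r = enorm (x - y)]].

Definition bdry n (A : set 'rV[R]_n) : set 'rV[R]_n := closure A `\` A°.

Definition affinely_independent m n (p : 'I_m.+1 -> 'rV[R]_n) : bool :=
  row_free (\matrix_(i < m) (p (lift ord0 i) - p ord0)).

Definition simplex m n (p : 'I_m.+1 -> 'rV[R]_n) : set 'rV[R]_n :=
  [set x | exists t : 'I_m.+1 -> R,
    [/\ forall i, 0 <= t i, \sum_i t i = 1 & x = \sum_i t i *: p i]].

(* For n = 1, 2, 3: a bounded open interval, polygon, polyhedron, possibly
   nonconvex and multiply connected.  The condition D = (closure D)° excludes
   cracks, across which a domain would meet one boundary face from two sides. *)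
Definition polytopal_domain n (D : set 'rV[R]_n) : Prop :=
  [/\ D !=set0, open D, connected D, D = (closure D)° &
      exists (N : nat) (p : 'I_N -> 'I_n.+1 -> 'rV[R]_n),
        (forall l, affinely_independent (p l)) /\
        closure D = \bigcup_l simplex (p l)].

(* Near each boundary point, T lies below the graph of a Lipschitz function over
   the hyperplane orthogonal to nu. *)
Definition lipschitz_domain n (T : set 'rV[R]_n) : Prop :=
  forall x0, bdry T x0 ->
    exists (nu : 'rV[R]_n) (phi : 'rV[R]_n -> R) (L r : R),
      [/\ enorm nu = 1, 0 < r,
          forall y z, `|phi y - phi z| <= L * enorm (y - z) &
          forall x, enorm (x - x0) < r ->
            (T x <-> dot (x - x0) nu < phi (x - x0 - dot (x - x0) nu *: nu))].

(* Gamma_ji is polyhedral with empty interior, so that for A = Gamma_ji this says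
   that A has dimension d - 1. *)
Definition has_codim1 d (A : set 'rV[R]_d) : Prop :=
  exists2 p : 'I_d.-1.+1 -> 'rV[R]_d, affinely_independent p & simplex p `<=` A.

(* A face e is described by a domain fdom e in R^(d-1) and the isometric affine
   parametrization y |-> forg e + y *m fframe e of the hyperplane of e.
   onormal T e is only meaningful when e lies on the boundary of T. *)
Record mesh (d : nat) := Mesh {
  elem : finType;
  face : finType;
  elt : elem -> set 'rV[R]_d;
  fdom : face -> set 'rV[R]_d.-1;
  forg : face -> 'rV[R]_d;
  fframe : face -> 'M[R]_(d.-1, d);
  onormal : elem -> face -> 'rV[R]_d }.

Section mesh_notions.
Variables (d : nat) (Th : mesh d).

Definition fparam (e : face Th) (y : 'rV[R]_d.-1) : 'rV[R]_d :=
  forg e + y *m fframe e.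

Definition face_set (e : face Th) : set 'rV[R]_d := fparam e @` closure (fdom e).

Definition face_relint (e : face Th) : set 'rV[R]_d := fparam e @` fdom e.

Definition face_in (S : set 'rV[R]_d) (e : face Th) : bool :=
  `[< face_set e `<=` S >].

Definition face_of (T : elem Th) (e : face Th) : bool :=
  face_in (bdry (elt T)) e.

Definition elem_in (S : set 'rV[R]_d) (T : elem Th) : bool :=
  `[< elt T `<=` S >].

Record is_mesh (Om : set 'rV[R]_d) : Prop := IsMesh {
  elt_polytopal : forall T : elem Th, polytopal_domain (elt T);
  elt_lipschitz : forall T : elem Th, lipschitz_domain (elt T);
  elt_disjoint : forall T T' : elem Th, T != T' -> elt T `&` elt T' = set0;
  elt_cover : closure Om = \bigcup_(T in [set: elem Th]) closure (elt T);
  fdom_polytopal : forall e : face Th, polytopal_domain (fdom e);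
  fframe_isometric : forall e : face Th, fframe e *m (fframe e)^T = 1%:M;
  face_disjoint : forall e e' : face Th, e != e' ->
    face_relint e `&` face_relint e' = set0;
  elt_bdry : forall T : elem Th,
    bdry (elt T) = \bigcup_(e in [set e | face_of T e]) face_set e;
  face_shared : forall e : face Th,
    (face_relint e `<=` Om /\ #|[set T | face_of T e]%SET| = 2%N) \/
    (face_set e `<=` bdry Om /\ #|[set T | face_of T e]%SET| = 1%N);
  normal_unit : forall (T : elem Th) (e : face Th), face_of T e ->
    enorm (onormal T e) = 1;
  normal_orth : forall (T : elem Th) (e : face Th), face_of T e ->
    fframe e *m (onormal T e)^T = 0;
  normal_outward : forall (T : elem Th) (e : face Th), face_of T e ->
    forall x, face_relint e x -> exists2 eps : R, 0 < eps &
      forall t, 0 < t < eps ->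
        elt T (x - t *: onormal T e) /\ ~ elt T (x + t *: onormal T e) }.

Definition pev n (p : mpoly n R) (x : 'rV[R]_n) : R :=
  meval (fun i => x ord0 i) p.

(* msize is the total degree plus one. *)
Definition Pdeg n (r : nat) (p : mpoly n R) : bool := (msize p <= r.+1)%N.

Definition vint (T : elem Th) (h : 'rV[R]_d -> R) : R :=
  \int[lebesgue_rV d]_(x in elt T) h x.

(* Functions on a face are written in the coordinates y; the parametrization
   being isometric, this is the integral for the surface measure. *)
Definition fint (e : face Th) (h : 'rV[R]_d.-1 -> R) : R :=
  \int[lebesgue_rV d.-1]_(y in fdom e) h y.

Definition bfun := {ffun face Th -> mpoly d.-1 R}.

(* v.1 = v_0 and v.2 = v_b.  Elements of W_h(Omega_j) are also given by such a
   pair, of which only the components living on Omega_j matter. *)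
Definition wfun := ({ffun elem Th -> mpoly d R} * bfun)%type.

Variable k : nat.

Definition Qb (e : face Th) (h : 'rV[R]_d -> R) : mpoly d.-1 R :=
  xget 0 [set q | Pdeg k.-1 q /\ forall p, Pdeg k.-1 p ->
    fint e (fun y => pev q y * pev p y) =
    fint e (fun y => h (fparam e y) * pev p y)].

Definition wgrad (v : wfun) (T : elem Th) : 'rV[mpoly d R]_d :=
  xget (0 : 'rV[mpoly d R]_d) [set G | (forall i, Pdeg k.-1 (G ord0 i)) /\
    forall w : 'rV[mpoly d R]_d, (forall i, Pdeg k.-1 (w ord0 i)) ->
      vint T (fun x => \sum_i pev (G ord0 i) x * pev (w ord0 i) x) =
      - vint T (fun x => pev (v.1 T) x * pev (\sum_i mderiv i (w ord0 i)) x)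
      + \sum_(e | face_of T e) fint e (fun y => pev (v.2 e) y *
          \sum_i pev (w ord0 i) (fparam e y) * onormal T e ord0 i)].

Definition stab (T : elem Th) (u v : wfun) : R :=
  (diam (elt T))^-1 * \sum_(e | face_of T e)
    fint e (fun y => pev (Qb e (pev (u.1 T)) - u.2 e) y *
                     pev (Qb e (pev (v.1 T)) - v.2 e) y).

Record is_decomposition (Om : set 'rV[R]_d) (M : nat)
    (sub : 'I_M -> set 'rV[R]_d) : Prop := IsDecomposition {
  sub_neq0 : forall j, sub j !=set0;
  sub_open : forall j, open (sub j);
  sub_connected : forall j, connected (sub j);
  sub_disjoint : forall j i, j != i -> sub j `&` sub i = set0;
  sub_cover : closure Om = \bigcup_j closure (sub j);
  sub_elts : forall j, closure (sub j) =
    \bigcup_(T in [set T : elem Th | elem_in (sub j) T]) closure (elt T) }.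

Variables (Om : set 'rV[R]_d) (M : nat) (sub : 'I_M -> set 'rV[R]_d).

Definition Gext (j : 'I_M) : set 'rV[R]_d := bdry Om `&` bdry (sub j).

Definition Gint (j i : 'I_M) : set 'rV[R]_d := bdry (sub j) `&` bdry (sub i).

Definition adjacent_sub (j i : 'I_M) : bool :=
  (j != i) && `[< has_codim1 (Gint j i) >].

Definition sub_face (j : 'I_M) (e : face Th) : bool :=
  [exists T : elem Th, elem_in (sub j) T && face_of T e].

Definition in_Wh (j : 'I_M) (v : wfun) : Prop :=
  (forall T, elem_in (sub j) T -> Pdeg k (v.1 T)) /\
  (forall e, sub_face j e -> Pdeg k.-1 (v.2 e)).

Definition in_Wh0 (j : 'I_M) (v : wfun) : Prop :=
  in_Wh j v /\ forall e, face_in (Gext j) e -> v.2 e = 0.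

Definition in_Lambda (j i : 'I_M) (mu : bfun) : Prop :=
  forall e, face_in (Gint j i) e -> Pdeg k.-1 (mu e).

Definition Gpair (j i : 'I_M) (mu nu : bfun) : R :=
  \sum_(e | face_in (Gint j i) e) fint e (fun y => pev (mu e) y * pev (nu e) y).

(* The L2 norms on W_h(Omega_j) and Lambda_ji. *)
Definition Wnorm (j : 'I_M) (v : wfun) : R :=
  Num.sqrt (\sum_(T | elem_in (sub j) T) vint T (fun x => pev (v.1 T) x ^+ 2)
            + \sum_(e | sub_face j e) fint e (fun y => pev (v.2 e) y ^+ 2)).

Definition Lambda_norm (j i : 'I_M) (mu : bfun) : R := Num.sqrt (Gpair j i mu mu).

Variables a c f g : 'rV[R]_d -> R.

Definition dirichlet (j : 'I_M) (v : wfun) : Prop :=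
  forall e, face_in (Gext j) e -> v.2 e = Qb e g.

Definition diffusion_form (j : 'I_M) (u v : wfun) : R :=
  \sum_(T | elem_in (sub j) T) vint T (fun x => a x *
    \sum_i pev (wgrad u T ord0 i) x * pev (wgrad v T ord0 i) x).

Definition stab_form (j : 'I_M) (u v : wfun) : R :=
  \sum_(T | elem_in (sub j) T) stab T u v.

Definition reaction_form (j : 'I_M) (u v : wfun) : R :=
  \sum_(T | elem_in (sub j) T)
    vint T (fun x => c x * pev (u.1 T) x * pev (v.1 T) x).

Definition load (j : 'I_M) (v : wfun) : R :=
  \sum_(T | elem_in (sub j) T) vint T (fun x => f x * pev (v.1 T) x).

Record DD_solution (u : 'I_M -> wfun) (lam : 'I_M -> 'I_M -> bfun) : Prop := {
  DD_space : forall j, in_Wh j (u j) /\ dirichlet j (u j);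
  DD_mult : forall j i, adjacent_sub j i -> in_Lambda j i (lam j i);
  DD_local : forall j v, in_Wh0 j v ->
    diffusion_form j (u j) v + stab_form j (u j) v
    - \sum_(i | adjacent_sub j i) Gpair j i (lam j i) v.2
    + reaction_form j (u j) v = load j v;
  DD_cont : forall j (mu : 'I_M -> bfun),
    (forall i, adjacent_sub j i -> in_Lambda j i (mu i)) ->
    \sum_(i | adjacent_sub j i) Gpair j i (mu i) ((u j).2 - (u i).2) = 0;
  DD_flux : forall j i e, adjacent_sub j i -> face_in (Gint j i) e ->
    lam j i e + lam i j e = 0 }.

(* For n = 0, IT_space and IT_mult are the conditions on the initial guess. *)
Record IT_sequence (beta : R) (u : nat -> 'I_M -> wfun)
    (lam : nat -> 'I_M -> 'I_M -> bfun) : Prop := {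
  IT_space : forall n j, in_Wh j (u n j) /\ dirichlet j (u n j);
  IT_mult : forall n j i, adjacent_sub j i -> in_Lambda j i (lam n j i);
  IT_local : forall n j v, in_Wh0 j v ->
    diffusion_form j (u n.+1 j) v + stab_form j (u n.+1 j) v
    + \sum_(i | adjacent_sub j i) Gpair j i (beta *: (u n.+1 j).2) v.2
    + reaction_form j (u n.+1 j) v =
    \sum_(i | adjacent_sub j i) Gpair j i (beta *: (u n i).2 - lam n i j) v.2
    + load j v;
  IT_update : forall n j i e, adjacent_sub j i -> face_in (Gint j i) e ->
    lam n.+1 j i e =
    beta *: ((u n i).2 e - (u n.+1 j).2 e) - lam n i j e }.

End mesh_notions.

Definition coefficient_bounds d (Om : set 'rV[R]_d) (h : 'rV[R]_d -> R)
    (h0 h1 : R) : Prop :=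
  measurable_fun Om h /\ forall x, Om x -> h0 <= h x <= h1.

Definition L2_domain d (Om : set 'rV[R]_d) (f : 'rV[R]_d -> R) : Prop :=
  measurable_fun Om f /\
  (\int[lebesgue_rV d]_(x in Om) ((f x) ^+ 2)%:E < +oo)%E.

Definition L2_boundary d (Th : mesh d) (Om : set 'rV[R]_d)
    (g : 'rV[R]_d -> R) : Prop :=
  forall e : face Th, face_in (bdry Om) e ->
    measurable_fun (fdom e) (g \o fparam e) /\
    (\int[lebesgue_rV d.-1]_(y in fdom e) ((g (fparam e y)) ^+ 2)%:E < +oo)%E.

End geometry.

(* Main.v *)
(* Let e_j^n = u_j^n - u_j and theta_ji^n = lambda_ji^n - lambda_ji. The norm of
   theta_ji + beta e_j over all interfaces, squared and summed, decreases at each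
   step by 4 beta times the sum of the local energies
   A_j(e_j,e_j) = (a grad_w e_j, grad_w e_j) + s_j(e_j,e_j) + (c e_j0, e_j0),
   so these energies tend to 0. Testing the error equation with functions supported
   on one face, and comparing norms in finite dimension, gives theta_ji^n -> 0, and
   the update of the multiplier then gives e_i^n - e_j^(n+1) -> 0 on the interfaces.
   On one element, Green's formula shows that a function with zero weak gradient,
   zero trace defect and zero value on one face vanishes. Hence the elements on
   which e^n does not tend to 0 are closed under passing through a face and have no
   face on the boundary of Omega; the divergence theorem summed over such a family
   equates its volume with a sum of cancelling face terms, so the family is empty.

   The divergence theorem for polynomial fields on an element comes from Fubini's
   theorem along a generic direction, the intersection of a line with the element
   being read off from its signed crossings with the faces; the Jacobians of the
   projections of the faces are computed by affine changes of variables. *)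
Require Import Defs.
From mathcomp Require Import all_boot all_order all_algebra.
From mathcomp Require Import -(notations) mpoly.
From mathcomp Require Import all_classical all_reals all_analysis.
From mathcomp Require Import measurable_realfun measurable_fun_approximation.
From mathcomp Require Import lebesgue_integral_fubini.
From mathcomp Require Import ring lra.

Set Implicit Arguments.
Unset Strict Implicit.
Unset Printing Implicit Defensive.

Import Order.TTheory GRing.Theory Num.Theory.
Import numFieldNormedType.Exports.

Local Open Scope classical_set_scope.
Local Open Scope ring_scope.

(** * Polynomials in several variables *)

(** The local energy can vanish on a nonzero error: [c] may be zero, and a constant v_0 with the
    same constant as v_b has zero weak gradient and zero stabilizer. Decay of the energies therefore
    gives no convergence by itself; each element needs one face, an anchor, on which its error is
    already known to tend to 0. Boundary faces are anchors, and the information has to travel from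
    there to every element through faces only. Deriving such chains of elements from the
    connectedness of Omega would mean removing the skeleton of dimension d - 2 and showing that it
    does not disconnect the domain. The volume argument replaces that topological fact: it excludes
    a family of elements without outlet directly, and uses only the divergence theorem, which
    Green's formula requires anyway. Elements may be nonconvex with holes, so that theorem cannot be
    reduced to graphs over a coordinate hyperplane; counting signed crossings on one line at a time
    avoids any description of the shape. *)

Section polynomials.
Context {R : realType}.
Implicit Types (n r s : nat).

(** Constants and variables generate the ring, so stability under sums and products suffices;
    evaluation formulas, continuity, measurability and boundedness all follow this pattern. *)
Lemma mpoly_gen_ind n (P : mpoly n R -> Prop) :
  (forall c, P (mpolyC n c)) -> (forall i, P (mpolyX R (mnm1 i))) ->
  (forall p q, P p -> P q -> P (p + q)) ->
  (forall p q, P p -> P q -> P (p * q)) -> forall p, P p.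
Proof.
move=> PC PX PD PM; elim/mpolyind => [|c m p _ _ Pp].
  by rewrite -(mpolyC0 n R).
apply: PD => //; rewrite -mul_mpolyC mpolyXE_id; apply: (PM) => //.
apply: big_ind => [|p1 p2|i _]; [by rewrite -(mpolyC1 n R)|exact: PM|].
by elim: (m i) => [|e]; [rewrite expr0 -(mpolyC1 n R)|rewrite exprS; exact: PM].
Qed.

Lemma pevC n c (x : 'rV[R]_n) : pev (mpolyC n c) x = c.
Proof. exact: mevalC. Qed.

Lemma pevX n i (x : 'rV[R]_n) : pev (mpolyX R (mnm1 i)) x = x ord0 i.
Proof. exact: mevalXU. Qed.

Lemma pevD n (p q : mpoly n R) x : pev (p + q) x = pev p x + pev q x.
Proof. exact: mevalD. Qed.

Lemma pevB n (p q : mpoly n R) x : pev (p - q) x = pev p x - pev q x.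
Proof. exact: mevalB. Qed.

Lemma pevM n (p q : mpoly n R) x : pev (p * q) x = pev p x * pev q x.
Proof. exact: mevalM. Qed.

Lemma pevZ n c (p : mpoly n R) x : pev (c *: p) x = c * pev p x.
Proof. exact: mevalZ. Qed.

Lemma pev1 n (x : 'rV[R]_n) : pev 1 x = 1.
Proof. exact: meval1. Qed.

Lemma pev_sum n I (s : seq I) (P : pred I) (F : I -> mpoly n R) x :
  pev (\sum_(i <- s | P i) F i) x = \sum_(i <- s | P i) pev (F i) x.
Proof. exact: raddf_sum. Qed.

Lemma PdegP n r (p : mpoly n R) :
  reflect (forall m, (r < mdeg m)%N -> mcoeff m p = 0) (Pdeg r p).
Proof.
apply: (iffP idP) => [pr m rm|h].
  by apply/eqP; rewrite mcoeff_eq0; apply: mmeasure_mnm_ge; exact: leq_trans pr rm.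
rewrite /Pdeg mmeasureE; apply/bigmax_leqP_seq => m mp _.
by rewrite ltnS leqNgt; apply: contraTN mp => /h /eqP; rewrite mcoeff_eq0.
Qed.

Lemma Pdeg0 n r : Pdeg r (0 : mpoly n R).
Proof. by apply/PdegP => m _; rewrite mcoeff0. Qed.

Lemma PdegD n r (p q : mpoly n R) : Pdeg r p -> Pdeg r q -> Pdeg r (p + q).
Proof.
move=> /PdegP pr /PdegP qr; apply/PdegP => m rm.
by rewrite mcoeffD pr// qr// addr0.
Qed.

Lemma PdegZ n r c (p : mpoly n R) : Pdeg r p -> Pdeg r (c *: p).
Proof. by move=> /PdegP pr; apply/PdegP => m rm; rewrite mcoeffZ pr// mulr0. Qed.

Lemma PdegN n r (p : mpoly n R) : Pdeg r p -> Pdeg r (- p).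
Proof. by move=> pr; rewrite -scaleN1r; exact: PdegZ. Qed.

Lemma PdegB n r (p q : mpoly n R) : Pdeg r p -> Pdeg r q -> Pdeg r (p - q).
Proof. by move=> pr qr; apply: PdegD => //; exact: PdegN. Qed.

Lemma Pdeg_sum n r I (s : seq I) (P : pred I) (F : I -> mpoly n R) :
  (forall i, P i -> Pdeg r (F i)) -> Pdeg r (\sum_(i <- s | P i) F i).
Proof.
by move=> h; apply: (big_ind (fun p => Pdeg r p)) => //; [exact: Pdeg0|move=> p q; exact: PdegD].
Qed.

Lemma PdegC n r c : Pdeg r (mpolyC n c : mpoly n R).
Proof. by rewrite /Pdeg mmeasureC; case: (c != 0). Qed.

Lemma PdegM n r s (p q : mpoly n R) : Pdeg r p -> Pdeg s q -> Pdeg (r + s) (p * q).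
Proof.
have [->|p0] := eqVneq p 0; first by move=> _ _; rewrite mul0r; exact: Pdeg0.
have [->|q0] := eqVneq q 0; first by move=> _ _; rewrite mulr0; exact: Pdeg0.
rewrite /Pdeg => pr qs; rewrite msizeM//.
by rewrite -subn1 leq_subLR add1n -addSn -addnS; exact: leq_add.
Qed.

Lemma Pdeg_mderiv n r (p : mpoly n R) i : Pdeg r p -> Pdeg r.-1 (mderiv i p).
Proof.
move=> /PdegP pr; apply/PdegP => m rm; rewrite mcoeff_mderiv pr ?mul0rn//.
by rewrite mdegD mdeg1 addn1; case: r rm {pr} => // r; rewrite ltnS.
Qed.

Lemma Pdeg_le n r s (p : mpoly n R) : (r <= s)%N -> Pdeg r p -> Pdeg s p.
Proof. by rewrite /Pdeg => rs /leq_trans; apply; rewrite ltnS. Qed.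

Lemma PdegE n r (p : mpoly n R) : Pdeg r p ->
  p = \sum_(m : bmultinom n r.+1) mcoeff m p *: mpolyX R m.
Proof. exact: mpolywE. Qed.

(** Substitution at the level of polynomials: the restriction to a face must again be a polynomial,
    of no larger degree, in the coordinates of the face. *)
Definition pcomp_affine m n (A : 'M[R]_(m, n)) (b : 'rV[R]_n) (p : mpoly n R) :
    mpoly m R :=
  mmap (@mpolyC m R)
    (fun j => \sum_i A i j *: mpolyX R (mnm1 i) + mpolyC m (b ord0 j)) p.

Lemma pcomp_affineD m n (A : 'M[R]_(m, n)) b p q :
  pcomp_affine A b (p + q) = pcomp_affine A b p + pcomp_affine A b q.
Proof. exact: mmapD. Qed.

Lemma pcomp_affineM m n (A : 'M[R]_(m, n)) b p q :
  pcomp_affine A b (p * q) = pcomp_affine A b p * pcomp_affine A b q.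
Proof. exact: (mmap_is_multiplicative _ _).1. Qed.

Lemma pev_comp_affine m n (A : 'M[R]_(m, n)) b p y :
  pev (pcomp_affine A b p) y = pev p (y *m A + b).
Proof.
elim/mpoly_gen_ind: p => [c|i|p q hp hq|p q hp hq].
- by rewrite /pcomp_affine mmapC !pevC.
- rewrite /pcomp_affine mmapX mmap1U pevX pevD pevC !mxE pev_sum.
  by congr (_ + _); apply: eq_bigr => j _; rewrite pevZ pevX mulrC.
- by rewrite pcomp_affineD pevD hp hq pevD.
- by rewrite pcomp_affineM pevM hp hq pevM.
Qed.

Lemma pcomp_affineZ m n (A : 'M[R]_(m, n)) b c p :
  pcomp_affine A b (c *: p) = c *: pcomp_affine A b p.
Proof. by rewrite /pcomp_affine mmapZ mul_mpolyC. Qed.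

Lemma Pdeg_comp_affine m n (A : 'M[R]_(m, n)) b r p :
  Pdeg r p -> Pdeg r (pcomp_affine A b p).
Proof.
move=> pr; rewrite (PdegE pr) /pcomp_affine raddf_sum; apply: Pdeg_sum => k _.
rewrite /= mmapZ mul_mpolyC; apply: PdegZ; rewrite mmapX /mmap1.
have kr : (mdeg k <= r)%N by rewrite -ltnS bmdeg.
apply: (Pdeg_le kr); rewrite mdegE.
elim: (index_enum _) => [|i s IH]; first by rewrite !big_nil -(mpolyC1 m R) PdegC.
rewrite !big_cons; apply: PdegM => //.
elim: (_ i) => [|e IHe]; first by rewrite expr0 -(mpolyC1 m R) PdegC.
rewrite exprS -add1n; apply: PdegM => //; apply: PdegD; last exact: PdegC.
by apply: Pdeg_sum => j _; apply: PdegZ; rewrite /Pdeg msizeX mdeg1.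
Qed.

(** The restriction to a line as a univariate polynomial, which gives access to root counting and to
    the fundamental theorem of calculus. *)
Definition line_poly n (x v : 'rV[R]_n) (p : mpoly n R) : {poly R} :=
  mmap polyC (fun i => (x ord0 i)%:P + v ord0 i *: 'X) p.

Lemma line_polyD n (x v : 'rV[R]_n) : {morph line_poly x v : p q / p + q}.
Proof. by move=> p q; exact: mmapD. Qed.

Lemma line_polyM n (x v : 'rV[R]_n) : {morph line_poly x v : p q / p * q}.
Proof. exact: (mmap_is_multiplicative _ _).1. Qed.

Lemma horner_line_poly n (x v : 'rV[R]_n) p t :
  (line_poly x v p).[t] = pev p (x + t *: v).
Proof.
elim/mpoly_gen_ind: p => [c|i|p q hp hq|p q hp hq].
- by rewrite /line_poly mmapC pevC hornerC.
- by rewrite /line_poly mmapX mmap1U pevX !hornerE !mxE mulrC.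
- by rewrite line_polyD hornerD hp hq pevD.
- by rewrite line_polyM hornerM hp hq pevM.
Qed.

Definition pderiv n (v : 'rV[R]_n) (p : mpoly n R) : mpoly n R :=
  \sum_i v ord0 i *: mderiv i p.

Lemma deriv_line_poly n (x v : 'rV[R]_n) p :
  (line_poly x v p)^`() = line_poly x v (pderiv v p).
Proof.
elim/mpoly_gen_ind: p => [c|i|p q hp hq|p q hp hq].
- rewrite /line_poly mmapC derivC /pderiv big1 ?mmap0// => i _.
  by rewrite mderivC scaler0.
- rewrite [in LHS]/line_poly mmapX mmap1U derivD derivC derivZ derivX add0r.
  rewrite /pderiv (bigD1 i)//= mderivX mnm1E eqxx big1 ?addr0; last first.
    move=> j ji; rewrite mderivX mnm1E eq_sym (negbTE ji) scale0r scaler0//.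
  have -> : mnm_sub (mnm1 i) (mnm1 i) = mnm0 by apply/mnmP => k; rewrite mnmBE subnn mnm0E.
  by rewrite mpolyX0 scale1r /line_poly mmapZ (mmap_is_multiplicative _ _).2 mulr1 alg_polyC.
- rewrite line_polyD derivD hp hq -line_polyD; congr line_poly.
  by rewrite /pderiv -big_split; apply: eq_bigr => i _; rewrite mderivD scalerDr.
- rewrite line_polyM derivM hp hq -!line_polyM -line_polyD; congr line_poly.
  rewrite /pderiv mulr_suml mulr_sumr -big_split; apply: eq_bigr => i _.
  by rewrite mderivM scalerDr -scalerAl -scalerAr.
Qed.

Lemma poly_horner_eq0 (q : {poly R}) : (forall x, q.[x] = 0) -> q = 0.
Proof.
move=> q0; apply: (@roots_geq_poly_eq0 _ _ [seq i%:R | i <- iota 0 (size q)]).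
- by apply/allP => t _; rewrite /root q0.
- by rewrite map_inj_uniq ?iota_uniq//; exact: mulrIn (oner_neq0 _).
- by rewrite size_map size_iota.
Qed.

(** In characteristic 0 the coefficients are recovered by differentiation: induction on the degree
    of the monomial, the constant coefficient being the value at 0. *)
Lemma mpoly_eq0 n (p : mpoly n R) : (forall x, pev p x = 0) -> p = 0.
Proof.
move=> p0; apply/mpolyP => m; rewrite mcoeff0.
elim: {m}(mdeg m) {1 3}m (erefl (mdeg m)) p p0 => [|d IH] m md p p0.
  have -> : m = mnm0 by apply/eqP; rewrite -mdeg_eq0 md.
  have := p0 0; rewrite /pev mevalE; rewrite [in X in _ -> X](mpolyE p).
  rewrite raddf_sum /= => h; rewrite -[RHS]h; apply: eq_bigr => k _.
  rewrite mcoeffZ mcoeffX; congr (_ * _).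
  have [->|k0] := eqVneq k mnm0; first by rewrite big1// => i _; rewrite mnm0E.
  have /existsP[i ki] : [exists i, k i != 0%N].
    apply: contraNT k0; rewrite negb_exists => /forallP h'.
    by apply/eqP/mnmP => i; rewrite mnm0E; apply/eqP; move: (h' i); rewrite negbK.
  by rewrite (bigD1 i)//= mxE expr0n (negbTE ki) mul0r.
have /existsP[i mi] : [exists i, m i != 0%N].
  rewrite -negb_forall; apply/negP => /forallP h.
  by move: md; rewrite mdegE big1// => i _; exact/eqP.
have mE : mnm_add (mnm_sub m (mnm1 i)) (mnm1 i) = m.
  apply: submK; apply/mnm_lepP => j; rewrite mnm1E.
  by have [<-|//] := eqVneq i j; rewrite lt0n.
(* The partial derivative is again the zero function, since [p] vanishes on every line in direction
   [i]; its coefficient at m - e_i is m_i times that of [p] at m. *)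
have : mcoeff (mnm_sub m (mnm1 i)) (mderiv i p) = 0.
  apply: IH; first by move: md; rewrite -{1}mE mdegD mdeg1 addn1 => -[].
  move=> x; pose e : 'rV[R]_n := delta_mx ord0 i.
  have -> : mderiv i p = pderiv e p.
    rewrite /pderiv (bigD1 i)//= mxE !eqxx scale1r big1 ?addr0// => j ji.
    by rewrite mxE (negbTE ji) andbF scale0r.
  have lp0 : line_poly x e p = 0.
    by apply: poly_horner_eq0 => t; rewrite horner_line_poly p0.
  have := horner_line_poly x e (pderiv e p) 0; rewrite scale0r addr0 => <-.
  by rewrite -deriv_line_poly lp0 deriv0 horner0.
rewrite mcoeff_mderiv mE => /eqP; rewrite -mulr_natr mulf_eq0 pnatr_eq0 orbF.
by move/eqP.
Qed.

Lemma mpoly_const m (p : mpoly m R) : (forall i, mderiv i p = 0) ->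
  p = mcoeff mnm0 p *: 1.
Proof.
move=> dp; apply/mpolyP => w; rewrite mcoeffZ mcoeff1.
have [->|w0] := eqVneq w mnm0; first by rewrite mulr1.
have [i wi] : exists i, w i != 0%N.
  apply: contrapT => /forallNP h; move/eqP: w0; apply; apply/mnmP => i.
  by rewrite mnm0E; apply/eqP; have /negP := h i; rewrite negbK.
have wE : mnm_add (mnm_sub w (mnm1 i)) (mnm1 i) = w.
  apply: submK; apply/mnm_lepP => j; rewrite mnm1E.
  by have [<-|//] := eqVneq i j; rewrite lt0n.
have := mcoeff_mderiv i p (mnm_sub w (mnm1 i)); rewrite dp mcoeff0 wE => /esym/eqP.
by rewrite -[X in X == _]mulr_natr mulf_eq0 pnatr_eq0 orbF => /eqP ->; rewrite mulr0.
Qed.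

End polynomials.

(** * Linear and bilinear forms *)

Lemma cvg0_sum {R : realType} I (s : seq I) (P : pred I) (F : I -> nat -> R) :
  (forall i, P i -> F i n @[n --> \oo] --> (0 : R)) ->
  (\sum_(i <- s | P i) F i n) @[n --> \oo] --> (0 : R).
Proof.
move=> F0; elim: s => [|i s IH].
  by under eq_cvg do rewrite big_nil; exact: cvg_cst.
under eq_cvg do rewrite big_cons.
case: (boolP (P i)) => Pi //.
have := cvgD (F0 i Pi) IH; rewrite addr0. exact.
Qed.

Section linear_forms.
Context {R : realType} {V : lmodType R}.

Definition linear_form (l : V -> R) := forall c x y, l (c *: x + y) = c * l x + l y.

Section theory.
Variables (l : V -> R) (hl : linear_form l).

Lemma lform0 : l 0 = 0.
Proof. by have := hl (-1) 0 0; rewrite scaler0 addr0 mulN1r addNr. Qed.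

Lemma lformD x y : l (x + y) = l x + l y.
Proof. by rewrite -[x]scale1r hl mul1r scale1r. Qed.

Lemma lformZ c x : l (c *: x) = c * l x.
Proof. by rewrite -[c *: x]addr0 hl lform0 addr0. Qed.

Lemma lformB x y : l (x - y) = l x - l y.
Proof. by rewrite -scaleN1r lformD lformZ mulN1r. Qed.

Lemma lform_sum I (s : seq I) (P : pred I) (F : I -> V) :
  l (\sum_(i <- s | P i) F i) = \sum_(i <- s | P i) l (F i).
Proof. by apply: (big_morph l lformD lform0). Qed.

End theory.

Record psd_form (B : V -> V -> R) : Prop := PsdForm {
  psd_linear : forall x, linear_form (B x);
  psd_sym : forall x y, B x y = B y x;
  psd_ge0 : forall x, 0 <= B x x }.

Lemma psd_cauchy_schwarz B x y : psd_form B -> (B x y) ^+ 2 <= B x x * B y y.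
Proof.
move=> [Bl Bs B0].
have E s : B (s *: x + y) (s *: x + y) = s ^+ 2 * B x x + 2 * s * B x y + B y y.
  rewrite Bl (Bs _ x) (Bs _ y) !Bl (Bs y x); ring.
have [x0|x0] := eqVneq (B x x) 0.
  suff -> : B x y = 0 by rewrite expr0n/= x0 mul0r.
  apply: contrapT => /eqP xy0.
  (* With [B x x = 0] the quadratic is affine in the scalar, and this scalar gives it the value
     -1. *)
  have := B0 ((- (B y y + 1) / (2 * B x y)) *: x + y); rewrite E x0 mulr0 add0r.
  rewrite (_ : 2 * _ * _ = - (B y y + 1)); last by field.
  by rewrite opprD addrAC addNr add0r ler0N1.
have x_gt0 : 0 < B x x by rewrite lt0r x0 B0.
(* The scalar that minimizes the quadratic. *)
have := B0 (- (B x y / B x x) *: x + y); rewrite E.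
rewrite (_ : _ + _ = (B x x * B y y - B x y ^+ 2) / B x x); last by field.
by rewrite pmulr_lge0 ?invr_gt0// subr_ge0.
Qed.

Lemma psd_cvg0 B (x_ : nat -> V) y : psd_form B ->
  (fun n => B (x_ n) (x_ n)) @ \oo --> (0 : R) ->
  (fun n => B (x_ n) y) @ \oo --> (0 : R).
Proof.
move=> hB x0; apply/cvgr0Pnorm_lt => e e0.
(* Adding 1 keeps the divisor positive when [B y y] is 0. *)
have D_gt0 : 0 < B y y + 1 by apply: ltr_wpDl => //; exact: psd_ge0.
have /cvgr0Pnorm_lt/(_ (e ^+ 2 / (B y y + 1))) := x0.
move=> /(_ (divr_gt0 (exprn_gt0 _ e0) D_gt0)); apply: filterS => n.
rewrite ger0_norm; last exact: psd_ge0.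
move=> h; rewrite -ltr_sqr ?nnegrE ?normr_ge0 ?ltW// real_normK ?num_real//.
apply: le_lt_trans (psd_cauchy_schwarz _ _ hB) _.
move: h; rewrite ltr_pdivlMr//; apply: le_lt_trans.
by apply: ler_wpM2l; [exact: psd_ge0|rewrite lerDl].
Qed.

End linear_forms.

(** * Riesz representation and convergence for polynomials of bounded degree *)

Section riesz.
Context {R : realType}.

(** Fredholm alternative: [l] lies in the row space of the Gram matrix once it vanishes on the
    kernel, and a kernel vector [c] makes the quadratic form vanish, so the hypothesis applies to
    it. *)
Lemma riesz_fin (I : finType) (G : I -> I -> R) (l : I -> R) :
  (forall c : I -> R, \sum_i \sum_j c i * c j * G i j = 0 ->
    \sum_i c i * l i = 0) ->
  exists w : I -> R, forall i, \sum_j w j * G j i = l i.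
Proof.
move=> h.
pose M : 'M[R]_#|I| := \matrix_(i, j) G (enum_val i) (enum_val j).
pose lr : 'rV[R]_#|I| := \row_i l (enum_val i).
have sumE (F : I -> R) : \sum_i F i = \sum_(i < #|I|) F (enum_val i).
  by rewrite (reindex (@enum_val _ I))//; apply/onW_bij/enum_val_bij.
suff /submxP[W lrE] : (lr <= M)%MS.
  exists (fun i => W ord0 (enum_rank i)) => i; rewrite sumE.
  have := congr1 (fun A : 'rV_ _ => A ord0 (enum_rank i)) lrE.
  rewrite !mxE enum_rankK => ->; apply: eq_bigr => j _.
  by rewrite !mxE enum_valK enum_rankK.
rewrite submxE; apply/eqP/rowP => k; rewrite [RHS]mxE.
have := h (fun i => cokermx M (enum_rank i) k).
have -> : \sum_i \sum_j cokermx M (enum_rank i) k * cokermx M (enum_rank j) k * G i j = 0.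
  rewrite sumE big1// => i _; rewrite sumE.
  transitivity (cokermx M i k * (M *m cokermx M) i k).
    rewrite [X in _ * X]mxE mulr_sumr; apply: eq_bigr => j _.
    by rewrite !enum_valK [M _ _]mxE -mulrA; congr (_ * _); rewrite mulrC.
  by rewrite mulmx_coker [X in _ * X]mxE mulr0.
move=> /(_ erefl); rewrite sumE => h0; rewrite [LHS]mxE -[RHS]h0; apply: eq_bigr => i _.
by rewrite enum_valK [lr _ _]mxE mulrC.
Qed.

(** Definiteness on P_r makes the Gram system of the monomials solvable. Existence of [Qb] and of
    the weak gradient rests on this. *)
Lemma riesz_mpoly n r (B : mpoly n R -> mpoly n R -> R) (l : mpoly n R -> R) :
  (forall p, linear_form (B p)) -> (forall q, linear_form (B^~ q)) ->
  (forall p, Pdeg r p -> B p p = 0 -> p = 0) -> linear_form l ->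
  exists2 w, Pdeg r w & forall p, Pdeg r p -> B w p = l p.
Proof.
move=> Bl Br Bdef hl.
pose X (m : bmultinom n r.+1) : mpoly n R := mpolyX R m.
have Xr m : Pdeg r (X m) by rewrite /Pdeg msizeX; exact: bmdeg.
have cr (c : bmultinom n r.+1 -> R) : Pdeg r (\sum_m c m *: X m).
  by apply: Pdeg_sum => m _; exact: PdegZ.
have [c hc|w hw] := @riesz_fin _ (fun i j => B (X i) (X j)) (fun i => l (X i)).
  have : \sum_i c i *: X i = 0.
    apply: Bdef => //; rewrite -[RHS]hc (lform_sum (Br _)); apply: eq_bigr => i _.
    rewrite (lformZ (Br _)) (lform_sum (Bl _)) mulr_sumr; apply: eq_bigr => j _.
    by rewrite (lformZ (Bl _)) mulrA.
  move=> /(congr1 l); rewrite (lform0 hl) (lform_sum hl) => {2}<-.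
  by apply: eq_bigr => i _; rewrite (lformZ hl).
exists (\sum_m w m *: X m) => // p /PdegE ->.
rewrite (lform_sum (Bl _)) (lform_sum hl); apply: eq_bigr => m _.
rewrite (lformZ (Bl _)) (lformZ hl) -hw (lform_sum (Br _)); congr (_ * _).
by apply: eq_bigr => j _; rewrite (lformZ (Br _)).
Qed.

(** Every functional on P_r is the pairing with some [w] in P_r, so testing against P_r tests all
    functionals. *)
Lemma weak_cvg_mpoly n r (B : mpoly n R -> mpoly n R -> R) (p_ : nat -> mpoly n R) :
  (forall p, linear_form (B p)) -> (forall q, linear_form (B^~ q)) ->
  (forall p, Pdeg r p -> B p p = 0 -> p = 0) -> (forall i, Pdeg r (p_ i)) ->
  (forall q, Pdeg r q -> (fun i => B (p_ i) q) @ \oo --> (0 : R)) ->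
  forall l, linear_form l -> (fun i => l (p_ i)) @ \oo --> (0 : R).
Proof.
move=> Bl Br Bdef pr hB l hl.
have [w wr hw] := @riesz_mpoly n r (fun p q => B q p) l Br Bl Bdef hl.
rewrite (_ : (fun _ => _) = fun i => B (p_ i) w); first exact: hB.
by apply/funext => i; rewrite -hw.
Qed.

Lemma quadratic_cvg_mpoly n r (Q : mpoly n R -> mpoly n R -> R)
    (p_ : nat -> mpoly n R) :
  (forall p, linear_form (Q p)) -> (forall q, linear_form (Q^~ q)) ->
  (forall i, Pdeg r (p_ i)) ->
  (forall l, linear_form l -> (fun i => l (p_ i)) @ \oo --> (0 : R)) ->
  (fun i => Q (p_ i) (p_ i)) @ \oo --> (0 : R).
Proof.
move=> Ql Qr pr h.
rewrite (_ : (fun _ => _) = fun i => \sum_(m : bmultinom n r.+1)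
    (mcoeff m (p_ i) * Q (p_ i) (mpolyX R m))); last first.
  apply/funext => i; rewrite {2}(PdegE (pr i)) (lform_sum (Ql _)).
  by apply: eq_bigr => m _; rewrite (lformZ (Ql _)).
apply: cvg0_sum => m _.
have m0 : linear_form (mcoeff (R := R) (m : multinom n)).
  by move=> c x y; rewrite mcoeffD mcoeffZ.
have := cvgM (h _ m0) (h _ (Qr (mpolyX R m))); rewrite mulr0; exact.
Qed.

End riesz.

(** * Lebesgue measure and linear changes of variables *)

Section lebesgue_line.
Context {R : realType}.
Local Notation mu := (@lebesgue_measure R).

Lemma measurable_affine (a b : R) :
  measurable_fun setT (fun t : measurableTypeR R => a * t + b : measurableTypeR R).
Proof. by apply: measurable_funD => //; exact: measurable_funM. Qed.

(** Both sides are measures in [E], so uniqueness of Lebesgue measure reduces the claim to half-open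
    intervals. *)
Lemma lebesgue_affine (a b : R) (E : set (measurableTypeR R)) : a != 0 ->
  measurable E -> (`|a|%:E * mu ((fun t => (a * t + b)%R) @^-1` E) = mu E)%E.
Proof.
move=> a0 mE.
pose phi (t : measurableTypeR R) : measurableTypeR R := (a * t + b)%R.
have mphi : measurable_fun setT phi by exact: measurable_affine.
pose nu0 := mscale (NngNum (normr_ge0 a))
  [the measure _ _ of pushforward mu phi].
pose nu := nu0 mphi.
rewrite -/phi (_ : (_ * _)%E = nu E)//; apply/esym/lebesgue_measure_unique => //.
move=> _ [[x y]] _ <-; rewrite lebesgue_measure_itv/= lte_fin.
rewrite -[RHS]/(`|a|%:E * mu (phi @^-1` `]x, y]%classic))%E.
have [a_gt0|a_lt0|/eqP] := ltgtP 0 a; last by rewrite eq_sym (negbTE a0).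
  rewrite [X in (_ * mu X)%E](_ : _ = `](x - b) / a, (y - b) / a]%classic); last first.
    apply/seteqP; split=> t /=; rewrite !in_itv/= /phi;
    by rewrite ltr_pdivrMr// ler_pdivlMr// ltrBlDr lerBrDr mulrC.
  rewrite lebesgue_measure_itv/= lte_fin ltr_pM2r ?invr_gt0// ltrD2r.
  case: ifP => xy; last by rewrite mule0.
  by rewrite -!EFinD -EFinM gtr0_norm//; congr EFin; field.
(* A negative slope reverses the interval, so the closed end changes sides. *)
rewrite [X in (_ * mu X)%E](_ : _ = `[(y - b) / a, (x - b) / a[%classic); last first.
  apply/seteqP; split=> t /=; rewrite !in_itv/= /phi;
  by rewrite ltr_ndivlMr// ler_ndivrMr// ltrBlDr lerBrDr mulrC => /andP[-> ->].
rewrite lebesgue_measure_itv/= lte_fin ltr_nM2r ?invr_lt0// ltrD2r.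
case: ifP => xy; last by rewrite mule0.
by rewrite -!EFinD -EFinM ltr0_norm//; congr EFin; field.
Qed.

End lebesgue_line.

(** * Integrals under a map that scales the measure by a constant *)

Section change_of_variables.
Local Open Scope ereal_scope.
Context d (T : measurableType d) (R : realType).
Variables (mu : {measure set T -> \bar R}) (phi : T -> T) (c : R).
Hypotheses (mphi : measurable_fun setT phi) (c_ge0 : (0 <= c)%R).
Hypothesis mu_phi : forall E, measurable E -> c%:E * mu (phi @^-1` E) = mu E.

Lemma ge0_integral_change (g : T -> \bar R) : measurable_fun setT g ->
  (forall x, 0 <= g x) -> c%:E * \int[mu]_x g (phi x) = \int[mu]_x g x.
Proof.
move=> mg g0.
transitivity (c%:E * \int[pushforward mu phi]_y g y).
  by rewrite ge0_integral_pushforward.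
rewrite -(@ge0_integral_mscale _ _ _ _ setT measurableT (NngNum c_ge0))//.
by apply: eq_measure_integral => E mE _; rewrite -mu_phi.
Qed.

Lemma integrable_change (g : T -> \bar R) : (0 < c)%R ->
  mu.-integrable setT g -> mu.-integrable setT (g \o phi).
Proof.
move=> c_gt0 /integrableP[mg ig]; apply/integrableP; split; first exact: measurableT_comp.
move: ig; rewrite -ge0_integral_change//; last exact: measurableT_comp.
rewrite !ltey; apply: contra => /eqP ->; by rewrite gt0_muley ?lte_fin.
Qed.

Lemma integral_change (g : T -> \bar R) : (0 < c)%R ->
  mu.-integrable setT g -> c%:E * \int[mu]_x g (phi x) = \int[mu]_x g x.
Proof.
move=> c_gt0 ig; have := integrable_change c_gt0 ig.
have /integrableP[mg _] := ig => igphi.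
rewrite [X in _ * X]integralE muleBr//; last exact: integrable_add_def.
rewrite [RHS]integralE -(@ge0_integral_change g^\+)//; last exact: measurable_funepos.
rewrite -(@ge0_integral_change g^\-)//; last exact: measurable_funeneg.
by rewrite funepos_comp funeneg_comp.
Qed.

End change_of_variables.

(** * Fubini and affine changes of variables in R^n *)

Section lebesgue_rV_theory.
Context {R : realType}.
Local Notation mu := (@lebesgue_measure R).
Local Notation L := (@lebesgue_rV R).

Lemma measurable_cons n (E : set 'rV[R]_n.+1) :
  measurable E -> measurable (@consrV R n @^-1` E).
Proof. by move=> mE; rewrite -[X in measurable X]setTI; exact: measurable_consrV. Qed.

Lemma measurable_cons1 n (E : set 'rV[R]_n.+1) t :
  measurable E -> measurable [set y : 'rV[R]_n | E (consrV (t, y))].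
Proof.
move=> /measurable_cons/(@measurable_xsection _ _ _ _ _ t).
by congr (measurable _); apply/seteqP; split=> y /=; rewrite /xsection/= inE.
Qed.

Lemma measurable_cons2 n (E : set 'rV[R]_n.+1) y :
  measurable E -> measurable [set t : measurableTypeR R | E (consrV (t, y))].
Proof.
move=> /measurable_cons/(@measurable_ysection _ _ _ _ _ y).
by congr (measurable _); apply/seteqP; split=> t /=; rewrite /ysection/= inE.
Qed.

Lemma lebesgue_rV_cons1 n (E : set 'rV[R]_n.+1) : measurable E ->
  L n.+1 E = (\int[mu]_t L n [set y | E (consrV (t, y))])%E.
Proof.
move=> mE; apply: eq_integral => t _ /=; congr (L n _).
by apply/seteqP; split=> y /=; rewrite /xsection/= inE.
Qed.

(** The measure is built by slicing along the first coordinate; uniqueness of the product measure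
    allows the opposite order. *)
Lemma lebesgue_rV_cons2 n (E : set 'rV[R]_n.+1) : measurable E ->
  L n.+1 E = (\int[L n]_y mu [set t | E (consrV (t, y))])%E.
Proof.
move=> mE; rewrite -[LHS]/((mu \x L n) (@consrV R n @^-1` E))%E.
rewrite (@product_measure_unique _ _ _ _ _ mu (L n) (mu \x^ L n)%E); first last.
- exact: measurable_cons.
- by move=> A B mA mB; exact: product_measure2E.
apply: eq_integral => y _ /=; congr (mu _).
by apply/seteqP; split=> t /=; rewrite /ysection/= inE.
Qed.

Lemma measurable_lebesgue_rV_cons1 n (E : set 'rV[R]_n.+1) : measurable E ->
  measurable_fun setT (fun t : measurableTypeR R => L n [set y | E (consrV (t, y))]).
Proof.
move=> mE; have := measurable_fun_xsection (L n) (measurable_cons mE).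
congr (measurable_fun _ _); apply/funext => t /=; congr (L n _).
by apply/seteqP; split=> y /=; rewrite /xsection/= inE.
Qed.

Lemma lebesgue_rV_fubini n (h : 'rV[R]_n.+1 -> \bar R) :
  (L n.+1).-integrable setT h ->
  (mu \x L n)%E.-integrable setT (h \o @consrV R n) /\
  (\int[L n.+1]_x h x = \int[L n]_y \int[mu]_t h (consrV (t, y)))%E.
Proof.
move=> /integrableP[mh ih].
have mhc : measurable_fun setT (h \o @consrV R n).
  by apply: measurableT_comp => //; exact: measurable_consrV.
have ihc : (mu \x L n)%E.-integrable setT (h \o @consrV R n).
  apply/integrableP; split=> //; move: ih; apply: le_lt_trans.
  rewrite -[leRHS]/(\int[pushforward (mu \x L n)%E (@consrV R n)]_x `|h x|)%E.
  rewrite (ge0_integral_pushforward (@measurable_consrV R n))//.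
  exact: measurableT_comp.
split=> //.
rewrite -[LHS]/(\int[pushforward (mu \x L n)%E (@consrV R n)]_x h x)%E.
rewrite (@integral_pushforward _ _ _ _ _ _ (@measurable_consrV R n) (mu \x L n)%E
  setT h mh ihc measurableT).
by rewrite -(integral21_prod_meas1 ihc).
Qed.

Lemma measurable_affine_rV m n (A : 'M[R]_(m, n)) b :
  measurable_fun setT (fun y : 'rV[R]_m => y *m A + b).
Proof.
apply: measurable_fun_rVP => i.
rewrite (_ : (fun _ => _) =
    fun y : 'rV[R]_m => \sum_(j <- index_enum 'I_m) y ord0 j * A j i + b ord0 i).
  apply: measurable_funD => //; apply: measurable_sum => j.
  by apply: measurable_funM => //; exact: measurable_rV_coord.
by apply/funext => y; rewrite !mxE.
Qed.

Lemma measurable_mul_rV m n (A : 'M[R]_(m, n)) :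
  measurable_fun setT (fun y : 'rV[R]_m => y *m A).
Proof.
by rewrite (_ : (fun _ => _) = fun y => y *m A + 0);
  [exact: measurable_affine_rV|apply/funext => y; rewrite addr0].
Qed.

(** The affine form [affP] is the inductive statement, because the slices of an upper block factor
    are translated; the left factor of a product is only needed without translation, which is
    [mulP]. *)
Let mulP n (A : 'M[R]_n) := forall E, measurable E ->
  (`|\det A|%:E * L n ((fun y => y *m A) @^-1` E) = L n E)%E.

Let affP n (A : 'M[R]_n) := forall b E, measurable E ->
  (`|\det A|%:E * L n ((fun y => y *m A + b)%R @^-1` E) = L n E)%E.

Let affP_mul n (A B : 'M[R]_n) : mulP A -> affP B -> affP (A *m B).
Proof.
move=> hA hB b E mE; rewrite det_mulmx normrM mulrC EFinM -muleA.
rewrite (_ : _ @^-1` E = (fun y => y *m A) @^-1` ((fun y => y *m B + b) @^-1` E)).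
  by rewrite hA ?hB// -[X in measurable X]setTI; exact: measurable_affine_rV.
by apply/seteqP; split=> y /=; rewrite mulmxA.
Qed.

Let affP_mulP n (A : 'M[R]_n) : affP A -> mulP A.
Proof.
move=> hA E mE; rewrite -[RHS](hA 0)//; congr (_ * L n _)%E.
by apply/seteqP; split=> y /=; rewrite addr0.
Qed.

Lemma consrV_mul_ublock n (a t : R) (w y : 'rV[R]_n) (S : 'M[R]_n) b :
  consrV (t, y) *m (block_mx (a%:M : 'M[R]_1) w 0 S : 'M[R]_(1 + n)) + b =
  consrV (a * t + b ord0 ord0, y *m S + (t *: w + rsubmx (b : 'rV[R]_(1 + n)))).
Proof.
rewrite /consrV/= (mul_row_block (t%:M : 'M[R]_1)).
rewrite -[X in _ + X](@hsubmxK _ 1 1 n) (@add_row_mx _ 1 1 n) mulmx0 addr0.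
rewrite mul_scalar_mx addrA [y *m S + _]addrC mul_scalar_mx; congr row_mx.
apply/rowP => i; rewrite !ord1 !mxE/= !mulr1n mulrC; congr (_ + b _ _).
exact/val_inj.
Qed.

Lemma consrV_mul_lblock n (t : R) (y : 'rV[R]_n) (c : 'cV[R]_n) :
  consrV (t, y) *m (block_mx (1%:M : 'M[R]_1) 0 c 1%:M : 'M[R]_(1 + n)) =
  consrV (1 * t + (y *m c) ord0 ord0, y).
Proof.
rewrite /consrV/= (mul_row_block (t%:M : 'M[R]_1)) !mulmx1 mulmx0 add0r mul1r.
by congr row_mx; apply/rowP => i; rewrite !ord1 !mxE/= !mulr1n.
Qed.

(** For fixed [t] the slice undergoes an affine map with matrix [S], while [t] undergoes one with
    slope [a]. *)
Let affP_ublock n (a : R) (w : 'rV[R]_n) (S : 'M[R]_n) : a != 0 -> affP S ->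
  affP (block_mx (a%:M : 'M[R]_1) w 0 S : 'M[R]_(1 + n)).
Proof.
move=> a0 hS b E mE.
rewrite lebesgue_rV_cons1; last first.
  by rewrite -[X in measurable X]setTI; exact: measurable_affine_rV.
rewrite lebesgue_rV_cons1// det_ublock det_scalar1 normrM EFinM.
pose G (t : measurableTypeR R) := L n [set y | E (consrV (t, y))].
have mG : measurable_fun setT G by exact: measurable_lebesgue_rV_cons1.
rewrite -[RHS](@ge0_integral_change _ _ _ mu (fun t => a * t + b ord0 ord0)%R `|a|)//;
  last 2 first.
- exact: measurable_affine.
- by move=> X mX; exact: lebesgue_affine.
rewrite -muleA; congr (_ * _)%E.
have mE' t : measurable [set y : 'rV[R]_n | E (consrV (t, y))].
  exact: measurable_cons1.
have GE t : (`|\det S|%:E * L n [set y |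
    ((fun y => (y *m (block_mx (a%:M : 'M[R]_1) w 0 S : 'M[R]_(1 + n)) + b)%R) @^-1` E)
      (consrV (t, y))] = G (a * t + b ord0 ord0)%R)%E.
  rewrite -[RHS](hS (t *: w + rsubmx (b : 'rV[R]_(1 + n))))//; congr (_ * L n _)%E.
  by apply/seteqP; split=> y /=; rewrite consrV_mul_ublock.
rewrite -ge0_integralZl//; first by apply: eq_integral => t _; rewrite GE.
apply: (@measurable_lebesgue_rV_cons1 n (fun x => E (x *m _ + b)%R)).
by rewrite -[X in measurable X]setTI; exact: measurable_affine_rV.
Qed.

(** For fixed [y] the first coordinate is only translated, hence slices in the other order. *)
Let mulP_lblock n (c : 'cV[R]_n) :
  mulP (block_mx (1%:M : 'M[R]_1) 0 c 1%:M : 'M[R]_(1 + n)).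
Proof.
move=> E mE.
rewrite lebesgue_rV_cons2; last first.
  by rewrite -[X in measurable X]setTI; exact: measurable_mul_rV.
rewrite lebesgue_rV_cons2// det_lblock !det1 mulr1 normr1 mul1e.
apply: eq_integral => y _.
rewrite -[RHS](@lebesgue_affine _ 1 ((y *m c) ord0 ord0))//; last exact: measurable_cons2.
rewrite normr1 mul1e; congr (mu _).
by apply/seteqP; split=> t /=; rewrite consrV_mul_lblock.
Qed.

(* Induction on n: a matrix with nonzero corner factors into a block lower and a
   block upper triangular one, both handled by Tonelli; otherwise a shear first
   brings a nonzero entry to the corner. *)
Lemma lebesgue_rV_affine n (A : 'M[R]_n) (b : 'rV[R]_n) (E : set 'rV[R]_n) :
  A \in unitmx -> measurable E ->
  (`|\det A|%:E * L n ((fun y => y *m A + b)%R @^-1` E) = L n E)%E.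
Proof.
move: b E; elim: n A => [|n IH] A b E uA mE.
  rewrite det_mx00 normr1 mul1e; congr (L 0 _).
  by apply/seteqP; split=> y /=; congr E; apply/rowP; case.
move: b E mE; rewrite -/(affP A).
have corner (B : 'M[R]_(1 + n)) : B \in unitmx -> ulsubmx B ord0 ord0 != 0 -> affP B.
  move=> uB; rewrite -[B]submxK; set a := ulsubmx B ord0 ord0.
  have -> : ulsubmx B = a%:M by exact: mx11_scalar.
  rewrite block_mxKul mxE eqxx mulr1n => a0.
  set w := ursubmx B; set c := dlsubmx B; set S := drsubmx B.
  (* Gaussian elimination with pivot [a]; the last block is the Schur complement. *)
  have BE : block_mx a%:M w c S =
      block_mx (1%:M : 'M[R]_1) 0 (a^-1 *: c) 1%:M *m
      block_mx a%:M w 0 (S - a^-1 *: c *m w) :> 'M[R]_(1 + n).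
    rewrite mulmx_block !mul1mx !mul0mx !addr0; congr block_mx.
    by rewrite mul_mx_scalar scalerA mulfV// scale1r.
    by rewrite addrC subrK.
  rewrite BE; apply: affP_mul; first exact: mulP_lblock.
  apply: affP_ublock => //.
  move=> b E mE; apply: IH => //; move: uB.
  rewrite -[B]submxK [ulsubmx B]mx11_scalar -/a -/w -/c -/S BE !unitmxE.
  by rewrite det_mulmx det_lblock det_ublock !det1 !mul1r unitrM => /andP[].
have [|a0] := boolP (ulsubmx (A : 'M[R]_(1 + n)) ord0 ord0 != 0); first exact: corner.
have [i ci] : exists i, dlsubmx (A : 'M[R]_(1 + n)) i ord0 != 0.
  apply: contrapT => /forallNP h; move: uA; rewrite unitmxE -(@submxK _ 1 n 1 n A).
  have -> : ulsubmx (A : 'M[R]_(1 + n)) = 0.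
    by apply/matrixP => i j; rewrite !ord1 [RHS]mxE; apply/eqP; move: a0; rewrite negbK.
  have -> : dlsubmx (A : 'M[R]_(1 + n)) = 0.
    apply/matrixP => i j; rewrite ord1 [RHS]mxE; apply/eqP.
    by apply: contrapT => /negP; exact: h.
  by rewrite (@det_ublock _ 1 n) det_mx11 mxE mul0r unitr0.
(* Multiplication by [U 1] adds a lower row to the first one, so the zero corner becomes the nonzero
   entry found above. *)
pose U (s : R) : 'M[R]_(1 + n) := block_mx 1%:M (s *: delta_mx ord0 i) 0 1%:M.
have UU : U (-1) *m U 1 = 1%:M.
  rewrite /U mulmx_block !mul1mx !mul0mx !mulmx1 !mulmx0 add0r addr0.
  by rewrite scale1r scaleN1r subrr (@scalar_mx_block _ 1 n) add0r.
have affU s : affP (U s).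
  by apply: affP_ublock; [exact: oner_neq0 | move=> b E mE; apply: IH; rewrite ?unitmx1].
rewrite (_ : A = U (-1) *m (U 1 *m A)); last by rewrite mulmxA UU mul1mx.
apply: affP_mul; first exact: affP_mulP.
apply: corner.
  by rewrite unitmx_mul uA andbT unitmxE det_ublock !det1 mulr1 unitr1.
rewrite -(@submxK _ 1 n 1 n A) /U (@mulmx_block _ 1 n 1 n 1 n) block_mxKul mul1mx scale1r -rowE mxE.
by rewrite [X in _ + X]mxE; move: a0; rewrite negbK => /eqP ->; rewrite add0r.
Qed.

End lebesgue_rV_theory.

(** * Open sets, boxes and hyperplanes in R^n *)

Section rV_topology.
Context {R : realType}.
Local Notation mu := (@lebesgue_measure R).
Local Notation L := (@lebesgue_rV R).

Definition rbox n (x : 'rV[R]_n) (r : R) : set 'rV[R]_n :=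
  [set y | forall i, `|x ord0 i - y ord0 i| < r].

Lemma nbhs_rbox n (x : 'rV[R]_n) (A : set 'rV[R]_n) :
  nbhs x A <-> exists2 r, 0 < r & rbox x r `<=` A.
Proof.
rewrite nbhs_ballP; split=> -[r r0 h]; exists r => // y hy; apply: h.
  by split=> // i j; rewrite !ord1; exact: hy.
by case: hy => _ hy i; exact: hy.
Qed.

Lemma open_rboxP n (U : set 'rV[R]_n) : open U <->
  forall x, U x -> exists2 r, 0 < r & rbox x r `<=` U.
Proof.
by rewrite openE; split=> h x Ux; apply/nbhs_rbox; exact: h.
Qed.

Lemma continuous_rVP (T : topologicalType) n (f : T -> 'rV[R]_n) :
  (forall i, continuous (fun x => f x ord0 i)) -> continuous f.
Proof.
move=> fc x; apply/cvg_ballP => e e0.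
have : \forall y \near x, forall i, `|f x ord0 i - f y ord0 i| < e.
  apply: filter_forall => i; have := fc i x => /cvgr_dist_lt; exact.
by apply: filterS => y h; split=> // i j; rewrite !ord1; exact: h.
Qed.

Lemma continuous_lform_rV n (v : 'cV[R]_n) :
  continuous (fun x : 'rV[R]_n => (x *m v) ord0 ord0).
Proof.
move=> x; rewrite [X in continuous_at _ X](_ : _ =
    (fun y : 'rV[R]_n => \sum_(i <- index_enum 'I_n) y ord0 i * v i ord0)); last first.
  by apply/funext => y; rewrite mxE.
elim: (index_enum _) => [|i s IH].
  rewrite [X in continuous_at _ X](_ : _ = cst 0); first exact: cst_continuous.
  by apply/funext => y; rewrite big_nil.
rewrite [X in continuous_at _ X](_ : _ = (fun y : 'rV[R]_n => y ord0 i * v i ord0) \+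
  (fun y : 'rV[R]_n => \sum_(j <- s) y ord0 j * v j ord0)); last first.
  by apply/funext => y; rewrite big_cons.
apply: continuousD => //; apply: continuousM; first exact: coord_continuous.
exact: cst_continuous.
Qed.

Lemma continuous_affine_rV m n (A : 'M[R]_(m, n)) b :
  continuous (fun y : 'rV[R]_m => y *m A + b).
Proof.
apply: continuous_rVP => i x.
rewrite [X in continuous_at _ X](_ : _ =
    (fun y : 'rV[R]_m => (y *m col i A) ord0 ord0) \+ cst (b ord0 i)).
  apply: (@continuousD _ _ _ (fun y : 'rV[R]_m => (y *m col i A) ord0 ord0) (cst (b ord0 i))).
    exact: continuous_lform_rV.
  exact: cst_continuous.
by apply/funext => y; rewrite /= !mxE; congr (_ + _); apply: eq_bigr => j _; rewrite ?mxE.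
Qed.

Lemma continuous_pev n (p : mpoly n R) : continuous (pev p).
Proof.
elim/(@mpoly_gen_ind R n): p => [c|i|p q hp hq|p q hp hq] x.
- rewrite [X in continuous_at _ X](_ : _ = cst c); first exact: cst_continuous.
  by apply/funext => y; rewrite pevC.
- rewrite [X in continuous_at _ X](_ : _ = fun y : 'rV[R]_n => y ord0 i).
    exact: coord_continuous.
  by apply/funext => y; rewrite pevX.
- rewrite [X in continuous_at _ X](_ : _ = pev p \+ pev q).
    exact: (continuousD (hp x) (hq x)).
  by apply/funext => y; rewrite pevD.
- rewrite [X in continuous_at _ X](_ : _ = pev p \* pev q).
    exact: (continuousM (hp x) (hq x)).
  by apply/funext => y; rewrite pevM.
Qed.

Lemma measurable_rbox n (x : 'rV[R]_n) r : measurable (rbox x r).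
Proof.
rewrite (_ : rbox x r = \bigcap_(i in [set: 'I_n])
    ((fun y : 'rV[R]_n => y ord0 i) @^-1` ball (x ord0 i) r)).
  apply: fin_bigcap_measurable => // i _; rewrite -[X in measurable X]setTI.
  by apply: measurable_rV_coord => //; exact: measurable_ball.
by apply/seteqP; split=> y /= h i; [move=> _|]; exact: h.
Qed.

(** The sigma-algebra is generated by the coordinates, so the open set has to be a countable union
    of boxes: those with rational centre and radius. *)
Lemma open_measurable_rV n (U : set 'rV[R]_n) : open U -> measurable U.
Proof.
move=> /open_rboxP oU.
pose c (q : 'rV[rat]_n) : 'rV[R]_n := \row_i ratr (q ord0 i).
pose F (qs : 'rV[rat]_n * rat) : set 'rV[R]_n :=
  if `[< rbox (c qs.1) (ratr qs.2) `<=` U >] then rbox (c qs.1) (ratr qs.2) else set0.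
rewrite (_ : U = \bigcup_qs F qs).
  apply: countable_bigcupT_measurable => [|qs]; first exact: countableP.
  by rewrite /F; case: ifP => _; [exact: measurable_rbox|exact: measurable0].
apply/seteqP; split=> [x Ux|x [qs _]]; last first.
  by rewrite /F; case: ifPn => // /asboolP h /h.
have [r r0 rU] := oU x Ux.
(* Below r / 2, a box of radius [s] that contains [x] stays inside [rbox x r]. *)
have [s] := @rat_in_itvoo R 0 (r / 2) (divr_gt0 r0 (ltr0Sn _ 1)).
rewrite in_itv/= => /andP[s0 sr].
have /choice[q hq] : forall i, exists q : rat, `|x ord0 i - ratr q| < ratr s.
  move=> i; have [|q] := @rat_in_itvoo R (x ord0 i - ratr s) (x ord0 i + ratr s).
    by rewrite ltrBlDr -addrA ltrDl addr_gt0.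
  by rewrite in_itv/= => h; exists q; rewrite distrC ltr_distl.
have xq : rbox (c (\row_i q i)) (ratr s) x by move=> i; rewrite !mxE distrC; exact: hq.
exists (\row_i q i, s) => //; rewrite /F /=; case: ifPn => // /asboolP; case.
move=> y yq; apply: rU => i.
rewrite (splitr r) (le_lt_trans (ler_distD ((c (\row_i q i)) ord0 i) _ _))//.
by apply: ltrD; [rewrite distrC|]; apply: lt_trans sr; [exact: xq|exact: yq].
Qed.

Lemma closed_measurable_rV n (A : set 'rV[R]_n) : closed A -> measurable A.
Proof.
by rewrite -openC => /open_measurable_rV/measurableC; rewrite setCK.
Qed.

Lemma lebesgue_rV_rbox n (x : 'rV[R]_n) r : 0 <= r ->
  L n (rbox x r) = ((r *+ 2) ^+ n)%:E.
Proof.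
move=> r0; elim: n x => [|n IH] x.
  rewrite expr0 /= diracE mem_set//; by case.
rewrite -[LHS]/((mu \x L n) (@consrV R n @^-1` rbox x r))%E.
rewrite (_ : _ @^-1` _ = ball (x ord0 ord0) r `*` rbox (rsubmx (x : 'rV[R]_(1 + n))) r).
  rewrite product_measure1E//; [|exact: measurable_ball|exact: measurable_rbox].
  rewrite [X in (X * _)%E](_ : _ = (r *+ 2)%:E); last exact: lebesgue_measure_ball.
  by rewrite exprS EFinM -(IH (rsubmx (x : 'rV[R]_(1 + n)))).
apply/seteqP; split=> [[t y] h|[t y] [ht hy] i] /=.
  split=> [|i].
    have := h ord0; rewrite /consrV mxE; case: splitP => //= j _.
    by rewrite !ord1 mxE mulr1n.
  have := h (rshift 1 i : 'I_n.+1).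
  by rewrite /consrV (@row_mxEr _ 1 1 n) mxE.
rewrite /consrV mxE; case: splitP => j ij.
  rewrite !ord1 mxE mulr1n; have -> : i = ord0 by apply/val_inj; rewrite /= ij ord1.
  exact: ht.
have := hy j; rewrite mxE; congr (`|x _ _ - _| < _); exact/val_inj.
Qed.

Definition rV_bounded n (D : set 'rV[R]_n) :=
  exists B, forall x, D x -> forall i, `|x ord0 i| <= B.

Lemma lebesgue_rV_bounded n (D : set 'rV[R]_n) : measurable D -> rV_bounded D ->
  (L n D < +oo)%E.
Proof.
move=> mD [B DB]; apply: (@le_lt_trans _ _ (L n (rbox 0 (`|B| + 1)))).
  apply: le_measure; rewrite ?inE//; first exact: measurable_rbox.
  move=> x /DB h i; rewrite mxE sub0r normrN (le_lt_trans (h i))//.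
  by rewrite (le_lt_trans (ler_norm B))// ltrDl.
by rewrite lebesgue_rV_rbox ?ltry// addr_ge0.
Qed.

Lemma lebesgue_rV_open_gt0 n (U : set 'rV[R]_n) x : open U -> U x ->
  (0 < L n U)%E.
Proof.
move=> oU Ux; have [r r0 rU] := (open_rboxP U).1 oU x Ux.
apply: (@lt_le_trans _ _ (L n (rbox x r))).
  by rewrite lebesgue_rV_rbox ?ltW// lte_fin exprn_gt0// pmulrn_lgt0.
by apply: le_measure; rewrite ?inE//; [exact: measurable_rbox|exact: open_measurable_rV].
Qed.

Lemma measurable_pev n (p : mpoly n R) : measurable_fun setT (pev p).
Proof.
elim/(@mpoly_gen_ind R n): p => [c|i|p q hp hq|p q hp hq].
- rewrite [X in measurable_fun _ X](_ : _ = cst c); first exact: measurable_cst.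
  by apply/funext => y; rewrite pevC.
- rewrite [X in measurable_fun _ X](_ : _ = fun y : 'rV[R]_n => y ord0 i).
    exact: measurable_rV_coord.
  by apply/funext => y; rewrite pevX.
- rewrite [X in measurable_fun _ X](_ : _ = pev p \+ pev q); first exact: measurable_funD.
  by apply/funext => y; rewrite pevD.
- rewrite [X in measurable_fun _ X](_ : _ = pev p \* pev q); first exact: measurable_funM.
  by apply/funext => y; rewrite pevM.
Qed.

Lemma bounded_pev n (p : mpoly n R) (D : set 'rV[R]_n) : rV_bounded D ->
  exists2 B, 0 <= B & forall x, D x -> `|pev p x| <= B.
Proof.
move=> [B0 DB0].
elim/(@mpoly_gen_ind R n): p => [c|i|p q [B1 B10 h1] [B2 B20 h2]|p q [B1 B10 h1] [B2 B20 h2]].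
- by exists `|c| => // x _; rewrite pevC.
- by exists `|B0| => // x /DB0 h; rewrite pevX (le_trans (h i))// ler_norm.
- exists (B1 + B2) => [|x Dx]; first exact: addr_ge0.
  by rewrite pevD (le_trans (ler_normD _ _))// lerD ?h1 ?h2.
- exists (B1 * B2) => [|x Dx]; first exact: mulr_ge0.
  by rewrite pevM normrM ler_pM ?h1 ?h2.
Qed.

Lemma measurable_hyperplane n (v : 'cV[R]_n) c :
  measurable [set x : 'rV[R]_n | (x *m v) ord0 ord0 = c].
Proof.
rewrite -[X in measurable X]setTI.
rewrite (_ : [set x : 'rV[R]_n | (x *m v) ord0 ord0 = c] =
  (fun x => x *m v) @^-1` ((fun z : 'rV[R]_1 => z ord0 ord0) @^-1` [set c]))//.
apply: measurable_mul_rV => //; rewrite -[X in measurable X]setTI.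
by apply: measurable_rV_coord.
Qed.

(** Induction on the dimension. If [v] has a nonzero entry beyond the first, slices at a fixed first
    coordinate are hyperplanes one dimension lower; otherwise each slice along the first coordinate
    is a single point. *)
Lemma lebesgue_rV_hyperplane n (v : 'cV[R]_n) c : v != 0 ->
  L n [set x | (x *m v) ord0 ord0 = c] = 0%E.
Proof.
elim: n v c => [|n IH] v c v0.
  by case/eqP: v0; apply/colP; case.
have consE t (y : 'rV[R]_n) : (consrV (t, y) *m v) ord0 ord0 =
    t * v ord0 ord0 + (y *m (dsubmx (v : 'cV[R]_(1 + n)))) ord0 ord0.
  rewrite -[v in LHS](@vsubmxK _ 1 n) /consrV (@mul_row_col _ 1 1 n) mxE.
  congr (_ + _); rewrite mxE big_ord1 !mxE/= mulr1n; congr (_ * v _ _).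
  exact/val_inj.
have [w0|w0] := eqVneq (dsubmx (v : 'cV[R]_(1 + n))) 0; last first.
  rewrite lebesgue_rV_cons1; last exact: measurable_hyperplane.
  rewrite integral0_eq// => t _.
  rewrite (_ : mkset _ = [set y | (y *m dsubmx (v : 'cV[R]_(1 + n))) ord0 ord0 =
    c - t * v ord0 ord0]); first exact: IH.
  apply/seteqP; split=> y /=; rewrite consE.
    by move=> <-; rewrite addrAC subrr add0r.
  by move=> ->; rewrite addrC subrK.
have v00 : v ord0 ord0 != 0.
  apply: contra v0 => /eqP v00; apply/eqP; rewrite -[v](@vsubmxK _ 1 n) w0.
  rewrite (_ : usubmx _ = 0) ?col_mx0//; apply/colP => i; rewrite ord1 !mxE -[RHS]v00.
  by congr (v _ _); exact/val_inj.
rewrite lebesgue_rV_cons2; last exact: measurable_hyperplane.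
rewrite integral0_eq// => y _.
rewrite (_ : mkset _ = [set c / v ord0 ord0]); first exact: lebesgue_measure_set1.
by apply/seteqP; split=> t /=; rewrite consE w0 mulmx0 mxE addr0;
  [move=> <-; rewrite mulfK|move=> ->; rewrite divfK].
Qed.

End rV_topology.

(** * Polytopes and integrals of polynomials *)

Section polytopes.
Context {R : realType}.
Local Notation L := (@lebesgue_rV R).

Lemma negligible_fin_bigcup d (T : measurableType d) (mu : {measure set T -> \bar R})
    (I : finType) (F : I -> set T) :
  (forall i, mu.-negligible (F i)) -> mu.-negligible (\bigcup_i F i).
Proof.
move=> hF; pose G k := if @unpickle I k is Some i then F i else set0.
apply: (@negligibleS _ _ _ _ (\bigcup_k G k)).
  by move=> x [i _ Fx]; exists (pickle i) => //; rewrite /G pickleK.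
apply: negligible_bigcup => k; rewrite /G; case: unpickle => [i|]; first exact: hF.
exact: negligible_set0.
Qed.

Section simplex_coordinates.
Variables (n : nat) (p : 'I_n.+1 -> 'rV[R]_n).
Hypothesis pind : affinely_independent p.
Let M := \matrix_(i < n) (p (lift ord0 i) - p ord0).

Let uM : M \in unitmx. Proof. by rewrite -row_free_unit. Qed.

(** Barycentric coordinates at the vertices other than [p ord0]; the missing one is 1 minus their
    sum. *)
Definition bary (x : 'rV[R]_n) : 'rV[R]_n := (x - p ord0) *m invmx M.

Lemma simplexP x : simplex p x <->
  (forall i, 0 <= bary x ord0 i) /\ \sum_i bary x ord0 i <= 1.
Proof.
have sumM (t : 'rV[R]_n) : \sum_i t ord0 i *: (p (lift ord0 i) - p ord0) = t *m M.
  by rewrite mulmx_sum_row; apply: eq_bigr => i _; rewrite rowK.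
split=> [[t [t0 t1 ->]]|[b0 b1]].
  have tE : bary (\sum_i t i *: p i) = \row_i t (lift ord0 i).
    apply: (canLR (mulmxK uM)); rewrite -sumM -[p ord0 in LHS]scale1r -t1.
    rewrite scaler_suml -sumrB big_ord_recl subrr add0r.
    by apply: eq_bigr => i _; rewrite scalerBr mxE.
  rewrite tE; split=> [i|]; first by rewrite mxE.
  rewrite -t1 big_ord_recl; apply: ler_wpDl => //.
  by apply: ler_sum => i _; rewrite mxE.
exists (fun i => if unlift ord0 i is Some j then bary x ord0 j
  else 1 - \sum_j bary x ord0 j); split.
- by move=> i; case: unliftP => [j _|_] //; rewrite subr_ge0.
- rewrite big_ord_recl unlift_none -[RHS](subrK (\sum_j bary x ord0 j)).
  by congr (_ + _); apply: eq_bigr => i _; rewrite liftK.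
rewrite big_ord_recl unlift_none.
transitivity (p ord0 + \sum_i bary x ord0 i *: (p (lift ord0 i) - p ord0)).
  by rewrite sumM /bary mulmxKV// addrC subrK.
rewrite scalerBl scale1r -addrA; congr (_ + _).
rewrite scaler_suml -sumrN -big_split; apply: eq_bigr => i _.
by rewrite liftK scalerBr addrC.
Qed.

Lemma baryE x i : bary x ord0 i =
  (x *m col i (invmx M)) ord0 ord0 - (p ord0 *m col i (invmx M)) ord0 ord0.
Proof.
rewrite /bary mulmxBl mxE [X in _ + X]mxE -!/(_ - _).
by congr (_ - _); rewrite [RHS]mxE mxE; apply: eq_bigr => j _; rewrite mxE.
Qed.

Lemma sum_baryE x : \sum_i bary x ord0 i =
  (x *m (invmx M *m (const_mx 1 : 'cV[R]_n))) ord0 ord0 -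
  (p ord0 *m (invmx M *m (const_mx 1 : 'cV[R]_n))) ord0 ord0.
Proof.
transitivity ((bary x *m (const_mx 1 : 'cV[R]_n)) ord0 ord0).
  by rewrite [RHS]mxE; apply: eq_bigr => i _; rewrite [const_mx _ _ _]mxE mulr1.
by rewrite /bary -mulmxA mulmxBl mxE [X in _ + X]mxE.
Qed.

(** The whole hyperplanes carrying the facets, where one barycentric coordinate vanishes, in the
    linear form that [lebesgue_rV_hyperplane] requires. *)
Definition facets : set 'rV[R]_n :=
  (\bigcup_i [set x | (x *m col i (invmx M)) ord0 ord0 =
     (p ord0 *m col i (invmx M)) ord0 ord0]) `|`
  [set x | (x *m (invmx M *m (const_mx 1 : 'cV[R]_n))) ord0 ord0 =
     1 + (p ord0 *m (invmx M *m (const_mx 1 : 'cV[R]_n))) ord0 ord0].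

Lemma negligible_facets : (0 < n)%N -> (L n).-negligible facets.
Proof.
move=> n0.
have null (v : 'cV[R]_n) c : v != 0 ->
    (L n).-negligible [set x : 'rV[R]_n | (x *m v) ord0 ord0 = c].
  move=> v0; apply/negligibleP; last exact: lebesgue_rV_hyperplane.
  exact: measurable_hyperplane.
have ui : invmx M \in unitmx by rewrite unitmx_inv.
have nz (v : 'cV[R]_n) : v != 0 -> invmx M *m v != 0.
  by apply: contraNneq => /(canRL (mulKVmx uM)) ->; rewrite mulmx0.
apply: negligibleU.
  apply: negligible_fin_bigcup => i; apply: null; rewrite colE; apply: nz.
  by apply/eqP => /colP/(_ i); rewrite !mxE !eqxx => /eqP; rewrite oner_eq0.
apply/null/nz/eqP => /colP/(_ (Ordinal n0)); rewrite !mxE => /eqP.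
by rewrite oner_eq0.
Qed.

Lemma interior_simplex x : simplex p x -> ~ facets x -> (simplex p)° x.
Proof.
move=> /simplexP[b0 b1] /not_orP[nf1 nf2].
have {}b0 i : 0 < bary x ord0 i.
  rewrite lt_def b0 andbT; apply/eqP => bx0; apply: nf1; exists i => //=.
  by apply/eqP; rewrite -subr_eq0 -baryE bx0.
have {}b1 : \sum_i bary x ord0 i < 1.
  rewrite lt_def b1 andbT; apply/eqP => bx1; apply: nf2 => /=.
  by apply/eqP; rewrite -subr_eq -sum_baryE -bx1.
have bc i : continuous (fun y => bary y ord0 i).
  move=> y; rewrite [X in continuous_at _ X](_ : _ =
    (fun y => (y *m col i (invmx M)) ord0 ord0) \- cst ((p ord0 *m col i (invmx M)) ord0 ord0)).
    by apply: continuousB; [exact: continuous_lform_rV|exact: cst_continuous].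
  by apply/funext => z; rewrite baryE.
have sc : continuous (fun y => \sum_i bary y ord0 i).
  move=> y; rewrite [X in continuous_at _ X](_ : _ =
    (fun y => (y *m (invmx M *m (const_mx 1 : 'cV[R]_n))) ord0 ord0) \-
     cst ((p ord0 *m (invmx M *m (const_mx 1 : 'cV[R]_n))) ord0 ord0)).
    by apply: continuousB; [exact: continuous_lform_rV|exact: cst_continuous].
  by apply/funext => z; rewrite sum_baryE.
have : \forall y \near x, (forall i, 0 < bary y ord0 i) /\ \sum_i bary y ord0 i < 1.
  near=> y; split; last by near: y; exact: (cvgr_lt _ (sc x)).
  by near: y; apply: filter_forall => i; exact: (cvgr_gt _ (bc i x)).
by apply: filterS => y [y0 y1]; apply/simplexP; split=> [i|]; exact: ltW.
Unshelve. all: by end_near. Qed.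

End simplex_coordinates.

Lemma rV_boundedS n (A B : set 'rV[R]_n) : A `<=` B -> rV_bounded B -> rV_bounded A.
Proof. by move=> AB [b Bb]; exists b => x /AB; exact: Bb. Qed.

Lemma simplex_bounded m n (p : 'I_m.+1 -> 'rV[R]_n) : rV_bounded (simplex p).
Proof.
exists (\sum_i \sum_j `|p i ord0 j|) => x [t [t0 t1 ->]] j.
rewrite summxE (le_trans (ler_norm_sum _ _ _))//; apply: ler_sum => i _.
have ti : t i <= 1 by rewrite -t1 (bigD1 i)//= lerDl; apply: sumr_ge0 => *.
rewrite mxE normrM (ger0_norm (t0 i)) (le_trans (ler_piMl _ ti))//.
by rewrite (bigD1 j)//= lerDl; apply: sumr_ge0 => *.
Qed.

Section polytopal.
Variables (n : nat) (D : set 'rV[R]_n).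
Hypothesis hD : polytopal_domain D.

Lemma polytopal_open : open D. Proof. by case: hD. Qed.

Lemma polytopal_measurable : measurable D.
Proof. by apply: open_measurable_rV; exact: polytopal_open. Qed.

Lemma polytopal_closure_bounded : rV_bounded (closure D).
Proof.
have [_ _ _ _ [N [p [_ ->]]]] := hD.
have /choice[B hB] := fun l => @simplex_bounded n n (p l).
exists (\sum_l `|B l|) => x [l _ xl] j; rewrite (le_trans (hB l x xl j))//.
by rewrite (le_trans (ler_norm _))// (bigD1 l)//= lerDl; apply: sumr_ge0 => *.
Qed.

Lemma polytopal_bounded : rV_bounded D.
Proof. by apply: rV_boundedS polytopal_closure_bounded; exact: subset_closure. Qed.

Lemma polytopal_bdryE : bdry D = closure D `\` D.
Proof. by rewrite /bdry; have /interior_id -> := polytopal_open. Qed.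

Lemma closed_bdry (A : set 'rV[R]_n) : closed (bdry A).
Proof.
rewrite /bdry setDE; apply: closedI; first exact: closed_closure.
by apply: open_closedC; exact: open_interior.
Qed.

(** A boundary point off these hyperplanes would be interior to a simplex, hence to [closure D],
    hence in [D]: the absence of cracks confines the boundary to the facets. *)
Lemma negligible_bdry : (0 < n)%N -> (L n).-negligible (bdry D).
Proof.
move=> n0; rewrite polytopal_bdryE.
have [_ oD _ DE [N [p [pind cD]]]] := hD.
apply: (@negligibleS _ _ _ _ (\bigcup_l facets (p l))); last first.
  by apply: negligible_fin_bigcup => l; exact: negligible_facets.
move=> x [cx nDx]; have := cx; rewrite {1}cD => -[l _ xl]; exists l => //.
apply: contrapT => /(interior_simplex (pind l) xl) sx; apply: nDx.
by rewrite DE; apply: interiorS sx; rewrite cD => y ys; exists l.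
Qed.

End polytopal.

End polytopes.

(** * Integrals of polynomials over bounded sets *)

Section polynomial_integrals.
Context {R : realType}.
Local Notation L := (@lebesgue_rV R).

Definition bounded_on n (D : set 'rV[R]_n) (w : 'rV[R]_n -> R) :=
  exists C, forall x, D x -> `|w x| <= C.

Lemma integrable_bounded n (D : set 'rV[R]_n) (w : 'rV[R]_n -> R) :
  measurable D -> rV_bounded D -> measurable_fun D w -> bounded_on D w ->
  (L n).-integrable D (EFin \o w).
Proof.
move=> mD bD mw [C wC]; apply: measurable_bounded_integrable => //.
  exact: lebesgue_rV_bounded.
exists C; split; first exact: num_real.
by move=> c Cc x Dx /=; rewrite (le_trans (wC x Dx))// ltW.
Qed.

Lemma bounded_on_pevM n (D : set 'rV[R]_n) w p : rV_bounded D -> bounded_on D w ->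
  bounded_on D (fun x => w x * pev p x).
Proof.
move=> bD [C wC]; have [B B0 pB] := bounded_pev p bD.
by exists (C * B) => x Dx; rewrite normrM ler_pM ?wC ?pB.
Qed.

Lemma bounded_on_pev n (D : set 'rV[R]_n) p : rV_bounded D -> bounded_on D (pev p).
Proof. by move=> bD; have [B _ pB] := bounded_pev p bD; exists B. Qed.

Section weighted.
Variables (n : nat) (D : set 'rV[R]_n) (w : 'rV[R]_n -> R).
Hypotheses (mD : measurable D) (bD : rV_bounded D).
Hypotheses (mw : measurable_fun D w) (bw : bounded_on D w).

Lemma measurable_wpev p : measurable_fun D (fun x => w x * pev p x).
Proof. by apply: measurable_funM => //; apply: measurable_funTS; exact: measurable_pev. Qed.

Lemma integrable_wpev p : (L n).-integrable D (EFin \o (fun x => w x * pev p x)).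
Proof.
by apply: integrable_bounded => //; [exact: measurable_wpev|exact: bounded_on_pevM].
Qed.

Lemma wint_linear : linear_form (fun p => \int[L n]_(x in D) (w x * pev p x)).
Proof.
move=> c p q.
rewrite -RintegralZl//; last exact: integrable_wpev.
rewrite -RintegralD//; last 2 first.
- rewrite (_ : EFin \o _ = EFin \o (fun x => w x * pev (c *: p) x)).
    exact: integrable_wpev.
  by apply/funext => x /=; rewrite pevZ mulrCA.
- exact: integrable_wpev.
by apply: eq_Rintegral => x _; rewrite pevD pevZ; ring.
Qed.

End weighted.

Section unweighted.
Variables (n : nat) (D : set 'rV[R]_n).
Hypotheses (mD : measurable D) (bD : rV_bounded D).

Lemma pint_linear : linear_form (fun p => \int[L n]_(x in D) pev p x).
Proof.
have := @wint_linear n D (cst 1) mD bD (@measurable_cst _ _ _ _ _ _).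
move=> h c p q.
have {}h : linear_form (fun p => \int[L n]_(x in D) (cst 1 x * pev p x)).
  by apply: h; exists 1 => x _; rewrite normr1.
have E r : \int[L n]_(x in D) pev r x = \int[L n]_(x in D) (cst 1 x * pev r x).
  by apply: eq_Rintegral => x _; rewrite mul1r.
by rewrite !E h.
Qed.

End unweighted.

Lemma measurable_EFin_pev n (D : set 'rV[R]_n) p :
  measurable_fun D (fun x => (pev p x)%:E).
Proof. by apply/measurable_EFinP/measurable_funTS; exact: measurable_pev. Qed.

Lemma integrable_pev n (D : set 'rV[R]_n) p : measurable D -> rV_bounded D ->
  (L n).-integrable D (EFin \o pev p).
Proof.
move=> mD bD; apply: integrable_bounded => //; last exact: bounded_on_pev.
by apply: measurable_funTS; exact: measurable_pev.
Qed.

(** By continuity [p] stays above half its value at [x] on an open set, which has positive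
    measure. *)
Lemma pint_gt0 n (D : set 'rV[R]_n) p x : open D -> rV_bounded D ->
  (forall y, D y -> 0 <= pev p y) -> D x -> 0 < pev p x ->
  0 < \int[L n]_(x in D) pev p x.
Proof.
move=> oD bD p0 Dx px; set e := pev p x / 2.
have e0 : 0 < e by rewrite divr_gt0.
have mD := open_measurable_rV oD.
pose U := D `&` (pev p) @^-1` [set t | e < t].
have oU : open U.
  apply: openI => //; have /continuousP/(_ [set t | e < t]) := @continuous_pev R n p.
  by apply; exact: open_gt.
have mU := open_measurable_rV oU.
have Ux : U x by split=> //=; rewrite /e ltr_pdivrMr// mulr2n mulrDr mulr1 ltrDl.
have U0 := lebesgue_rV_open_gt0 oU Ux.
have UD : U `<=` D by move=> y [].
have Ufin : (L n U < +oo)%E.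
  by apply: lebesgue_rV_bounded => //; exact: rV_boundedS bD.
have ip := integrable_pev p mD bD.
rewrite /Rintegral fine_gt0//; apply/andP; split; last first.
  have := integrable_fin_num mD ip; rewrite ge0_fin_numE//.
  by apply: integral_ge0 => y Dy; rewrite lee_fin p0.
apply: (@lt_le_trans _ _ (\int[L n]_(y in U) e%:E)%E).
  by rewrite integral_cst// mule_gt0// lte_fin.
apply: (@le_trans _ _ (\int[L n]_(y in U) (pev p y)%:E)%E).
  apply: ge0_le_integral => //=.
  - by move=> *; rewrite lee_fin ltW.
  - exact: measurable_EFin_pev.
  - by move=> y [Dy] /=; rewrite lee_fin => /ltW.
by apply: ge0_subset_integral => //=; exact: measurable_EFin_pev.
Qed.

(** On the line from [x] to an arbitrary [y], the restriction of [p] has more roots near [x] than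
    its degree allows. *)
Lemma pev_open_eq0 n (U : set 'rV[R]_n) x p : open U -> U x ->
  (forall y, U y -> pev p y = 0) -> p = 0.
Proof.
move=> /open_rboxP oU Ux p0; have [r r0 rU] := oU x Ux.
apply: mpoly_eq0 => y; pose v := y - x.
pose B := \sum_i `|v ord0 i| + 1.
have B0 : 0 < B by rewrite ltr_wpDl// sumr_ge0.
have vB i : `|v ord0 i| < B.
  by rewrite /B (bigD1 i)//= -addrA ltrDl ltr_wpDl// sumr_ge0.
have lp0 : line_poly x v p = 0.
  (* These distinct parameters move each coordinate by less than [r], since [B] exceeds every entry
     of [v] in absolute value. *)
  apply: (@roots_geq_poly_eq0 _ _
    [seq r / B / i.+1%:R | i <- iota 0 (size (line_poly x v p))]).
  - apply/allP => _ /mapP[i _ ->]; rewrite /root horner_line_poly p0//.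
    apply: rU => j; rewrite !mxE opprD addrA subrr sub0r normrN normrM.
    have s0 : 0 < r / B / i.+1%:R by rewrite !divr_gt0.
    rewrite gtr0_norm// (@lt_le_trans _ _ (r / B / i.+1%:R * B))//.
      by rewrite ltr_pM2l//; have := vB j; rewrite !mxE.
    rewrite mulrAC divfK ?gt_eqF// ler_pdivrMr// ler_peMr ?(ler1n _ i.+1)//.
    exact: ltW.
  - rewrite map_inj_uniq ?iota_uniq// => i j /mulfI h.
    have /invr_inj/eqP : (i.+1%:R : R)^-1 = j.+1%:R^-1.
      by apply: h; rewrite gt_eqF// divr_gt0.
    by rewrite eqr_nat => /eqP[].
  - by rewrite size_map size_iota.
have := horner_line_poly x v p 1.
by rewrite lp0 horner0 scale1r /v addrC subrK => <-.
Qed.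

Lemma pint_sqr_eq0 n (D : set 'rV[R]_n) p : open D -> rV_bounded D -> D !=set0 ->
  \int[L n]_(x in D) pev (p * p) x = 0 -> p = 0.
Proof.
move=> oD bD [x0 Dx0] I0; apply: (pev_open_eq0 oD Dx0) => x Dx.
apply: contrapT => /eqP px; have := I0; apply/eqP; rewrite gt_eqF//.
apply: (@pint_gt0 n D (p * p) x) => // [y _|].
  by rewrite pevM -expr2 sqr_ge0.
by rewrite pevM -expr2 lt0r sqrf_eq0 sqr_ge0 andbT.
Qed.

End polynomial_integrals.

(** * The divergence theorem on mesh elements *)

Section line_sections.
Context {R : realType}.
Local Notation mu := (@lebesgue_measure R).

(** If the path avoided the boundary, [T] and its closure would have the same trace on the segment;
    open, closed and nonempty, it would be the whole segment. *)
Lemma path_meets_bdry n (T : set 'rV[R]_n) (g : R -> 'rV[R]_n) (a b s s' : R) :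
  open T -> continuous g -> a <= s <= b -> a <= s' <= b -> T (g s) -> ~ T (g s') ->
  exists2 r, a <= r <= b & bdry T (g r).
Proof.
move=> oT cg sab s'ab Ts nTs'; apply: contrapT => nex; apply: nTs'.
have bE r : a <= r <= b -> closure T (g r) -> T (g r).
  move=> rab cl; apply: contrapT => nT; apply: nex; exists r => //.
  by rewrite /bdry; have /interior_id -> := oT.
have := @segment_connected R a b (`[a, b]%classic `&` g @^-1` T).
have -> : `[a, b]%classic `&` g @^-1` T = `[a, b]%classic `&` g @^-1` (closure T).
  apply/seteqP; split=> r /= [rab h]; split=> //; first exact: subset_closure.
  by apply: bE => //; rewrite in_itv/= in rab.
move=> h; have : (`[a, b]%classic `&` g @^-1` (closure T)) s'.
  rewrite h ?in_itv//=.
  - by exists s; split; rewrite /= ?in_itv//; exact: subset_closure.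
  - exists (g @^-1` T); first by have /continuousP := cg; exact.
    apply/seteqP; split=> r /= [rab ?]; split=> //; last exact: subset_closure.
    by apply: bE => //; rewrite in_itv/= in rab.
  - exists (g @^-1` (closure T)) => //.
    by have /continuous_closedP := cg; apply; exact: closed_closure.
by case=> _ /(bE _ s'ab).
Qed.

Lemma exists_pos_lt (I : finType) (P : pred I) (f : I -> R) :
  (forall i, P i -> 0 < f i) -> exists2 s, 0 < s & forall i, P i -> s < f i.
Proof.
move=> f0; pose m := \big[Order.min/1]_(i | P i) f i.
have m0 : 0 < m by rewrite /m; elim/big_ind : _ => // x y x0 y0; rewrite lt_min x0.
exists (m / 2) => [|i Pi]; first by rewrite divr_gt0.
apply: (@lt_le_trans _ _ m); first by rewrite ltr_pdivrMr// mulr2n mulrDr mulr1 ltrDl.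
by rewrite /m (bigD1 i)//= ge_min lexx.
Qed.

(** * Signed crossings of a bounded set with a line *)

Section crossings.
Variables (I : finType) (H : pred I) (tau : I -> R) (exits : I -> bool).
Variables (S : set R) (B : R).
Hypothesis tau_inj : forall e e', H e -> H e' -> tau e = tau e' -> e = e'.
Hypothesis S_bounded : forall t, S t -> - B < t < B.
Hypothesis S_const : forall a b, a <= b -> (forall e, H e -> ~~ (a <= tau e <= b)) ->
  (S a <-> S b).
Hypothesis S_switch : forall e, H e -> exists2 r, 0 < r & forall s, 0 < s < r ->
  (S (tau e - s) <-> exits e) /\ (S (tau e + s) <-> ~~ exits e).

(** In the application [S] is the part of a line inside an element and [tau e] its crossing with the
    face [e]; an exit counts +1, an entry -1. *)
Let sg e : R := (-1) ^+ (~~ exits e).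

(* S is bounded, so membership of al is the number of exits minus the number of
   entries above al. *)
Lemma crossing_count al : (forall e, H e -> tau e != al) ->
  \1_S al = \sum_(e | H e && (al < tau e)) sg e.
Proof.
have indE t b : (S t <-> is_true b) -> \1_S t = b%:R :> R.
  move=> SE; rewrite indicE; have -> // : (t \in S) = b.
  by apply/idP/idP; rewrite inE => /SE.
move cE : #|[set e | H e && (al < tau e)]%SET| => c.
elim: c al cE => [|c IH] al cE al_notin.
  have noe e : H e -> tau e < al.
    move=> He; rewrite lt_neqAle al_notin//= leNgt; apply/negP => lt_al.
    have : e \in [set e | H e && (al < tau e)]%SET by rewrite inE He.
    by rewrite (cards0_eq cE) inE.
  rewrite big_pred0; last first.
    by move=> e; apply/negP => /andP[/noe]; rewrite ltNge => /negP h /ltW.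
  apply: (@indE _ false); split=> // Sal.
  (* [Num.max al B] lies outside [S], and no crossing separates it from [al]. *)
  have /(_ _ _)[|e He|Sm _] := @S_const al (Num.max al B).
  - by rewrite le_max lexx.
  - by rewrite negb_and -!ltNge noe.
  have /S_bounded/andP[_] := Sm Sal.
  by rewrite gt_max ltxx andbF.
have [e0 /[!inE]] : exists e, e \in [set e | H e && (al < tau e)]%SET.
  by apply/set0Pn; rewrite -card_gt0 cE.
move=> e0P; pose e1 := [arg min_(e < e0 | H e && (al < tau e)) tau e]%O.
have [He1 e1al e1min] : [/\ H e1, al < tau e1 &
    forall e, H e -> al < tau e -> tau e1 <= tau e].
  rewrite /e1; case: arg_minP => //= e /andP[He al_e] emin; split=> // e' He' al_e'.
  by apply: emin; rewrite He'.
have [r r0 hr] := S_switch He1.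
(* [s] is smaller than the gap to every later crossing; the case [None] adds the conditions at the
   crossing [e1] itself, so one minimum serves all. *)
have [|s s0 hs] := @exists_pos_lt (option I)
  (fun o => if o is Some e then H e && (tau e1 < tau e) else true)
  (fun o => if o is Some e then tau e - tau e1 else Num.min r (tau e1 - al)).
  case=> [e /andP[_]|_]; first by rewrite subr_gt0.
  by rewrite lt_min r0 subr_gt0.
have := hs None erefl; rewrite lt_min => /andP[sr sal].
have {}hs e : H e -> tau e1 < tau e -> tau e1 + s < tau e.
  by move=> He e1e; have := hs (Some e); rewrite He e1e ltrBrDl => /(_ isT).
have [|Sm Sp] := hr s; first by rewrite s0.
rewrite (bigD1 e1) ?He1//=.
have -> : \sum_(e | H e && (al < tau e) && (e != e1)) sg e =
    \sum_(e | H e && (tau e1 + s < tau e)) sg e.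
  apply: eq_bigl => e; apply/idP/idP => [/andP[/andP[He ale] ne]|/andP[He lte]].
    rewrite He hs// lt_neqAle e1min// andbT; apply: contra_neq ne => /tau_inj.
    by move=> /(_ He1 He).
  have e1e : tau e1 < tau e by apply: lt_trans lte; rewrite ltrDl.
  by rewrite He (lt_trans e1al e1e)/=; apply: contraTneq e1e => ->; rewrite ltxx.
rewrite -(IH (tau e1 + s)); last 2 first.
- move: cE; rewrite (cardsD1 e1) inE He1 e1al/= add1n => -[<-].
  apply: eq_card => e; rewrite !inE; apply/idP/idP => [/andP[He lte]|/andP[ne /andP[He ale]]].
    have e1e : tau e1 < tau e by apply: lt_trans lte; rewrite ltrDl.
    by rewrite He (lt_trans e1al e1e)/= andbT; apply: contraTneq e1e => ->; rewrite ltxx.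
  rewrite He hs// lt_neqAle e1min// andbT; apply: contra_neq ne => /tau_inj.
  by move=> /(_ He1 He).
- move=> e He; have [lte|] := ltP (tau e1) (tau e); first by rewrite gt_eqF// hs.
  by move=> lee; rewrite lt_eqF// (le_lt_trans lee)// ltrDl.
have Sal : S al <-> exits e1.
  rewrite -Sm; apply: S_const; first by rewrite lerBrDr -lerBrDl ltW.
  move=> e He; apply/negP => /andP[ale ele].
  have := e1min e He; rewrite lt_neqAle eq_sym al_notin// ale => /(_ isT).
  by rewrite leNgt => /negP; apply; rewrite (le_lt_trans ele)// ltrBlDr ltrDl.
rewrite (indE _ _ Sal) (indE _ _ Sp) /sg.
by case: (exits e1); rewrite /= ?expr1 ?expr0 ?addr0// addNr.
Qed.

(** On one side of each crossing [S] holds at all nearby points, in particular at one within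
    distance 1. *)
Lemma crossing_in_range e : H e -> - B - 1 < tau e.
Proof.
move=> He; have [r r0 hr] := S_switch He.
have m0 : 0 < Num.min r 1 by rewrite lt_min r0 ltr01.
have [|Sm Sp] := hr (Num.min r 1 / 2).
  rewrite divr_gt0//= (@lt_le_trans _ _ (Num.min r 1))//; last by rewrite ge_min lexx.
  by rewrite ltr_pdivrMr// mulr2n mulrDr mulr1 ltrDl.
have m1 : Num.min r 1 / 2 < 1.
  rewrite (@lt_le_trans _ _ (Num.min r 1))//; last by rewrite ge_min lexx orbT.
  by rewrite ltr_pdivrMr// mulr2n mulrDr mulr1 ltrDl.
have m20 : 0 < Num.min r 1 / 2 by rewrite divr_gt0.
have [ex|ex] := boolP (exits e).
  have /S_bounded/andP[+ _] := Sm.2 ex; lra.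
have /S_bounded/andP[+ _] := Sp.2 ex; lra.
Qed.

Lemma crossing_sum0 : \sum_(e | H e) sg e = 0.
Proof.
have : forall e, H e -> tau e != - B - 1.
  by move=> e /crossing_in_range h; rewrite gt_eqF.
move=> /crossing_count.
have -> : \sum_(e | H e && (- B - 1 < tau e)) sg e = \sum_(e | H e) sg e.
  by apply: eq_bigl => e; case: (boolP (H e)) => //= /crossing_in_range ->.
by move=> <-; rewrite indicE memNset// => /S_bounded/andP[]; lra.
Qed.

(** Almost everywhere, [crossing_count] writes the indicator of [S] as a signed sum of indicators of
    the intervals from [A] to [tau e]; the values of [q] at [A] then cancel by [crossing_sum0]. *)
Lemma line_integral (q : {poly R}) : measurable (S : set (measurableTypeR R)) ->
  (\int[mu]_t (\1_S t * (q^`()).[t])%:E =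
   (\sum_(e | H e) sg e * q.[tau e])%:E)%E.
Proof.
move=> mS; pose A := - B - 1; pose h (t : R) := ((q^`()).[t])%:E.
have mq : measurable_fun setT (fun t : R => (q^`()).[t]).
  by apply: continuous_measurable_fun; exact: continuous_horner.
have ih e : mu.-integrable `[A, tau e] h.
  apply: continuous_compact_integrable; first exact: segment_compact.
  by apply: continuous_subspaceT; exact: continuous_horner.
have ihT e : mu.-integrable setT (h \_ `[A, tau e]).
  by apply: (iffLR (integrable_mkcond _ _)) => //; exact: ih.
have Ih e : H e -> (\int[mu]_t (h \_ `[A, tau e]) t = (q.[tau e] - q.[A])%:E)%E.
  move=> He; rewrite -integral_mkcond EFinB /h.
  apply: (@continuous_FTC2 _ (horner q^`()) (horner q)).
  - exact: crossing_in_range.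
  - by apply: continuous_subspaceT; exact: continuous_horner.
  - split=> [t _||]; first exact: derivable_horner.
      by apply: cvg_at_right_filter; exact: continuous_horner.
    by apply: cvg_at_left_filter; exact: continuous_horner.
  - by move=> t _; rewrite derivE.
transitivity (\int[mu]_t \sum_(e | H e) ((sg e)%:E * (h \_ `[A, tau e]) t))%E; last first.
  rewrite integral_sum//; last by move=> e; exact: integrableZl.
  rewrite -sumEFin (eq_bigr (fun e => (sg e * q.[tau e])%:E + (- sg e * q.[A])%:E)%E).
    rewrite big_split/= !sumEFin -mulr_suml sumrN crossing_sum0 oppr0 mul0r.
    by rewrite adde0.
  move=> e He; rewrite integralZl// Ih// -EFinM -EFinD; congr EFin; ring.
apply: ae_eq_integral => //.
- by apply/measurable_EFinP; apply: measurable_funM => //; exact: measurable_indic.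
- suff /integrableP[] : mu.-integrable setT
      (fun t => \sum_(e | H e) ((sg e)%:E * (h \_ `[A, tau e]) t))%E by [].
  by apply: integrable_sum => // e _; exact: integrableZl.
have : mu.-negligible ((\bigcup_e [set tau e]) `|` [set A]).
  apply: negligibleU; last by apply/negligibleP => //; exact: lebesgue_measure_set1.
  apply: negligible_fin_bigcup => e; apply/negligibleP => //.
  exact: lebesgue_measure_set1.
apply: negligibleS => t /=; apply: contra_notP => nt _.
have tE e : H e -> tau e != t by move=> _; apply/eqP => te; apply: nt; left; exists e.
have tA0 : t <> A by move=> tA; apply: nt; right.
have [tA|At] := leP t A.
  rewrite indicE memNset ?mul0r; last by move=> /S_bounded/andP[]; rewrite /A in tA; lra.
  rewrite big1// => e _; rewrite patchE memNset ?mule0//=.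
  rewrite in_itv/= => /andP[At _]; apply: tA0; apply/eqP; rewrite eq_le tA//.
rewrite crossing_count// mulr_suml -sumEFin big_mkcondr/=; apply: eq_bigr => e He.
rewrite patchE mem_setE in_itv/= (ltW At)/= le_eqVlt eq_sym (negbTE (tE e He))/=.
by case: ifP => _; rewrite ?mule0// EFinM.
Qed.

End crossings.

End line_sections.

(** * Projection along a direction and its Jacobian on a face *)

Section projections.
Context {R : realType}.
Local Notation L := (@lebesgue_rV R).
Variable n : nat.
Implicit Types (v x : 'rV[R]_n.+1) (z y : 'rV[R]_n).

Definition tailrV x : 'rV[R]_n := rsubmx (x : 'rV[R]_(1 + n)).

(** Projection along [v] onto the hyperplane of first coordinate 0. The normalization
    [v ord0 ord0 = 1] makes the first coordinate the time on a line. *)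
Definition proj_along v : 'M[R]_(n.+1, n) :=
  (col_mx (- tailrV v) 1%:M : 'M[R]_(1 + n, n)).

Lemma consrV_tailrV x : consrV (x ord0 ord0, tailrV x) = x.
Proof. exact: unconsrVK. Qed.

Lemma consrV0 (p : measurableTypeR R * 'rV[R]_n) : consrV p ord0 ord0 = p.1.
Proof. exact: (congr1 fst (consrVK p)). Qed.

Lemma tailrV_cons t y : tailrV (consrV (t, y)) = y.
Proof. exact: (congr1 snd (consrVK (t, y))). Qed.

Lemma mul_proj_along v x : x *m proj_along v = tailrV x - x ord0 ord0 *: tailrV v.
Proof.
rewrite -{1}[x]consrV_tailrV /consrV /proj_along (@mul_row_col _ 1 1 n n).
by rewrite mulmx1 mul_scalar_mx scalerN addrC.
Qed.

Lemma tailrVD x x' : tailrV (x + x') = tailrV x + tailrV x'.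
Proof. by rewrite /tailrV linearD. Qed.

Lemma tailrVZ c x : tailrV (c *: x) = c *: tailrV x.
Proof. by rewrite /tailrV linearZ. Qed.

Definition line_pt v z (t : R) : 'rV[R]_n.+1 := consrV (0, z) + t *: v.

Section direction.
Variable v : 'rV[R]_n.+1.
Hypothesis v0 : v ord0 ord0 = 1.

Lemma line_pt0 z t : line_pt v z t ord0 ord0 = t.
Proof. by rewrite /line_pt [LHS]mxE consrV0 mxE v0 mulr1 add0r. Qed.

Lemma line_ptK z t : line_pt v z t *m proj_along v = z.
Proof.
rewrite mul_proj_along line_pt0 /line_pt tailrVD tailrVZ tailrV_cons.
by rewrite addrK.
Qed.

Lemma proj_alongK x : line_pt v (x *m proj_along v) (x ord0 ord0) = x.
Proof.
rewrite /line_pt mul_proj_along -[RHS]consrV_tailrV.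
rewrite -[X in _ + _ *: X]consrV_tailrV v0.
apply/rowP => i; rewrite /consrV !mxE; case: splitP => j _; rewrite !mxE.
  by rewrite !ord1 !mulr1n mulr1 add0r.
by rewrite subrK.
Qed.

(** Time and foot of the line are related to the standard coordinates by a shear of determinant 1;
    this yields Fubini along [v]. *)
Lemma line_ptE z t : line_pt v z t =
  consrV (t, z) *m (block_mx 1%:M (tailrV v) 0 1%:M : 'M[R]_(1 + n)).
Proof.
rewrite /consrV (@mul_row_block _ 1 1 n 1 n) mulmx1 mulmx0 addr0 mul_scalar_mx mulmx1.
rewrite /line_pt -[X in _ + _ *: X]consrV_tailrV v0; apply/rowP => i.
rewrite /consrV !mxE; case: splitP => j _; rewrite !mxE.
  by rewrite !ord1 !mulr1n mulr1 add0r.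
by rewrite addrC.
Qed.

Section frame.
Variables (F : 'M[R]_(n, n.+1)) (nu : 'rV[R]_n.+1).
Hypotheses (F_iso : F *m F^T = 1%:M) (nu1 : enorm nu = 1) (F_nu : F *m nu^T = 0).

Lemma dotE m (x y : 'rV[R]_m) : dot x y = (x *m y^T) ord0 ord0.
Proof. by rewrite mxE; apply: eq_bigr => i _; rewrite mxE. Qed.

Lemma dot_nu : dot nu nu = 1.
Proof.
have d0 : 0 <= dot nu nu by apply: sumr_ge0 => i _; rewrite -expr2 sqr_ge0.
by rewrite -[LHS]sqr_sqrtr// -/(enorm nu) nu1 expr1n.
Qed.

Lemma nu_col : nu *m nu^T = 1%:M.
Proof. by rewrite [LHS]mx11_scalar -dotE dot_nu. Qed.

Lemma nu_F : nu *m F^T = 0.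
Proof. by apply: trmx_inj; rewrite trmx_mul trmxK F_nu trmx0. Qed.

Let Q : 'M[R]_(1 + n) := col_mx nu F.

Lemma frame_orthogonal : Q *m Q^T = 1%:M.
Proof.
rewrite /Q tr_col_mx (@mul_col_row _ 1 n (1 + n) 1 n) nu_col nu_F F_nu F_iso.
by rewrite -scalar_mx_block.
Qed.

Lemma frame_det : `|\det Q| = 1.
Proof.
have : \det Q ^+ 2 = 1 by rewrite expr2 -{2}det_tr -det_mulmx frame_orthogonal det1.
by move/eqP; rewrite sqrf_eq1 => /orP[] /eqP ->; rewrite ?normrN normr1.
Qed.

Lemma frame_decomposition (w : 'rV[R]_n.+1) :
  w = dot w nu *: nu + (w *m F^T) *m F.
Proof.
have QtQ : Q^T *m Q = 1%:M by apply: mulmx1C; exact: frame_orthogonal.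
rewrite -[LHS]mulmx1 -QtQ /Q tr_col_mx (@mul_row_col _ (1 + n) 1 n (1 + n)) mulmxDr.
rewrite !mulmxA; congr (_ + _).
by rewrite [w *m _]mx11_scalar mul_scalar_mx dotE.
Qed.

(** The determinant of the rows [v], [F] is computed twice: in the orthonormal frame [Q], where it
    is v . nu up to sign, and after the unimodular map [J], which sends [v] to the first axis and
    leaves the projected frame as diagonal block. *)
Lemma det_proj_along : `|\det (F *m proj_along v)| = `|dot v nu|.
Proof.
pose V : 'M[R]_(1 + n) := col_mx v F.
have VQ : V = block_mx (dot v nu)%:M (v *m F^T) 0 1%:M *m Q.
  rewrite /Q /V (@mul_block_col _ 1 n 1 n (1 + n)) mul0mx mul1mx add0r.
  by rewrite mul_scalar_mx {1}(frame_decomposition v).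
pose J : 'M[R]_(1 + n) := row_mx (delta_mx ord0 ord0) (proj_along v).
have JE : J = block_mx 1%:M (- tailrV v) 0 1%:M.
  rewrite [RHS]block_mxEh /J /proj_along; congr row_mx.
  apply/colP => i; rewrite !mxE; case: splitP => j ij; rewrite !mxE.
    by rewrite !ord1 eqxx andbT (_ : i = ord0)//; apply/val_inj; rewrite /= ij ord1.
  by rewrite andbT; case: eqP => // i0; move: ij; rewrite i0.
have VJ : V *m J = block_mx 1%:M 0 (F *m delta_mx ord0 ord0) (F *m proj_along v).
  rewrite /V /J (@mul_col_row _ 1 n (1 + n) 1 n); congr block_mx.
    by apply/rowP => i; rewrite !ord1 -colE mxE v0 mxE.
  by rewrite mul_proj_along v0 scale1r subrr.
have := congr1 (fun M : 'M[R]_(1 + n) => `|\det M|) VJ.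
rewrite /= det_mulmx JE det_ublock !det1 !mulr1 det_lblock det1 mul1r => <-.
by rewrite VQ det_mulmx det_ublock det1 mulr1 det_scalar1 normrM frame_det mulr1.
Qed.

End frame.
End direction.
End projections.

Lemma continuous_line {R : realType} n (a w : 'rV[R]_n) :
  continuous (fun t : R => a + t *: w).
Proof.
apply: continuous_rVP => i t.
rewrite [X in continuous_at _ X](_ : _ =
  cst (a ord0 i) \+ ((@id R) \* cst (w ord0 i))); last first.
  by apply/funext => u; rewrite !mxE.
apply: (@continuousD _ _ _ (cst (a ord0 i))); first exact: cst_continuous.
apply: (@continuousM _ _ (@id R) (cst (w ord0 i))); last exact: cst_continuous.
exact: id.
Qed.

(** * Lines that avoid the relative boundaries of the faces *)

Section generic_lines.
Context {R : realType}.
Local Notation L := (@lebesgue_rV R).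
Variables (n : nat) (I : finType).
Variables (fd : I -> set 'rV[R]_n) (o : I -> 'rV[R]_n.+1) (fr : I -> 'M[R]_(n, n.+1)).
Variables (P : pred I) (v : 'rV[R]_n.+1).
Hypothesis n_gt0 : (0 < n)%N.
Hypothesis v0 : v ord0 ord0 = 1.
Hypothesis fd_polytopal : forall e, polytopal_domain (fd e).

Let par e y := o e + y *m fr e.

Hypothesis disjoint_relint : forall e e', e != e' ->
  par e @` fd e `&` par e' @` fd e' = set0.

Definition face_proj e : 'M[R]_n := fr e *m proj_along v.

Hypothesis face_projU : forall e, P e -> face_proj e \in unitmx.

(** The crossing with the whole hyperplane of [e], in face coordinates; whether it lies in the face
    is decided separately. As an affine map of [z] it serves as change of variables. *)
Definition face_hit e z : 'rV[R]_n :=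
  z *m invmx (face_proj e) + - (o e *m proj_along v) *m invmx (face_proj e).

Lemma face_hitP e z y : P e -> par e y *m proj_along v = z -> y = face_hit e z.
Proof.
move=> Pe <-; rewrite /face_hit -mulmxDl /par [X in (X + _) *m _]mulmxDl.
rewrite [X in X *m _]addrAC subrr add0r -(mulmxA y).
by rewrite mulmxK// face_projU.
Qed.

Lemma par_face_hit e z : P e -> par e (face_hit e z) *m proj_along v = z.
Proof.
move=> Pe; rewrite /par /face_hit -mulmxDl; set y := _ *m invmx _.
rewrite mulmxDl -(mulmxA y) /y mulmxKV ?face_projU//.
by rewrite addrC subrK.
Qed.

Definition hit_time e z : R := par e (face_hit e z) ord0 ord0.

Lemma line_pt_hit e z : P e -> line_pt v z (hit_time e z) = par e (face_hit e z).
Proof. by move=> Pe; rewrite -{1}(par_face_hit z Pe) proj_alongK. Qed.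

Definition generic_pt z := forall e, P e -> ~ bdry (fd e) (face_hit e z).

Lemma generic_pt_ae : (L n).-negligible [set z | ~ generic_pt z].
Proof.
apply: (@negligibleS _ _ _ _
  (\bigcup_e [set z | P e /\ bdry (fd e) (face_hit e z)])).
  by move=> z /existsNP[e /not_implyP[Pe /contrapT be]]; exists e.
apply: negligible_fin_bigcup => e.
have [Pe|nPe] := boolP (P e); last first.
  rewrite (_ : [set z | _] = set0); first exact: negligible_set0.
  by apply/seteqP; split=> z // -[].
have mb : measurable (bdry (fd e)) by apply: closed_measurable_rV; exact: closed_bdry.
have ui : invmx (face_proj e) \in unitmx by rewrite unitmx_inv face_projU.
have := lebesgue_rV_affine (- (o e *m proj_along v) *m invmx (face_proj e)) ui mb.
have -> : L n (bdry (fd e)) = 0%E.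
  by apply/(negligibleP _ mb); exact: negligible_bdry.
move=> /eqP; rewrite mule_eq0 eqe normr_eq0.
move: (ui); rewrite unitmxE unitfE => /negbTE -> /= /eqP L0.
apply: (@negligibleS _ _ _ _ (face_hit e @^-1` bdry (fd e))); first by move=> z [].
apply/negligibleP => //; rewrite -[X in measurable X]setTI.
exact: measurable_affine_rV.
Qed.

Lemma generic_hit e z y : P e -> generic_pt z -> closure (fd e) y ->
  par e y *m proj_along v = z -> y = face_hit e z /\ fd e y.
Proof.
move=> Pe gz cy /(face_hitP Pe) yE; split=> //; apply: contrapT => ny.
by have := gz e Pe; rewrite -yE (polytopal_bdryE (fd_polytopal e)); apply.
Qed.

(** On a generic line a contact with a closed face happens in its relative interior, and relative
    interiors are disjoint. *)
Lemma generic_disjoint e e' z y y' : P e -> P e' -> generic_pt z ->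
  closure (fd e) y -> closure (fd e') y' -> par e y = par e' y' ->
  par e y *m proj_along v = z -> e = e'.
Proof.
move=> Pe Pe' gz cy cy' yy' yz; apply: contrapT => /eqP ne.
have [_ fy] := generic_hit Pe gz cy yz.
have [|_ fy'] := generic_hit Pe' gz cy'; first by rewrite -yy'.
have : (par e @` fd e `&` par e' @` fd e') (par e y).
  by split; [exists y|exists y'].
by rewrite disjoint_relint.
Qed.

Section element.
Variables (T : set 'rV[R]_n.+1) (nu : I -> 'rV[R]_n.+1).
Hypothesis T_polytopal : polytopal_domain T.
Hypothesis T_bdry : bdry T = \bigcup_(e in [set e | P e]) par e @` closure (fd e).
Hypothesis fr_iso : forall e, fr e *m (fr e)^T = 1%:M.
Hypothesis nu_unit : forall e, P e -> enorm (nu e) = 1.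
Hypothesis nu_orth : forall e, P e -> fr e *m (nu e)^T = 0.
Hypothesis nu_outward : forall e, P e -> forall x, (par e @` fd e) x ->
  exists2 eps : R, 0 < eps & forall t, 0 < t < eps ->
    T (x - t *: nu e) /\ ~ T (x + t *: nu e).
Hypothesis v_transversal : forall e, P e -> dot v (nu e) != 0.

Let T_open : open T := polytopal_open T_polytopal.

Lemma face_setK e y : par e y - o e = y *m fr e.
Proof. by rewrite /par addrC addKr. Qed.

Lemma closed_face e : closed (par e @` closure (fd e)).
Proof.
(* [(fr e)^T *m fr e] projects orthogonally onto the directions of [e]: the first set is the
   hyperplane of [e], the second constrains the coordinates in it. *)
have -> : par e @` closure (fd e) =
    ((fun x => x *m ((fr e)^T *m fr e - 1%:M) + - (o e *m ((fr e)^T *m fr e - 1%:M)))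
      @^-1` [set 0]) `&`
    ((fun x => x *m (fr e)^T + - (o e *m (fr e)^T)) @^-1` closure (fd e)).
  apply/seteqP; split=> [_ [y cy <-]|x /= [x1 x2]].
    split=> /=; rewrite -mulmxBl face_setK.
      by rewrite mulmxBr mulmx1 mulmxA -(mulmxA y) fr_iso mulmx1 subrr.
    by rewrite -mulmxA fr_iso mulmx1.
  exists (x *m (fr e)^T - o e *m (fr e)^T) => //.
  move: x1; rewrite -!mulmxBl mulmxBr mulmx1 mulmxA => /eqP; rewrite subr_eq0 => /eqP.
  by rewrite /par => ->; rewrite addrC subrK.
apply: closedI; have /continuous_closedP h := @continuous_affine_rV R _ _
  ((fr e)^T *m fr e - 1%:M) (- (o e *m ((fr e)^T *m fr e - 1%:M))).
  apply: h; apply: (accessible_closed_set1 (hausdorff_accessible _)).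
  exact: (@norm_hausdorff _ 'rV[R]_n.+1).
have /continuous_closedP h' := @continuous_affine_rV R _ _ (fr e)^T (- (o e *m (fr e)^T)).
by apply: h'; exact: closed_closure.
Qed.

Lemma dotDl m (x y w : 'rV[R]_m) : dot (x + y) w = dot x w + dot y w.
Proof. by rewrite !dotE mulmxDl mxE. Qed.

Lemma dotZl m c (x w : 'rV[R]_m) : dot (c *: x) w = c * dot x w.
Proof. by rewrite !dotE -scalemxAl mxE. Qed.

Lemma dot_face e y y' : P e -> dot (par e y - par e y') (nu e) = 0.
Proof.
move=> Pe; rewrite /par opprD addrACA subrr add0r -mulmxBl dotE -mulmxA nu_orth//.
by rewrite mulmx0 mxE.
Qed.

Lemma rbox_shift m (x w : 'rV[R]_m) r : 0 < r ->
  exists2 s0, 0 < s0 & forall s, `|s| < s0 -> rbox x r (x + s *: w).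
Proof.
move=> r0; pose B := \sum_i `|w ord0 i| + 1.
have B0 : 0 < B by rewrite ltr_wpDl// sumr_ge0.
exists (r / B) => [|s sr i]; first exact: divr_gt0.
rewrite !mxE opprD addrA subrr sub0r normrN normrM.
rewrite (@le_lt_trans _ _ (`|s| * B))//; last by rewrite -ltr_pdivlMr.
apply: ler_wpM2l => //; rewrite /B (bigD1 i)//= -addrA lerDl addr_ge0//.
by apply: sumr_ge0.
Qed.

(* Near a point of the relative interior of e through which no other face of T
   passes, the boundary of T is the hyperplane of e, so that membership in T only
   depends on the side. *)
Lemma same_side e y z : P e -> generic_pt z -> fd e y ->
  par e y *m proj_along v = z ->
  exists2 r, 0 < r & forall w w', rbox (par e y) r w -> rbox (par e y) r w' ->
    0 < dot (w - par e y) (nu e) * dot (w' - par e y) (nu e) -> T w <-> T w'.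
Proof.
move=> Pe gz fy yz; pose x := par e y.
have : \forall w \near x, forall e', P e' && (e' != e) -> ~ (par e' @` closure (fd e')) w.
  apply: (@filter_forall _ I (fun e' w => P e' && (e' != e) ->
    ~ (par e' @` closure (fd e')) w) (nbhs x) (nbhs_filter x)) => e'.
  have [/andP[Pe' ne]|h] := boolP (P e' && (e' != e)); last first.
    by apply: nearW => w.
  suff : \forall w \near x, ~ (par e' @` closure (fd e')) w by apply: filterS.
  apply: open_nbhs_nbhs; split; first exact/closed_openC/closed_face.
  move=> [y' cy' yy']; move/eqP: ne; apply.
  apply: (generic_disjoint Pe' Pe gz cy' (subset_closure fy) yy').
  by rewrite yy'.
move=> /nbhs_rbox[r r0 rB]; exists r => // w w' xw xw' side.
suff H (a b : 'rV[R]_n.+1) : rbox x r a -> rbox x r b ->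
    0 < dot (a - x) (nu e) * dot (b - x) (nu e) -> T a -> T b.
  by split; apply: H; rewrite // mulrC.
move=> xa xb ab Ta; apply: contrapT => nTb.
pose g t := a + t *: (b - a).
have g0 : g 0 = a by rewrite /g scale0r addr0.
have g1 : g 1 = b by rewrite /g scale1r addrC subrK.
have cg : continuous g by exact: continuous_line.
have [t t01] := @path_meets_bdry _ _ T g 0 1 0 1 T_open cg
  (introT andP (conj (lexx 0) ler01)) (introT andP (conj ler01 (lexx 1)))
  (eq_ind_r T Ta g0) (fun h => nTb (eq_ind _ T h _ g1)).
(* The signed distance to the hyperplane of [e] is the same convex combination of two values of
   equal sign, hence nonzero; convexity of the box excludes the other faces. *)
have gE : g t - x = (1 - t) *: (a - x) + t *: (b - x).
  rewrite /g scalerBl scale1r !scalerBr; apply/rowP => i; rewrite !mxE; ring.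
rewrite T_bdry => -[e' Pe' [y' cy' gy']].
have [ee'|ne] := eqVneq e' e.
  have : dot (g t - x) (nu e) = 0 by rewrite -gy' ee' dot_face.
  rewrite gE dotDl !dotZl.
  case/andP: t01 => t0 t1.
  set A := dot (a - x) _ in ab *; set B := dot (b - x) _ in ab *.
  have [t00|tn0] := eqVneq t 0.
    by rewrite t00 mul0r addr0 subr0 mul1r => A0; rewrite A0 mul0r ltxx in ab.
  have t_gt0 : 0 < t by rewrite lt0r tn0.
  move=> AB; have : 0 < ((1 - t) * A + t * B) * B.
    rewrite mulrDl ltr_wpDl//; first by rewrite -mulrA mulr_ge0 ?subr_ge0//; exact: ltW.
    rewrite -mulrA mulr_gt0// -expr2 lt0r sqr_ge0 andbT sqrf_eq0.
    by apply: contraTneq ab => ->; rewrite mulr0 ltxx.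
  by rewrite AB mul0r ltxx.
suff : rbox x r (g t) by move=> /rB/(_ e'); apply; [rewrite Pe'|exists y'].
move=> i; rewrite distrC.
have -> : g t ord0 i - x ord0 i = (1 - t) * (a ord0 i - x ord0 i) + t * (b ord0 i - x ord0 i).
  by have := congr1 (fun m : 'rV[R]_n.+1 => m ord0 i) gE; rewrite !mxE.
case/andP: t01 => t0 t1; have := xa i; have := xb i; rewrite ![`|x _ _ - _|]distrC.
move=> hb ha; apply: le_lt_trans (ler_normD _ _) _; rewrite !normrM.
rewrite (ger0_norm t0) (ger0_norm (_ : 0 <= 1 - t)) ?subr_ge0//.
have -> : r = (1 - t) * r + t * r by ring.
have [->|tn0] := eqVneq t 0; first by rewrite !mul0r !addr0 subr0 !mul1r.
apply: ler_ltD; last by rewrite ltr_pM2l// lt0r tn0.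
by apply: ler_wpM2l; rewrite ?subr_ge0//; exact: ltW.
Qed.

Let exits e := 0 < dot v (nu e).

Let sg e : R := (-1) ^+ (~~ exits e).

(** The crossing sign and the Jacobian of the projection recombine into the flux factor v . nu. *)
Lemma sg_dot e : P e -> sg e * `|dot v (nu e)| = dot v (nu e).
Proof.
move=> Pe; rewrite /sg /exits; have := v_transversal Pe.
rewrite neq_lt => /orP[h|h]; last by rewrite h expr0 mul1r gtr0_norm.
by rewrite ltNge (ltW h) expr1 mulN1r ltr0_norm// opprK.
Qed.

Let hits z e := P e && `[< fd e (face_hit e z) >].

(** [nu_outward] describes membership along the normal only; [same_side] transfers it to the
    direction [v], the sign of v . nu telling which side is reached. *)
Lemma section_switch z e : generic_pt z -> hits z e -> exists2 r, 0 < r &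
  forall s, 0 < s < r ->
  (T (line_pt v z (hit_time e z - s)) <-> exits e) /\
  (T (line_pt v z (hit_time e z + s)) <-> ~~ exits e).
Proof.
move=> gz /andP[Pe /asboolP fy]; set y := face_hit e z in fy.
have [r r0 sideT] := same_side Pe gz fy (par_face_hit z Pe).
have [eps eps0 out] := nu_outward Pe (ex_intro2 _ _ y fy erefl : (par e @` fd e) (par e y)).
have [s1 s10 hs1] := rbox_shift (par e y) (nu e) r0.
have [s2 s20 hs2] := rbox_shift (par e y) v r0.
exists s2 => // s /andP[s0 ss2].
pose t := Num.min eps s1 / 2.
have m0 : 0 < Num.min eps s1 by rewrite lt_min eps0.
have t0 : 0 < t by rewrite divr_gt0.
have tm : t < Num.min eps s1 by rewrite ltr_pdivrMr// mulr2n mulrDr mulr1 ltrDl.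
have [te ts1] : t < eps /\ t < s1 by move: tm; rewrite lt_min => /andP[].
have [Tin Tout] := out t (introT andP (conj t0 te)).
have lineE u : line_pt v z (hit_time e z + u) = par e y + u *: v.
  by rewrite -(line_pt_hit z Pe) /line_pt scalerDl addrA.
have box1 u : `|u| < s1 -> rbox (par e y) r (par e y + u *: nu e) by exact: hs1.
have nt1 : `|- t| < s1 by rewrite normrN gtr0_norm.
have pt1 : `|t| < s1 by rewrite gtr0_norm.
have ns2 : `|- s| < s2 by rewrite normrN gtr0_norm.
have ps2 : `|s| < s2 by rewrite gtr0_norm.
have dE u w : dot (par e y + u *: w - par e y) (nu e) = u * dot w (nu e).
  by rewrite addrAC subrr add0r dotZl.
have nu1 : dot (nu e) (nu e) = 1 by exact: dot_nu (nu_unit Pe).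
rewrite -scaleNr in Tin.
have side u u' : `|u| < s1 -> `|u'| < s2 -> 0 < u * (u' * dot v (nu e)) ->
    T (par e y + u *: nu e) <-> T (par e y + u' *: v).
  by move=> h h' uu'; apply: sideT; [exact: hs1|exact: hs2|rewrite !dE nu1 mulr1].
rewrite !lineE /exits.
have := v_transversal Pe; rewrite neq_lt => /orP[neg|pos].
  rewrite ltNge (ltW neg)/=; split; split=> //.
  - have /side h : `|t| < s1 by []. 
    move=> /(h _ ns2) /= Tt; exfalso; apply: Tout; apply: Tt.
    by rewrite mulNr mulrN -mulrN -mulrN mulr_gt0// mulr_gt0// oppr_gt0.
  - move=> _; apply/(side _ _ nt1 ps2) => //.
    by rewrite mulNr -mulrN -mulrN mulr_gt0// mulr_gt0// oppr_gt0.
rewrite pos/=; split; split=> //.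
- move=> _; apply/(side _ _ nt1 ns2) => //.
  by rewrite mulNr mulNr mulrN opprK !mulr_gt0.
- by move=> /(side _ _ pt1 ps2); rewrite !mulr_gt0// => /(_ isT).
Qed.

Lemma section_integral z p : generic_pt z ->
  (\int[@lebesgue_measure R]_t
     (\1_T (line_pt v z t) * pev (pderiv v p) (line_pt v z t))%:E =
   (\sum_(e | P e) sg e *
     (\1_(fd e) (face_hit e z) * pev p (par e (face_hit e z))))%:E)%E.
Proof.
move=> gz; pose S := [set t | T (line_pt v z t)].
have [B0 TB] := polytopal_bounded T_polytopal.
have oS : open S.
  by have /continuousP := @continuous_line R _ (consrV (0, z)) v; apply.
have inj e e' : hits z e -> hits z e' -> hit_time e z = hit_time e' z -> e = e'.
  move=> /andP[Pe /asboolP fe] /andP[Pe' /asboolP fe'] ee'.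
  apply: (generic_disjoint Pe Pe' gz (subset_closure fe) (subset_closure fe')).
    by rewrite -!line_pt_hit// ee'.
  exact: par_face_hit.
have SB t : S t -> - (B0 + 1) < t < B0 + 1.
  move=> /TB/(_ ord0); rewrite line_pt0// -ltr_norml => /le_lt_trans; apply.
  by rewrite ltrDl.
have Sc a b : a <= b -> (forall e, hits z e -> ~~ (a <= hit_time e z <= b)) ->
    S a <-> S b.
  move=> ab noe.
  have H s s' : a <= s <= b -> a <= s' <= b -> S s -> S s'.
    move=> hs hs' Ss; apply: contrapT => nSs'.
    (* A change of membership produces a boundary point on the line, which genericity identifies
       with one of the listed crossings. *)
    have [r rab] := path_meets_bdry T_open
      (@continuous_line R _ (consrV (0, z)) v) hs hs' Ss nSs'.
    rewrite T_bdry => -[e Pe [y cy yE]].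
    have yz : par e y *m proj_along v = z by rewrite yE; exact: line_ptK.
    have [yh fy] := generic_hit Pe gz cy yz.
    have re : r = hit_time e z by rewrite /hit_time -yh yE; exact/esym/line_pt0.
    have := noe e; rewrite -re rab => /(_ _)/negP; apply=> //.
    by rewrite /hits Pe; apply/asboolP; rewrite -yh.
  by split; apply: H; rewrite ?lexx ?ab.
have := @line_integral R I (hits z) (hit_time^~ z) exits S (B0 + 1) inj SB Sc
  (fun e => @section_switch z e gz) (line_poly (consrV (0, z)) v p) (open_measurable oS).
rewrite (_ : \sum_(e | hits z e) _ = \sum_(e | P e) sg e *
     (\1_(fd e) (face_hit e z) * pev p (par e (face_hit e z)))); last first.
  rewrite /hits big_mkcondr; apply: eq_bigr => e Pe.
  rewrite horner_line_poly -[consrV _ + _]/(line_pt v z (hit_time e z)) line_pt_hit//.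
  rewrite indicE; case: asboolP => h; first by rewrite mem_set// mul1r.
  by rewrite memNset// mul0r mulr0.
move=> <-; apply: eq_integral => t _.
by rewrite deriv_line_poly horner_line_poly.
Qed.

Lemma integral_indicM m (D : set 'rV[R]_m) (f : 'rV[R]_m -> R) :
  (\int[L m]_(x in D) (f x)%:E = \int[L m]_x (\1_D x * f x)%:E)%E.
Proof.
rewrite integral_mkcond; apply: eq_integral => x _; rewrite patchE indicE.
by case: ifP => _; rewrite ?mul1r ?mul0r.
Qed.

Lemma integrable_indicM m (D : set 'rV[R]_m) (f : 'rV[R]_m -> R) : measurable D ->
  (L m).-integrable D (EFin \o f) ->
  (L m).-integrable setT (fun x => (\1_D x * f x)%:E).
Proof.
move=> mD /(integrable_mkcond _ mD); congr (_.-integrable _ _).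
apply/funext => x; rewrite patchE indicE.
by case: ifP => _; rewrite ?mul1r ?mul0r.
Qed.

Lemma face_integral e p : P e ->
  (L n).-integrable setT (fun z => (\1_(fd e) (face_hit e z) *
     pev p (par e (face_hit e z)))%:E) /\
  (\int[L n]_z (\1_(fd e) (face_hit e z) * pev p (par e (face_hit e z)))%:E =
   (`|dot v (nu e)| * \int[L n]_(y in fd e) pev p (par e y))%:E)%E.
Proof.
move=> Pe; pose A := face_proj e.
have ui : invmx A \in unitmx by rewrite unitmx_inv face_projU.
pose q := pcomp_affine (fr e) (o e) p.
have qE y : pev p (par e y) = pev q y by rewrite /q pev_comp_affine /par addrC.
have mfd := polytopal_measurable (fd_polytopal e).
have ifd := integrable_pev q mfd (polytopal_bounded (fd_polytopal e)).
have ig := integrable_indicM mfd ifd.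
have c0 : 0 < `|\det (invmx A)|.
  by rewrite normr_gt0 -unitfE -unitmxE.
have mh : measurable_fun setT (face_hit e) by exact: measurable_affine_rV.
have ch E : measurable E -> (`|\det (invmx A)|%:E * L n (face_hit e @^-1` E) = L n E)%E.
  by move=> mE; exact: lebesgue_rV_affine.
have gE : (fun z => (\1_(fd e) (face_hit e z) * pev p (par e (face_hit e z)))%:E) =
    (fun y => (\1_(fd e) y * pev q y)%:E) \o face_hit e.
  by apply/funext => z /=; rewrite qE.
rewrite gE; split; first exact: (integrable_change mh (ltW c0) ch c0 ig).
have dA : `|\det A| = `|dot v (nu e)|.
  by rewrite (det_proj_along v0 (fr_iso e) (nu_unit Pe) (nu_orth Pe)).
have dA0 : `|dot v (nu e)| != 0 by rewrite normr_eq0 v_transversal.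
have -> : (\int[L n]_(y in fd e) pev p (par e y)) = \int[L n]_(y in fd e) pev q y.
  by apply: eq_Rintegral => y _; rewrite qE.
rewrite EFinM /Rintegral fineK; last exact: (integrable_fin_num mfd).
rewrite [in RHS]integral_indicM -(integral_change mh (ltW c0) ch c0 ig).
by rewrite det_inv normfV dA muleA -EFinM mulfV// mul1e.
Qed.

Lemma integral_sum_cond m (J : Type) (s : seq J) (Q : pred J)
    (f : J -> 'rV[R]_m -> \bar R) :
  (forall k, Q k -> (L m).-integrable setT (f k)) ->
  (\int[L m]_x (\sum_(k <- s | Q k) f k x) =
   \sum_(k <- s | Q k) \int[L m]_x f k x)%E.
Proof.
move=> fi; pose h k := if Q k then f k else cst 0%E.
transitivity (\int[L m]_x (\sum_(k <- s) h k x))%E.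
  apply: eq_integral => x _; rewrite big_mkcond; apply: eq_bigr => k _.
  by rewrite /h; case: ifP.
rewrite integral_sum//; last first.
  by move=> k; rewrite /h; case: ifP => [/fi //|_]; exact: integrable0.
rewrite [RHS]big_mkcond; apply: eq_bigr => k _; rewrite /h; case: ifP => // _.
exact: integral0.
Qed.

Lemma directional_divergence p :
  \int[L n.+1]_(x in T) pev (pderiv v p) x =
  \sum_(e | P e) dot v (nu e) * \int[L n]_(y in fd e) pev p (par e y).
Proof.
pose q := pderiv v p; have mT := polytopal_measurable T_polytopal.
have iT := integrable_pev q mT (polytopal_bounded T_polytopal).
pose g x := (\1_T x * pev q x)%:E.
have ig : (L n.+1).-integrable setT g by exact: integrable_indicM.
pose K := block_mx 1%:M (tailrV v) 0 1%:M : 'M[R]_(1 + n).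
have dK : \det K = 1 by rewrite /K det_ublock !det1 mulr1.
have uK : (K : 'M[R]_n.+1) \in unitmx by rewrite unitmxE -/(\det K) dK unitr1.
pose phi (x : 'rV[R]_n.+1) := x *m (K : 'M[R]_n.+1) + 0.
have mphi : measurable_fun setT phi by exact: measurable_affine_rV.
have ch E : measurable E -> (1%:E * L n.+1 (phi @^-1` E) = L n.+1 E)%E.
  by move=> mE; rewrite -(lebesgue_rV_affine 0 uK mE) dK normr1.
have igp := integrable_change mphi ler01 ch ltr01 ig.
have Ig := integral_change mphi ler01 ch ltr01 ig.
have phiE z t : phi (consrV (t, z)) = line_pt v z t by rewrite /phi addr0 line_ptE.
have [ih hE] := lebesgue_rV_fubini igp.
apply: EFin_inj; rewrite /Rintegral fineK; last exact: integrable_fin_num.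
rewrite integral_indicM -/(g _) -[LHS]Ig mul1e hE.
transitivity (\int[L n]_z (\sum_(e | P e) (sg e)%:E *
  (\1_(fd e) (face_hit e z) * pev p (par e (face_hit e z)))%:E))%E.
  apply: ae_eq_integral => //.
  - exact: (measurable_fubini_G ih).
  - suff /integrableP[] : (L n).-integrable setT (fun z => \sum_(e | P e) (sg e)%:E *
        (\1_(fd e) (face_hit e z) * pev p (par e (face_hit e z)))%:E)%E by [].
    apply: (@integrable_sum _ _ _ (L n) setT measurableT I (index_enum I) P
      (fun e z => (sg e)%:E *
        (\1_(fd e) (face_hit e z) * pev p (par e (face_hit e z)))%:E)%E) => e Pe.
    apply: integrableZl => //.
    by have [] := face_integral p Pe.
  apply: negligibleS generic_pt_ae => z /=; apply: contra_not => gz _.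
  under [LHS]eq_integral do rewrite /g /= phiE.
  rewrite section_integral// -sumEFin; apply: eq_bigr => e Pe.
  by rewrite EFinM.
rewrite integral_sum_cond; last first.
  by move=> e Pe; apply: integrableZl => //; have [] := face_integral p Pe.
rewrite -sumEFin; apply: eq_bigr => e Pe; rewrite integralZl//; last first.
  by have [] := face_integral p Pe.
have [_ ->] := face_integral p Pe.
by rewrite -EFinM mulrA sg_dot.
Qed.

End element.
End generic_lines.

(** * Transversal directions on the moment curve *)

Section moment_curve.
Context {R : realType}.
Variable n : nat.

(** This curve meets each hyperplane through the origin at finitely many parameters, so finitely
    many transversality conditions can be met at once; its first coordinate is 1, as the projections
    demand. *)
Definition moment_pt (s : R) : 'rV[R]_n.+1 := \row_i s ^+ i.

Definition dot_poly (w : 'rV[R]_n.+1) : {poly R} := \poly_(i < n.+1) w ord0 (inord i).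

Lemma horner_dot_poly w s : (dot_poly w).[s] = dot (moment_pt s) w.
Proof.
rewrite /dot_poly horner_poly; apply: eq_bigr => i _.
by rewrite inord_val mxE mulrC.
Qed.

Lemma dot_poly_eq0 w : dot_poly w = 0 -> w = 0.
Proof.
move=> w0; apply/rowP => i; have := congr1 (fun q : {poly R} => q`_i) w0.
by rewrite /= coef_poly ltn_ord inord_val coef0 mxE.
Qed.

Lemma moment_pt0 s : moment_pt s ord0 ord0 = 1.
Proof. by rewrite mxE expr0. Qed.

Lemma transversal_moment (I : finType) (P : pred I) (nu : I -> 'rV[R]_n.+1) :
  (forall e, P e -> nu e != 0) ->
  exists2 Q : {poly R}, Q != 0 & forall s, Q.[s] != 0 ->
    forall e, P e -> dot (moment_pt s) (nu e) != 0.
Proof.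
move=> nu0; exists (\prod_(e | P e) dot_poly (nu e)).
  by apply/prodf_neq0 => e Pe; apply: contra (nu0 e Pe) => /eqP/dot_poly_eq0 ->.
move=> s; rewrite horner_prod => /prodf_neq0 h e Pe.
by rewrite -horner_dot_poly h.
Qed.

Lemma exists_transversal (I : finType) (P : pred I) (nu : I -> 'rV[R]_n.+1) :
  (forall e, P e -> nu e != 0) ->
  exists2 v : 'rV[R]_n.+1, v ord0 ord0 = 1 & forall e, P e -> dot v (nu e) != 0.
Proof.
move=> /transversal_moment[Q Q0 hQ].
have [s Qs] : exists s, Q.[s] != 0.
  apply: contrapT => /forallNP h; move: Q0; rewrite (_ : Q = 0) ?eqxx//.
  by apply: poly_horner_eq0 => s; apply/eqP; have /negP := h s; rewrite negbK.
exists (moment_pt s); [exact: moment_pt0|exact: hQ].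
Qed.

End moment_curve.

(** * The divergence theorem in coordinate directions *)

Section mesh_divergence.
Context {R : realType}.
Local Notation L := (@lebesgue_rV R).
Variables (n : nat) (Th : @mesh R n.+1) (Om : set 'rV[R]_n.+1).
Hypotheses (n_gt0 : (0 < n)%N) (hTh : is_mesh Th Om).
Implicit Types (T : elem Th) (e : face Th).

Lemma enorm1_neq0 m (w : 'rV[R]_m) : enorm w = 1 -> w != 0.
Proof.
apply: contra_eqN => /eqP ->; rewrite /enorm /dot big1 ?sqrtr0 1?eq_sym ?oner_eq0//.
by move=> i _; rewrite mxE mul0r.
Qed.

Lemma fparam_disjoint e e' : e != e' ->
  (fun y => forg e + y *m fframe e) @` fdom e `&`
  (fun y => forg e' + y *m fframe e') @` fdom e' = set0.
Proof. exact: (face_disjoint hTh). Qed.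

(* Both sides are linear in the direction. On the moment curve s |-> (s^i)_i their
   difference is a polynomial in s, which vanishes whenever the direction is
   transversal to all faces, hence outside the zeros of a nonzero polynomial. *)
Lemma divergence_component T i p :
  vint T (pev (mderiv i p)) =
  \sum_(e | face_of T e) onormal T e ord0 i * fint e (fun y => pev p (fparam e y)).
Proof.
pose la i' := vint T (pev (mderiv i' p)) -
  \sum_(e | face_of T e) onormal T e ord0 i' * fint e (fun y => pev p (fparam e y)).
suff : la i = 0 by move/eqP; rewrite subr_eq0 => /eqP.
have nu0 e : face_of T e -> onormal T e != 0.
  by move=> Te; apply: enorm1_neq0; exact: (normal_unit hTh).
have [Q Q0 hQ] := transversal_moment nu0.
have [mT bT] : measurable (elt T) /\ rV_bounded (elt T).
  by split; [apply: polytopal_measurable|apply: polytopal_bounded]; exact: (elt_polytopal hTh).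
have dir s : Q.[s] != 0 -> dot (moment_pt n s) (\row_i' la i') = 0.
  move=> Qs; set v := moment_pt n s.
  have projU e : face_of T e -> face_proj (@fframe R n.+1 Th) v e \in unitmx.
    move=> Te; rewrite unitmxE unitfE -normr_eq0.
    rewrite (det_proj_along (moment_pt0 n s) (fframe_isometric hTh e)
      (normal_unit hTh Te) (normal_orth hTh Te)) normr_eq0; exact: hQ.
  have h := @directional_divergence R n _ (@fdom R n.+1 Th) (@forg R n.+1 Th)
    (@fframe R n.+1 Th) (face_of T) v n_gt0 (moment_pt0 n s) (fdom_polytopal hTh)
    fparam_disjoint projU (elt T) (onormal T) (elt_polytopal hTh T) (elt_bdry hTh T)
    (fframe_isometric hTh) (@normal_unit _ _ _ _ hTh T) (@normal_orth _ _ _ _ hTh T)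
    (@normal_outward _ _ _ _ hTh T) (hQ s Qs) p.
  rewrite /dot; under eq_bigr do rewrite [X in _ * X]mxE /la mulrBr.
  rewrite sumrB; apply/eqP; rewrite subr_eq0; apply/eqP.
  transitivity (vint T (pev (pderiv v p))).
    rewrite /vint /pderiv (lform_sum (pint_linear mT bT)); apply: eq_bigr => j _.
    by rewrite (lformZ (pint_linear mT bT)).
  rewrite /vint h.
  under [RHS]eq_bigr do rewrite mulr_sumr.
  rewrite exchange_big/=; apply: eq_bigr => e Te.
  rewrite mulr_suml; apply: eq_bigr => j _; rewrite mulrA; congr (_ * _).
have /eqP : Q * dot_poly (\row_i' la i') = 0.
  apply: poly_horner_eq0 => s; rewrite hornerM horner_dot_poly.
  by have [->|/dir ->] := eqVneq Q.[s] 0; rewrite ?mul0r ?mulr0.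
rewrite mulf_eq0 (negbTE Q0) => /= /eqP/dot_poly_eq0/rowP/(_ i).
by rewrite !mxE.
Qed.

End mesh_divergence.

(** * Faces shared by elements and subdomains *)

Section mesh_topology.
Context {R : realType}.
Local Notation L := (@lebesgue_rV R).
Variables (n : nat) (Th : @mesh R n.+1) (Om : set 'rV[R]_n.+1).
Hypotheses (n_gt0 : (0 < n)%N) (hOm : polytopal_domain Om) (hTh : is_mesh Th Om).
Implicit Types (T : elem Th) (e : face Th).

Lemma open_elt T : open (elt T).
Proof. exact: polytopal_open (elt_polytopal hTh T). Qed.

Lemma elt_nonempty T : elt T !=set0.
Proof. by have [] := elt_polytopal hTh T. Qed.

Lemma open_meets_closure m (U A : set 'rV[R]_m) x : open U -> U x -> closure A x ->
  exists2 y, U y & A y.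
Proof.
move=> oU Ux cA; have [|y [Ay Uy]] := cA U; first exact: open_nbhs_nbhs.
by exists y.
Qed.

Lemma elt_eq T T' x : elt T x -> closure (elt T') x -> T = T'.
Proof.
move=> Tx cx; apply: contrapT => /eqP ne.
have [y Ty T'y] := open_meets_closure (@open_elt T) Tx cx.
by have : (elt T `&` elt T') y by []; rewrite (elt_disjoint hTh).
Qed.

Lemma open_sub_domain U : open U -> U `<=` closure Om -> U `<=` Om.
Proof.
move=> oU UO; have [_ _ _ -> _] := hOm.
by move=> x Ux; apply: (interiorS UO); rewrite (interior_id U).1.
Qed.

Lemma elt_sub_domain T : elt T `<=` Om.
Proof.
apply: open_sub_domain; first exact: open_elt.
by rewrite (elt_cover hTh) => x Tx; exists T => //; exact: subset_closure.
Qed.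

Lemma face_has_elt e : exists T, face_of T e.
Proof.
have : (0 < #|[set T | face_of T e]%SET|)%N.
  by case: (face_shared hTh e) => -[_ ->].
by rewrite card_gt0 => /set0Pn[T]; rewrite finset.in_set; exists T.
Qed.

Lemma face_of_bdry T e : face_of T e -> face_set e `<=` bdry (elt T).
Proof. by move/asboolP. Qed.

Lemma face_nonempty e : exists x, face_relint e x.
Proof. by have [[y fy] _ _ _ _] := fdom_polytopal hTh e; exists (fparam e y), y. Qed.

Lemma face_relint_set e : face_relint e `<=` face_set e.
Proof. by move=> _ [y fy <-]; exists y => //; exact: subset_closure. Qed.

Lemma bdry_open m (A : set 'rV[R]_m) : open A -> bdry A = closure A `\` A.
Proof. by rewrite /bdry => /interior_id ->. Qed.

Lemma face_two_elts e T T' : face_of T e -> face_of T' e -> T != T' ->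
  face_relint e `<=` Om /\ forall T'', face_of T'' e -> T'' = T \/ T'' = T'.
Proof.
move=> Te T'e ne.
have sub : [set T; T']%SET \subset [set T'' | face_of T'' e]%SET.
  by apply/fintype.subsetP => U /set2P[] ->; rewrite finset.in_set.
have c2 : #|[set T; T']%SET| = 2%N by rewrite cards2 ne.
case: (face_shared hTh e) => [[rO ce]|[_ ce]]; last first.
  by have := subset_leq_card sub; rewrite c2 ce.
split=> // T'' T''e.
have : [set T; T']%SET == [set T'' | face_of T'' e]%SET.
  by rewrite eqEcard sub c2 ce.
by move=> /eqP/setP/(_ T''); rewrite [RHS]finset.in_set T''e => /set2P.
Qed.

Lemma dotC m (x y : 'rV[R]_m) : dot x y = dot y x.
Proof. by apply: eq_bigr => i _; rewrite mulrC. Qed.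

(** Both normals are unit vectors orthogonal to the face, so they agree up to sign; equal normals
    would put the points just behind the face into two disjoint elements. *)
Lemma normal_opposite e T T' : face_of T e -> face_of T' e -> T != T' ->
  onormal T' e = - onormal T e.
Proof.
move=> Te T'e ne.
have E : onormal T' e = dot (onormal T' e) (onormal T e) *: onormal T e.
  rewrite {1}(frame_decomposition (fframe_isometric hTh e) (normal_unit hTh Te)
    (normal_orth hTh Te) (onormal T' e)).
  by rewrite (nu_F (normal_orth hTh T'e)) mul0mx addr0.
set a := dot _ _ in E.
have a2 : a ^+ 2 = 1.
  by have := dot_nu (normal_unit hTh T'e); rewrite {1}E dotZl dotC -/a -expr2.
have := a2; move/eqP; rewrite sqrf_eq1 => /orP[] /eqP a1; last first.
  by rewrite E a1 scaleN1r.
rewrite a1 scale1r in E.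
have [x ex] := face_nonempty e.
have [r r0 h] := normal_outward hTh Te ex; have [r' r'0 h'] := normal_outward hTh T'e ex.
pose t := Num.min r r' / 2.
have m0 : 0 < Num.min r r' by rewrite lt_min r0.
have tm : t < Num.min r r' by rewrite ltr_pdivrMr// mulr2n mulrDr mulr1 ltrDl.
have t0 : 0 < t by rewrite divr_gt0.
move: tm; rewrite lt_min => /andP[tr tr'].
have [] := h t; first by rewrite t0.
have [|T'x _ Tx _] := h' t; first by rewrite t0.
have : (elt T `&` elt T') (x - t *: onormal T e) by split=> //; rewrite -E.
by rewrite (elt_disjoint hTh).
Qed.

(* The divergence theorem for the field e_0, summed over the closed family: the
   faces cancel in pairs, but each element contributes its positive volume. *)
Lemma no_closed_family (B : pred (elem Th)) :
  (forall T e, B T -> face_of T e -> exists2 T', B T' & face_of T' e && (T != T')) ->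
  forall T, ~~ B T.
Proof.
move=> hB T0; apply/negP => BT0.
pose X0 : mpoly n.+1 R := mpolyX R (mnm1 ord0).
have vol T : 0 < vint T (pev (mderiv ord0 X0)).
  have -> : mderiv ord0 X0 = 1.
    rewrite mderivX mnm1E eqxx.
    have -> : mnm_sub (mnm1 ord0) (mnm1 ord0) = mnm0 :> multinom n.+1.
      by apply/mnmP => k; rewrite mnmBE subnn mnm0E.
    by rewrite mpolyX0 scale1r.
  have [x Tx] := @elt_nonempty T.
  apply: (@pint_gt0 R _ (elt T) 1 x) => //; rewrite ?pev1//.
  - exact: open_elt.
  - exact: polytopal_bounded (elt_polytopal hTh T).
  - by move=> y _; rewrite pev1.
have : 0 < \sum_(T | B T) vint T (pev (mderiv ord0 X0)).
  rewrite (bigD1 T0)//= ltr_pwDl//; apply: sumr_ge0 => T _; exact: ltW.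
under eq_bigr do rewrite (divergence_component n_gt0 hTh) big_mkcond.
rewrite exchange_big big1 ?ltxx// => e _.
rewrite -big_mkcondr.
have [T /andP[BT Te]|none] := pickP (fun T => B T && face_of T e); last first.
  by rewrite big_pred0.
have [T' BT' /andP[T'e ne]] := hB T e BT Te.
have [_ two] := face_two_elts Te T'e ne.
rewrite (bigD1 T) ?BT//= (bigD1 T') ?BT' ?T'e ?(eq_sym T')//=.
rewrite big_pred0; last first.
  move=> U; apply/negP => /andP[/andP[/andP[_ /two[]->]]]; rewrite eqxx//.
by rewrite addr0 (normal_opposite Te T'e ne) mxE mulNr subrr.
Qed.

(* A generic line meets e in a relatively interior point; an element of B touching
   that point does so along one of its own faces, in its relative interior, so this
   face is e. *)
Lemma face_in_cover (C : set 'rV[R]_n.+1) (B : pred (elem Th)) e : open C ->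
  closure C = \bigcup_(T in [set T | B T]) closure (elt T) ->
  (forall T, B T -> elt T `<=` C) -> face_set e `<=` bdry C ->
  exists2 T, B T & face_of T e.
Proof.
move=> oC cC BC eC.
(* One owner per face supplies a normal. The direction must be transversal to all faces, because the
   face of [T] found at the point is not known in advance. *)
have /choice[Te hTe] := face_has_elt.
have nu0 e' : xpredT e' -> onormal (Te e') e' != 0.
  by move=> _; apply: enorm1_neq0; exact: (normal_unit hTh (hTe e')).
have [v v0 hv] := exists_transversal nu0.
have projU e' : xpredT e' -> face_proj (@fframe R n.+1 Th) v e' \in unitmx.
  move=> _; rewrite unitmxE unitfE -normr_eq0.
  rewrite (det_proj_along v0 (fframe_isometric hTh e') (normal_unit hTh (hTe e'))
    (normal_orth hTh (hTe e'))) normr_eq0; exact: hv.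
have gae := generic_pt_ae (@forg R n.+1 Th) n_gt0 (fdom_polytopal hTh) projU.
(* The feet of the lines through the relative interior of [e] have positive measure, so one of them
   is generic. *)
have [z fz gz] : exists2 z, fdom e (face_hit (@forg R n.+1 Th) (@fframe R n.+1 Th) v e z) &
    generic_pt (@fdom R n.+1 Th) (@forg R n.+1 Th) (@fframe R n.+1 Th) xpredT v z.
  apply: contrapT => nex.
  have mf := polytopal_measurable (fdom_polytopal hTh e).
  have ui : invmx (face_proj (@fframe R n.+1 Th) v e) \in unitmx by rewrite unitmx_inv projU.
  have := lebesgue_rV_affine (- (forg e *m proj_along v) *m
    invmx (face_proj (@fframe R n.+1 Th) v e)) ui mf.
  have [y fy] : fdom e !=set0 by have [] := fdom_polytopal hTh e.
  have := lebesgue_rV_open_gt0 (polytopal_open (fdom_polytopal hTh e)) fy.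
  set E := _ @^-1` _; move=> + EE; rewrite -EE.
  suff -> : L n E = 0%E by rewrite mule0 ltxx.
  have mE : measurable E by rewrite -[X in measurable X]setTI; exact: measurable_affine_rV.
  apply/(negligibleP _ mE); apply: negligibleS gae => z Ez /= gz.
  by apply: nex; exists z.
set y := face_hit _ _ _ _ _ in fz.
have : bdry C (fparam e y) by apply: eC; exists y => //; exact: subset_closure.
rewrite (bdry_open oC) cC => -[[T BT cT] nC].
have : bdry (elt T) (fparam e y).
  by rewrite (bdry_open (@open_elt T)); split=> // /(BC _ BT).
rewrite (elt_bdry hTh) => -[e' Te' [y' cy' yy']].
exists T => //; suff <- : e' = e by [].
have dis := fparam_disjoint hTh.
apply: (generic_disjoint (o := @forg R n.+1 Th) (fr := @fframe R n.+1 Th) (P := xpredT) (v := v)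
  (fdom_polytopal hTh) dis projU isT isT gz cy' (subset_closure fz) yy').
rewrite -[forg e' + _]/(fparam e' y') yy'.
exact: (par_face_hit (@forg R n.+1 Th) projU z (e := e) isT).
Qed.

End mesh_topology.

(** * Interfaces and outer faces of the subdomains *)

Section decomposition.
Context {R : realType}.
Variables (n : nat) (Th : @mesh R n.+1) (Om : set 'rV[R]_n.+1).
Variables (M : nat) (sub : 'I_M -> set 'rV[R]_n.+1).
Hypotheses (n_gt0 : (0 < n)%N) (hOm : polytopal_domain Om) (hTh : is_mesh Th Om).
Hypothesis hsub : is_decomposition Th Om sub.
Implicit Types (T : elem Th) (e : face Th) (i j : 'I_M).

Lemma sub_sub_domain j : sub j `<=` Om.
Proof.
apply: (open_sub_domain hOm); first exact: (sub_open hsub).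
by rewrite (sub_cover hsub) => x jx; exists j => //; exact: subset_closure.
Qed.

Lemma elem_in_some T : exists j, elem_in (sub j) T.
Proof.
have [x Tx] := @elt_nonempty _ _ _ _ hTh T.
have : closure Om x by apply: subset_closure; exact: (elt_sub_domain hOm hTh Tx).
rewrite (sub_cover hsub) => -[j _]; rewrite (sub_elts hsub) => -[T' T'j cT'].
by exists j; rewrite (elt_eq hTh Tx cT').
Qed.

Lemma elem_in_uniq T i j : elem_in (sub i) T -> elem_in (sub j) T -> i = j.
Proof.
move=> /asboolP Ti /asboolP Tj; apply: contrapT => /eqP ne.
have [x Tx] := @elt_nonempty _ _ _ _ hTh T.
have : (sub i `&` sub j) x by split; [exact: Ti|exact: Tj].
by rewrite (sub_disjoint hsub).
Qed.

Lemma GintC i j : Gint sub i j = Gint sub j i.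
Proof. exact: setIC. Qed.

Lemma adjacentC i j : adjacent_sub sub i j = adjacent_sub sub j i.
Proof. by rewrite /adjacent_sub eq_sym GintC. Qed.

Lemma Gint_elt i j e : face_in (Gint sub j i) e ->
  exists2 T, elem_in (sub j) T & face_of T e.
Proof.
move=> /asboolP eG.
have h := @face_in_cover R n Th Om n_gt0 hTh (sub j) (elem_in (sub j)) e
  (@sub_open _ _ _ _ _ _ hsub j) (sub_elts hsub j).
apply: h.
  by move=> T /asboolP.
by move=> x /eG[].
Qed.

Lemma Gint_sub_face i j e : face_in (Gint sub j i) e -> sub_face sub j e.
Proof.
by move=> /Gint_elt[T Tj Te]; apply/existsP; exists T; rewrite Tj.
Qed.

Lemma Gint_elts i j e : j != i -> face_in (Gint sub j i) e -> exists T T',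
  [/\ elem_in (sub j) T, elem_in (sub i) T', face_of T e, face_of T' e & T != T'].
Proof.
move=> ne eG; have [T Tj Te] := Gint_elt eG.
have [T' T'i T'e] : exists2 T, elem_in (sub i) T & face_of T e.
  by apply: Gint_elt; rewrite GintC; exact: eG.
exists T, T'; split=> //; apply: contra ne => /eqP TT'.
by apply/eqP; apply: (@elem_in_uniq T) => //; rewrite TT'.
Qed.

(** Only two elements contain [e] and one of them lies in [sub j], so the other determines the
    neighbour. A test function on [e] thus sees a single multiplier. *)
Lemma Gint_uniq i i' j e : j != i -> j != i' ->
  face_in (Gint sub j i) e -> face_in (Gint sub j i') e -> i = i'.
Proof.
move=> ne ne' /(Gint_elts ne)[T [T' [Tj T'i Te T'e TT']]].
move=> /(Gint_elts ne')[U [U' [Uj U'i _ U'e _]]].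
have [_ two] := face_two_elts hTh Te T'e TT'.
have [U'T|U'T'] := two U' U'e; last first.
  by apply: (@elem_in_uniq T') => //; rewrite -U'T'.
have ij : i' = j by apply: (@elem_in_uniq T) => //; rewrite -U'T.
by rewrite ij eqxx in ne'.
Qed.

(** A face of two elements has its relative interior inside the open set [Om]; test functions
    supported on it therefore satisfy the homogeneous boundary condition. *)
Lemma Gint_not_Gext i j j' e : j != i -> face_in (Gint sub j i) e ->
  ~~ face_in (Gext Om sub j') e.
Proof.
move=> ne /(Gint_elts ne)[T [T' [Tj T'i Te T'e TT']]].
have [rO _] := face_two_elts hTh Te T'e TT'.
apply/negP => /asboolP eG; have [x ex] := face_nonempty hTh e.
have [] := eG x (face_relint_set ex).
by rewrite (bdry_open (polytopal_open hOm)) => -[_ nO] _; apply: nO; exact: rO.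
Qed.

Lemma elem_closure j T : elem_in (sub j) T -> closure (elt T) `<=` closure (sub j).
Proof. by move=> /asboolP; exact: closureS. Qed.

Lemma face_in_closure T e : face_of T e -> face_set e `<=` closure (elt T).
Proof.
by move=> /face_of_bdry eb x /eb; rewrite (bdry_open (@open_elt _ _ _ _ hTh T)) => -[].
Qed.

Lemma shared_face_in_bdry i j T T' e : elem_in (sub j) T -> elem_in (sub i) T' ->
  j != i -> face_of T e -> face_of T' e -> face_set e `<=` bdry (sub j).
Proof.
move=> Tj T'i ne Te T'e x ex.
rewrite (bdry_open (@sub_open _ _ _ _ _ _ hsub j)); split.
  by apply: (elem_closure Tj); exact: (face_in_closure Te).
move=> jx.
have [y jy T'y] :=
  open_meets_closure (@sub_open _ _ _ _ _ _ hsub j) jx (face_in_closure T'e ex).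
have : (sub j `&` sub i) y by split=> //; move/asboolP: T'i; apply.
by rewrite (sub_disjoint hsub).
Qed.

Lemma codim1_face (A : set 'rV[R]_n.+1) e : face_set e `<=` A -> has_codim1 A.
Proof.
move=> eA; have [[y fy] _ _ _ [N [p [pind cp]]]] := fdom_polytopal hTh e.
have : closure (fdom e) y by exact: subset_closure.
rewrite cp => -[l _ _].
exists (fun m => fparam e (p l m)).
  have := pind l; rewrite /affinely_independent row_free_unit.
  set P := \matrix_(_ < _) _ => uP; apply/row_freeP.
  (* A right inverse of the edge matrix in space: the frame is isometric and the edge matrix [P] in
     face coordinates is invertible. *)
  exists ((fframe e)^T *m invmx P).
  have -> : \matrix_(m < n) (fparam e (p l (lift ord0 m)) - fparam e (p l ord0)) =
      P *m fframe e.
    apply/row_matrixP => m; rewrite rowK row_mul rowK /fparam opprD addrACA subrr.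
    by rewrite add0r -mulmxBl.
  by rewrite mulmxA -(mulmxA P) (fframe_isometric hTh) mulmx1 mulmxV.
move=> x [t [t0 t1 ->]]; apply: eA; exists (\sum_m t m *: p l m).
  by rewrite cp; exists l => //; exists t.
rewrite /fparam; under [RHS]eq_bigr do rewrite scalerDr.
rewrite big_split -scaler_suml t1 scale1r mulmx_suml; congr (_ + _).
by apply: eq_bigr => m _; rewrite scalemxAl.
Qed.

(** Passing through a face from one subdomain to another always crosses an interface that carries
    multipliers, so the interface estimates apply there. *)
Lemma shared_adjacent i j T T' e : elem_in (sub j) T -> elem_in (sub i) T' ->
  j != i -> face_of T e -> face_of T' e ->
  adjacent_sub sub j i /\ face_in (Gint sub j i) e.
Proof.
move=> Tj T'i ne Te T'e.
have eG : face_set e `<=` Gint sub j i.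
  move=> x ex; split; first exact: (shared_face_in_bdry Tj T'i ne Te T'e).
  by apply: (shared_face_in_bdry T'i Tj _ T'e Te) => //; rewrite eq_sym.
by split; [rewrite /adjacent_sub ne/=; apply/asboolP; exact: codim1_face eG|apply/asboolP].
Qed.

Lemma boundary_face_Gext j T e : elem_in (sub j) T -> face_of T e ->
  face_set e `<=` bdry Om -> face_in (Gext Om sub j) e.
Proof.
move=> Tj Te eO; apply/asboolP => x ex; split; first exact: eO.
rewrite (bdry_open (@sub_open _ _ _ _ _ _ hsub j)); split.
  by apply: (elem_closure Tj); exact: (face_in_closure Te).
move=> /sub_sub_domain; have := eO x ex.
by rewrite (bdry_open (polytopal_open hOm)) => -[].
Qed.

Lemma face_alternative T e : face_of T e ->
  (exists2 T', face_of T' e & T != T') \/ face_set e `<=` bdry Om.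
Proof.
move=> Te; have [[_ c2]|[eO _]] := face_shared hTh e; [left|by right].
have : (0 < #|[set U | face_of U e]%SET :\ T|)%N.
  by move: c2; rewrite (cardsD1 T) finset.in_set Te add1n => -[->].
by rewrite card_gt0 => /set0Pn[T']; rewrite in_setD1 finset.in_set => /andP[ne T'e];
  exists T' => //; rewrite eq_sym.
Qed.

End decomposition.

(** * Discrete operators and convergence of the iteration *)

Section psd_constructions.
Context {R : realType}.

Lemma psd_sum (V : lmodType R) I (s : seq I) (P : pred I) (B : I -> V -> V -> R) :
  (forall i, P i -> psd_form (B i)) ->
  psd_form (fun x y => \sum_(i <- s | P i) B i x y).
Proof.
move=> hB; split=> [x c y z|x y|x].
- rewrite mulr_sumr -big_split; apply: eq_bigr => i Pi.
  exact: (psd_linear (hB i Pi)).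
- by apply: eq_bigr => i Pi; exact: (psd_sym (hB i Pi)).
- by apply: sumr_ge0 => i Pi; exact: (psd_ge0 (hB i Pi)).
Qed.

Lemma psd_add (V : lmodType R) (B1 B2 : V -> V -> R) :
  psd_form B1 -> psd_form B2 -> psd_form (fun x y => B1 x y + B2 x y).
Proof.
move=> h1 h2; split=> [x c y z|x y|x].
- by rewrite (psd_linear h1) (psd_linear h2); ring.
- by rewrite (psd_sym h1) (psd_sym h2).
- by rewrite addr_ge0 ?(psd_ge0 h1) ?(psd_ge0 h2).
Qed.

Lemma psd_scale (V : lmodType R) (B : V -> V -> R) c : 0 <= c ->
  psd_form B -> psd_form (fun x y => c * B x y).
Proof.
move=> c0 h; split=> [x a y z|x y|x].
- by rewrite (psd_linear h); ring.
- by rewrite (psd_sym h).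
- by rewrite mulr_ge0 ?(psd_ge0 h).
Qed.

Lemma psd_comp (V W : lmodType R) (B : V -> V -> R) (phi : W -> V) :
  (forall c x y, phi (c *: x + y) = c *: phi x + phi y) ->
  psd_form B -> psd_form (fun x y => B (phi x) (phi y)).
Proof.
move=> hphi h; split=> [x a y z|x y|x].
- by rewrite hphi (psd_linear h).
- by rewrite (psd_sym h).
- exact: (psd_ge0 h).
Qed.

Lemma psd_rank1 (V : lmodType R) (l : V -> R) :
  linear_form l -> psd_form (fun x y => l x * l y).
Proof.
move=> hl; split=> [x c y z|x y|x]; first by rewrite hl; ring.
  exact: mulrC.
by rewrite -expr2 sqr_ge0.
Qed.

Lemma psd_ext (V : lmodType R) (B B' : V -> V -> R) :
  (forall x y, B x y = B' x y) -> psd_form B' -> psd_form B.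
Proof.
by move=> E; congr psd_form; apply/funext => x; apply/funext => y; rewrite E.
Qed.

Lemma psd_linear_l (V : lmodType R) (B : V -> V -> R) y :
  psd_form B -> linear_form (B^~ y).
Proof. by move=> h c x z /=; rewrite !(psd_sym h _ y) (psd_linear h). Qed.

Lemma weighted_psd n (D : set 'rV[R]_n) (w : 'rV[R]_n -> R) :
  measurable D -> rV_bounded D -> measurable_fun D w -> bounded_on D w ->
  (forall x, D x -> 0 <= w x) ->
  psd_form (fun p q : mpoly n R =>
    \int[lebesgue_rV n]_(x in D) (w x * (pev p x * pev q x))).
Proof.
move=> mD bD mw bw w0.
have E p q : \int[lebesgue_rV n]_(x in D) (w x * (pev p x * pev q x)) =
    \int[lebesgue_rV n]_(x in D) (w x * pev (p * q) x).
  by apply: eq_Rintegral => x _; rewrite pevM.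
split=> [p c q q'|p q|p].
- by rewrite !E mulrDr -scalerAr (wint_linear mD bD mw bw).
- by rewrite !E mulrC.
- by apply: Rintegral_ge0 => x Dx; rewrite mulr_ge0 ?w0// -expr2 sqr_ge0.
Qed.

Lemma unweighted_psd n (D : set 'rV[R]_n) : measurable D -> rV_bounded D ->
  psd_form (fun p q : mpoly n R => \int[lebesgue_rV n]_(x in D) (pev p x * pev q x)).
Proof.
move=> mD bD; apply: psd_ext (@weighted_psd n D (cst 1) mD bD _ _ _) => //.
- by move=> p q; apply: eq_Rintegral => x _; rewrite mul1r.
- by exists 1 => x _; rewrite normr1.
Qed.

Lemma unweighted_definite n (D : set 'rV[R]_n) p : open D -> rV_bounded D -> D !=set0 ->
  \int[lebesgue_rV n]_(x in D) (pev p x * pev p x) = 0 -> p = 0.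
Proof.
move=> oD bD D0 I0; apply: (pint_sqr_eq0 oD bD D0); rewrite -[RHS]I0.
by apply: eq_Rintegral => x _; rewrite pevM.
Qed.

Lemma linear_form_add (V : lmodType R) (l1 l2 : V -> R) :
  linear_form l1 -> linear_form l2 -> linear_form (fun x => l1 x + l2 x).
Proof. by move=> h1 h2 c x y; rewrite h1 h2; ring. Qed.

Lemma linear_form_scale (V : lmodType R) (l : V -> R) b :
  linear_form l -> linear_form (fun x => b * l x).
Proof. by move=> h c x y; rewrite h; ring. Qed.

Lemma linear_form_opp (V : lmodType R) (l : V -> R) :
  linear_form l -> linear_form (fun x => - l x).
Proof. by move=> h c x y; rewrite h; ring. Qed.

Lemma linear_form_sum (V : lmodType R) I (s : seq I) (P : pred I) (l : I -> V -> R) :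
  (forall i, linear_form (l i)) -> linear_form (fun x => \sum_(i <- s | P i) l i x).
Proof.
by move=> h c x y; rewrite mulr_sumr -big_split; apply: eq_bigr => i _; rewrite h.
Qed.

Lemma linear_form_comp (V W : lmodType R) (l : W -> R) (phi : V -> W) :
  (forall c x y, phi (c *: x + y) = c *: phi x + phi y) ->
  linear_form l -> linear_form (fun x => l (phi x)).
Proof. by move=> hphi h c x y; rewrite hphi h. Qed.

(** For sequences of bounded degree, testing with all linear functionals amounts to convergence in
    any norm; this form needs no norm and is preserved by linear maps. *)
Definition tends0 n (p_ : nat -> mpoly n R) :=
  forall l, linear_form l -> (fun i => l (p_ i)) @ \oo --> (0 : R).

Lemma tends0D n (p_ q_ : nat -> mpoly n R) :
  tends0 p_ -> tends0 q_ -> tends0 (fun i => p_ i + q_ i).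
Proof.
move=> hp hq l hl; have -> : (fun i => l (p_ i + q_ i)) = (fun i => l (p_ i) + l (q_ i)).
  by apply/funext => i; rewrite (lformD hl).
have := cvgD (hp l hl) (hq l hl); rewrite addr0; exact.
Qed.

Lemma tends0_map m n (phi : mpoly m R -> mpoly n R) p_ :
  (forall c p q, phi (c *: p + q) = c *: phi p + phi q) ->
  tends0 p_ -> tends0 (fun i => phi (p_ i)).
Proof.
by move=> hphi hp l hl; apply: (hp (l \o phi)) => c p q /=; rewrite hphi hl.
Qed.

Lemma tends0Z n c (p_ : nat -> mpoly n R) :
  tends0 p_ -> tends0 (fun i => c *: p_ i).
Proof.
apply: (tends0_map (phi := fun p => c *: p)) => a p q.
by rewrite scalerDr !scalerA mulrC.
Qed.

Lemma tends0B n (p_ q_ : nat -> mpoly n R) :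
  tends0 p_ -> tends0 q_ -> tends0 (fun i => p_ i - q_ i).
Proof.
move=> hp /(tends0Z (-1)) hq; have := tends0D hp hq.
by congr tends0; apply/funext => i; rewrite scaleN1r.
Qed.

Lemma tends0_ext n (p_ q_ : nat -> mpoly n R) : p_ =1 q_ -> tends0 p_ -> tends0 q_.
Proof. by move=> /funext ->. Qed.

Lemma cvg0Z (b : R) (v : nat -> R) :
  v @ \oo --> (0 : R) -> (fun i => b * v i) @ \oo --> (0 : R).
Proof.
move=> v0; have := cvgM (cvg_cst b : (fun=> b) @ \oo --> b) v0.
by rewrite mulr0; exact.
Qed.

Lemma cvg0D (v w : nat -> R) : v @ \oo --> (0 : R) -> w @ \oo --> (0 : R) ->
  (fun i => v i + w i) @ \oo --> (0 : R).
Proof. by move=> v0 w0; have := cvgD v0 w0; rewrite addr0; exact. Qed.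

Lemma cvg0_sqrt (v : nat -> R) :
  v @ \oo --> (0 : R) -> (fun i => Num.sqrt (v i)) @ \oo --> (0 : R).
Proof.
move=> v0; have := cvg_comp _ _ v0 (@sqrt_continuous R 0).
by rewrite sqrtr0; exact.
Qed.

Lemma cvg0_shift (v : nat -> R) :
  (fun i => v i.+1) @ \oo --> (0 : R) <-> v @ \oo --> (0 : R).
Proof. by rewrite (cvg_shiftS v). Qed.

Lemma tends0_shift n (p_ : nat -> mpoly n R) :
  tends0 (fun i => p_ i.+1) <-> tends0 p_.
Proof.
by split=> h l hl; have := h l hl; rewrite (cvg_shiftS (fun i => l (p_ i))).
Qed.

Lemma tends0_psd n r (B : mpoly n R -> mpoly n R -> R) p_ : psd_form B ->
  (forall p, Pdeg r p -> B p p = 0 -> p = 0) -> (forall i, Pdeg r (p_ i)) ->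
  (forall q, Pdeg r q -> (fun i => B (p_ i) q) @ \oo --> (0 : R)) -> tends0 p_.
Proof.
move=> hB Bdef pr h; apply: (weak_cvg_mpoly _ _ Bdef pr h).
  exact: (psd_linear hB).
by move=> q; exact: (psd_linear_l q hB).
Qed.

Lemma psd_tends0 n r (B : mpoly n R -> mpoly n R -> R) p_ : psd_form B ->
  (forall i, Pdeg r (p_ i)) -> tends0 p_ ->
  (fun i => B (p_ i) (p_ i)) @ \oo --> (0 : R).
Proof.
move=> hB pr h; apply: (quadratic_cvg_mpoly _ _ pr h).
  exact: (psd_linear hB).
by move=> q; exact: (psd_linear_l q hB).
Qed.

Lemma cvg0_squeeze (u v : nat -> R) : (forall i, 0 <= u i <= v i) ->
  v @ \oo --> (0 : R) -> u @ \oo --> (0 : R).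
Proof.
move=> uv v0; apply: (squeeze_cvgr (f := cst 0) (h := v)) => //.
  by apply: nearW => i; exact: uv.
exact: cvg_cst.
Qed.

(** [u] is nonincreasing and bounded below, hence convergent, and [a] is the difference of
    consecutive terms. *)
Lemma decreasing_increments_cvg0 (u a : nat -> R) : (forall i, 0 <= u i) ->
  (forall i, 0 <= a i) -> (forall i, u i.+1 = u i - a i) -> a @ \oo --> (0 : R).
Proof.
move=> u0 a0 ua.
have cu : cvgn u.
  apply: nonincreasing_is_cvgn; last by exists 0 => _ [i _ <-].
  by apply/nonincreasing_seqP => i; rewrite ua gerBl.
have -> : a = (fun i => u i - u i.+1).
  by apply/funext => i; rewrite ua opprB addrC subrK.
rewrite -(subrr (limn u)); apply: cvgB => //.
by rewrite cvg_shiftS.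
Qed.

End psd_constructions.

(** * Green's formula, boundary projection and weak gradient *)

Section discrete_operators.
Context {R : realType}.
Local Notation L := (@lebesgue_rV R).
Variables (n : nat) (Th : @mesh R n.+1) (Om : set 'rV[R]_n.+1).
Hypotheses (n_gt0 : (0 < n)%N) (hTh : is_mesh Th Om).
Implicit Types (T : elem Th) (e : face Th).

Definition vdot T (p q : mpoly n.+1 R) : R := vint T (fun x => pev p x * pev q x).

Definition fdot e (p q : mpoly n R) : R := fint e (fun y => pev p y * pev q y).

Definition trace e (p : mpoly n.+1 R) : mpoly n R :=
  pcomp_affine (fframe e : 'M[R]_(n, n.+1)) (forg e) p.

Lemma pev_trace e p y : pev (trace e p) y = pev p (fparam e y).
Proof. by rewrite /trace pev_comp_affine addrC. Qed.

Lemma trace_linear e c p q : trace e (c *: p + q) = c *: trace e p + trace e q.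
Proof. by rewrite /trace pcomp_affineD pcomp_affineZ. Qed.

Lemma elt_measurable T : measurable (elt T).
Proof. exact: polytopal_measurable (elt_polytopal hTh T). Qed.

Lemma elt_bounded T : rV_bounded (elt T).
Proof. exact: polytopal_bounded (elt_polytopal hTh T). Qed.

Lemma vdot_psd T : psd_form (vdot T).
Proof. exact: unweighted_psd (@elt_measurable T) (elt_bounded T). Qed.

Lemma vdot_eq0 T p : vdot T p p = 0 -> p = 0.
Proof.
apply: unweighted_definite; last by have [] := elt_polytopal hTh T.
  exact: polytopal_open (elt_polytopal hTh T).
exact: elt_bounded.
Qed.

Lemma fdot_psd e : psd_form (fdot e).
Proof.
apply: unweighted_psd; first exact: polytopal_measurable (fdom_polytopal hTh e).
exact: polytopal_bounded (fdom_polytopal hTh e).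
Qed.

Lemma fdot_eq0 e p : fdot e p p = 0 -> p = 0.
Proof.
apply: unweighted_definite; last by have [] := fdom_polytopal hTh e.
  exact: polytopal_open (fdom_polytopal hTh e).
exact: polytopal_bounded (fdom_polytopal hTh e).
Qed.

Lemma green_formula T i p q :
  vdot T (mderiv i p) q = - vdot T p (mderiv i q) +
  \sum_(e | face_of T e) onormal T e ord0 i * fdot e (trace e p) (trace e q).
Proof.
have pl := pint_linear (@elt_measurable T) (elt_bounded T).
have E p' q' : vdot T p' q' = vint T (pev (p' * q')).
  by apply: eq_Rintegral => x _; rewrite pevM.
apply/eqP; rewrite addrC -subr_eq opprK !E; apply/eqP.
transitivity (vint T (pev (mderiv i (p * q)))).
  by rewrite mderivM; exact/esym/(lformD pl).
rewrite (divergence_component n_gt0 hTh); apply: eq_bigr => e _; congr (_ * _).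
by apply: eq_Rintegral => y _; rewrite !pev_trace pevM.
Qed.

Lemma vdotE T p q : vdot T p q = vint T (fun x => pev p x * pev q x).
Proof. by []. Qed.

Lemma fdotE e p q : fdot e p q = fint e (fun y => pev p y * pev q y).
Proof. by []. Qed.

#[local] Opaque vdot fdot trace.

Variable k : nat.

(** A Riesz representer exists in P_(k-1), so [xget] returns a genuine projection and not its
    default 0. *)
Lemma Qb_spec e p : Pdeg k.-1 (Qb k e (pev p)) /\
  forall q, Pdeg k.-1 q -> fdot e (Qb k e (pev p)) q = fdot e (trace e p) q.
Proof.
have fe := fdot_psd e.
have [w wk hw] := @riesz_mpoly R n k.-1 (fdot e) (fdot e (trace e p)) (psd_linear fe)
  (fun q => psd_linear_l q fe) (fun q _ => @fdot_eq0 e q) (psd_linear fe _).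
have E q : fdot e (trace e p) q = fint e (fun y => pev p (fparam e y) * pev q y).
  by rewrite fdotE; apply: eq_Rintegral => y _; rewrite pev_trace.
have := @xgetPex _ 0 [set q | Pdeg k.-1 q /\ forall q', Pdeg k.-1 q' ->
    fint e (fun y => pev q y * pev q' y) =
    fint e (fun y => pev p (fparam e y) * pev q' y)].
rewrite -/(Qb k e (pev p)) => -[|h1 h2].
  by exists w; split=> // q qk; rewrite -E -fdotE; exact: hw.
by split=> // q /h2 h; rewrite E -h fdotE.
Qed.

Lemma fdot_uniq e r p q : Pdeg r p -> Pdeg r q ->
  (forall q', Pdeg r q' -> fdot e p q' = fdot e q q') -> p = q.
Proof.
move=> pr qr h; apply/eqP; rewrite -subr_eq0; apply/eqP/(@fdot_eq0 e).
have fe := fdot_psd e.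
by rewrite (lformB (psd_linear_l _ fe)) h ?subrr//; exact: PdegB.
Qed.

Lemma vdot_uniq T r p q : Pdeg r p -> Pdeg r q ->
  (forall q', Pdeg r q' -> vdot T p q' = vdot T q q') -> p = q.
Proof.
move=> pr qr h; apply/eqP; rewrite -subr_eq0; apply/eqP/(@vdot_eq0 T).
have fe := vdot_psd T.
by rewrite (lformB (psd_linear_l _ fe)) h ?subrr//; exact: PdegB.
Qed.

Lemma Qb_linear e c p q :
  Qb k e (pev (c *: p + q)) = c *: Qb k e (pev p) + Qb k e (pev q).
Proof.
have [d0 h0] := Qb_spec e (c *: p + q).
have [d1 h1] := Qb_spec e p; have [d2 h2] := Qb_spec e q.
have dd : Pdeg k.-1 (c *: Qb k e (pev p) + Qb k e (pev q)).
  by apply: PdegD; [exact: PdegZ|].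
apply: (@fdot_uniq e k.-1 _ _ d0 dd) => r rk.
rewrite (h0 r rk) trace_linear.
have E := psd_linear_l r (fdot_psd e).
have E1 := E c (trace e p) (trace e q); have E2 := E c (Qb k e (pev p)) (Qb k e (pev q)).
by rewrite /= in E1 E2; rewrite E1 E2 (h1 r rk) (h2 r rk).
Qed.

(** The right-hand side defining the weak gradient, for the test field whose only component is [q]
    in position [i]: the gradient is treated one component at a time. *)
Definition grad_functional T i (v0 : mpoly n.+1 R) (vb : face Th -> mpoly n R)
    (q : mpoly n.+1 R) : R :=
  - vdot T v0 (mderiv i q) +
  \sum_(e | face_of T e) onormal T e ord0 i * fdot e (vb e) (trace e q).

Lemma grad_functional_linear T i v0 vb : linear_form (grad_functional T i v0 vb).
Proof.
apply: linear_form_add.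
  apply: linear_form_opp.
  apply: (linear_form_comp (l := vdot T v0) (phi := mderiv i)).
    by move=> c p q; rewrite mderivD mderivZ.
  exact: (psd_linear (vdot_psd T)).
apply: linear_form_sum => e; apply: linear_form_scale.
apply: (linear_form_comp (l := fdot e (vb e)) (phi := trace e)).
  exact: trace_linear.
exact: (psd_linear (fdot_psd e)).
Qed.

Lemma grad_functional_linear_arg T i c v0 w0 vb wb ub q :
  (forall e, ub e = c *: vb e + wb e) ->
  grad_functional T i (c *: v0 + w0) ub q =
  c * grad_functional T i v0 vb q + grad_functional T i w0 wb q.
Proof.
move=> hu.
have h1 : vdot T (c *: v0 + w0) (mderiv i q) =
    c * vdot T v0 (mderiv i q) + vdot T w0 (mderiv i q).
  exact: (psd_linear_l (mderiv i q) (vdot_psd T)).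
pose S (b : face Th -> mpoly n R) :=
  \sum_(e | face_of T e) onormal T e ord0 i * fdot e (b e) (trace e q).
have h2 : S ub = c * S vb + S wb.
  rewrite /S mulr_sumr -big_split; apply: eq_bigr => e _.
  rewrite hu (psd_linear_l (trace e q) (fdot_psd e)) mulrDr; congr (_ + _).
  exact: mulrCA.
have E u0 b : grad_functional T i u0 b q = - vdot T u0 (mderiv i q) + S b by [].
rewrite !E h1 h2; ring.
Qed.

Lemma wgrad_spec (v : wfun Th) T i : Pdeg k.-1 (wgrad k v T ord0 i) /\
  forall q, Pdeg k.-1 q ->
    vdot T (wgrad k v T ord0 i) q = grad_functional T i (v.1 T) v.2 q.
Proof.
have Tp := vdot_psd T.
pose l i' := grad_functional T i' (v.1 T) v.2.
have ll i' : linear_form (l i') by exact: grad_functional_linear.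
have hG i' : exists G, Pdeg k.-1 G /\ forall q, Pdeg k.-1 q -> vdot T G q = l i' q.
  have [w wk hw] := @riesz_mpoly R _ k.-1 (vdot T) (l i') (psd_linear Tp)
    (fun q => psd_linear_l q Tp) (fun q _ => @vdot_eq0 T q) (ll i').
  by exists w.
have /choice[G {}hG] := hG.
pose rhs (w : 'rV[mpoly n.+1 R]_n.+1) :=
  - vint T (fun x => pev (v.1 T) x * pev (\sum_i mderiv i (w ord0 i)) x)
  + \sum_(e | face_of T e) fint e (fun y => pev (v.2 e) y *
      \sum_i pev (w ord0 i) (fparam e y) * onormal T e ord0 i).
have rhsE w : rhs w = \sum_i l i (w ord0 i).
  rewrite /rhs /l big_split/=; congr (_ + _).
    by rewrite -vdotE (lform_sum (psd_linear Tp _)) sumrN.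
  rewrite exchange_big; apply: eq_bigr => e _.
  transitivity (fdot e (v.2 e) (\sum_i onormal T e ord0 i *: trace e (w ord0 i))).
    rewrite fdotE; apply: eq_Rintegral => y _; rewrite pev_sum; congr (_ * _).
    by apply: eq_bigr => j _; rewrite pevZ pev_trace mulrC.
  rewrite (lform_sum (psd_linear (fdot_psd e) _)); apply: eq_bigr => j _.
  by rewrite (lformZ (psd_linear (fdot_psd e) _)).
have lhsE (G' w : 'rV[mpoly n.+1 R]_n.+1) :
    vint T (fun x => \sum_i pev (G' ord0 i) x * pev (w ord0 i) x) =
    \sum_i vdot T (G' ord0 i) (w ord0 i).
  have pl := pint_linear (@elt_measurable T) (elt_bounded T).
  transitivity (vint T (pev (\sum_i G' ord0 i * w ord0 i))).
    by apply: eq_Rintegral => x _; rewrite pev_sum; apply: eq_bigr => j _; rewrite pevM.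
  transitivity (\sum_i vint T (pev (G' ord0 i * w ord0 i))); first exact: (lform_sum pl).
  apply: eq_bigr => j _; rewrite vdotE.
  by apply: eq_Rintegral => x _; rewrite pevM.
have := @xgetPex _ (0 : 'rV[mpoly n.+1 R]_n.+1) [set G | (forall i, Pdeg k.-1 (G ord0 i)) /\
      forall w : 'rV[mpoly n.+1 R]_n.+1, (forall i, Pdeg k.-1 (w ord0 i)) ->
      vint T (fun x => \sum_i pev (G ord0 i) x * pev (w ord0 i) x) = rhs w].
rewrite -/(wgrad k v T) => -[|h1 h2].
  exists (\row_j G j); split=> [j|w hw]; first by rewrite mxE; exact: (hG j).1.
  by rewrite lhsE rhsE; apply: eq_bigr => j _; rewrite mxE (hG j).2.
split=> // q qk.
(* A test field with a single nonzero component isolates component [i]. *)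
have := h2 (\row_j if j == i then q else 0); rewrite lhsE rhsE.
have l0 j : l j 0 = 0 by exact: lform0 (ll j).
rewrite (bigD1 i)//= big1 ?addr0; last first.
  by move=> j ji; rewrite mxE (negbTE ji) (lform0 (psd_linear Tp _)).
rewrite (bigD1 i)//= big1 ?addr0; last first.
  by move=> j ji; rewrite mxE (negbTE ji).
rewrite mxE eqxx; apply=> j; rewrite mxE; case: ifP => // _; exact: Pdeg0.
Qed.

Lemma wgrad_linear c (u v : wfun Th) T i :
  wgrad k (c *: u + v) T ord0 i = c *: wgrad k u T ord0 i + wgrad k v T ord0 i.
Proof.
have [d0 h0] := wgrad_spec (c *: u + v) T i.
have [d1 h1] := wgrad_spec u T i; have [d2 h2] := wgrad_spec v T i.
have dd : Pdeg k.-1 (c *: wgrad k u T ord0 i + wgrad k v T ord0 i).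
  by apply: PdegD; [exact: PdegZ|].
apply: (@vdot_uniq T k.-1 _ _ d0 dd) => q qk.
rewrite h0// (psd_linear_l q (vdot_psd T)) h1// h2//.
have E1 : (c *: u + v).1 T = c *: u.1 T + v.1 T by rewrite /= !ffunE.
rewrite E1; apply: grad_functional_linear_arg => e.
by rewrite /= !ffunE.
Qed.

End discrete_operators.

(** * The local energy form and its lower bounds *)

Section energy_form.
Context {R : realType}.
Local Notation L := (@lebesgue_rV R).
Variables (n : nat) (Th : @mesh R n.+1) (Om : set 'rV[R]_n.+1).
Variables (a c : 'rV[R]_n.+1 -> R) (a0 a1 c1 : R).
Hypotheses (n_gt0 : (0 < n)%N) (hOm : polytopal_domain Om) (hTh : is_mesh Th Om).
Hypotheses (ha0 : 0 < a0) (ha : coefficient_bounds Om a a0 a1).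
Hypothesis (hc : coefficient_bounds Om c 0 c1).
Variables (k M : nat) (sub : 'I_M -> set 'rV[R]_n.+1).
Implicit Types (T : elem Th) (e : face Th) (j : 'I_M).

Definition wdot (w : 'rV[R]_n.+1 -> R) T (p q : mpoly n.+1 R) : R :=
  vint T (fun x => w x * (pev p x * pev q x)).

Lemma wdot_psd w w0 w1 T : 0 <= w0 -> coefficient_bounds Om w w0 w1 ->
  psd_form (wdot w T).
Proof.
move=> w00 [mw bw]; have TO := elt_sub_domain hOm hTh (T := T).
apply: weighted_psd.
- exact: elt_measurable hTh T.
- exact: (elt_bounded hTh).
- by apply: measurable_funS mw => //; apply: open_measurable_rV; exact: (polytopal_open hOm).
- exists w1 => x /TO /bw /andP[h0 h1]; rewrite ger0_norm//; exact: le_trans h0.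
- by move=> x /TO /bw /andP[h0 _]; exact: le_trans h0.
Qed.

Lemma le_vdot_wdot w w0 w1 T p : 0 <= w0 -> coefficient_bounds Om w w0 w1 ->
  w0 * vdot T p p <= wdot w T p p.
Proof.
move=> w00 hw; have [mw bw] := hw; have TO := elt_sub_domain hOm hTh (T := T).
have mT := elt_measurable hTh T; have bT := @elt_bounded _ _ _ _ hTh T.
have E (w' : 'rV[R]_n.+1 -> R) : (fun x => w' x * (pev p x * pev p x)) =
    (fun x => w' x * pev (p * p) x).
  by apply/funext => x; rewrite pevM.
rewrite /vdot /vint -RintegralZl//; last first.
  by rewrite (_ : (fun _ => _) = pev (p * p)); [exact: integrable_pev|
    apply/funext => x; rewrite pevM].
rewrite /wdot /vint; apply: le_Rintegral => //.
- rewrite [X in EFin \o X](_ : _ = fun x => cst w0 x * pev (p * p) x); last first.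
    by apply/funext => x; rewrite pevM.
  by apply: integrable_wpev => //; exists `|w0|.
- rewrite E; apply: integrable_wpev => //.
    by apply: measurable_funS mw => //; apply: open_measurable_rV; exact: (polytopal_open hOm).
  exists w1 => x /TO /bw /andP[h0 h1]; rewrite ger0_norm//; exact: le_trans h0.
- by move=> x /TO /bw /andP[h0 _]; rewrite ler_wpM2r// -expr2 sqr_ge0.
Qed.

Lemma enorm_gt0 m (x : 'rV[R]_m) : x != 0 -> 0 < enorm x.
Proof.
move=> x0; rewrite /enorm sqrtr_gt0 /dot.
have [i xi] : exists i, x ord0 i != 0.
  apply: contrapT => /forallNP h; move/eqP: x0; apply; apply/rowP => i; rewrite mxE.
  by apply/eqP; have /negP := h i; rewrite negbK.
rewrite (bigD1 i)//= ltr_pwDl// -?expr2 ?exprn_even_gt0//.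
by apply: sumr_ge0 => j _; rewrite -expr2 sqr_ge0.
Qed.

Lemma enorm_bound m (x : 'rV[R]_m) B : 0 <= B -> (forall i, `|x ord0 i| <= B) ->
  enorm x <= Num.sqrt (B ^+ 2 *+ m).
Proof.
move=> B0 xB; rewrite /enorm ler_wsqrtr// /dot.
rewrite -[X in _ <= _ *+ X]card_ord -sumr_const; apply: ler_sum => i _.
by rewrite -expr2 -real_normK ?num_real// lerXn2r ?nnegrE.
Qed.

(** Ensures that the weight [(diam D)^-1] of the stabilizer is positive: an open set contains a
    second point, and boundedness makes the supremum an upper bound. *)
Lemma diam_gt0 m (D : set 'rV[R]_m.+1) x : open D -> rV_bounded D -> D x -> 0 < diam D.
Proof.
move=> oD [B DB] Dx.
have [r r0 rD] := (open_rboxP D).1 oD x Dx.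
pose y : 'rV[R]_m.+1 := x + const_mx (r / 2).
have r2 : 0 < r / 2 by rewrite divr_gt0.
have Dy : D y.
  apply: rD => i; rewrite !mxE opprD addrA subrr sub0r normrN gtr0_norm//.
  by rewrite ltr_pdivrMr// mulr2n mulrDr mulr1 ltrDl.
have yx : 0 < enorm (y - x).
  apply: enorm_gt0; apply/eqP => /rowP/(_ ord0); rewrite !mxE addrAC subrr add0r.
  by apply/eqP; rewrite gt_eqF.
apply: lt_le_trans yx _; rewrite /diam; apply: ub_le_sup; last by exists y, x.
exists (Num.sqrt ((B + B) ^+ 2 *+ m.+1)) => _ [u [v [Du Dv ->]]].
have B0 : 0 <= B by apply: le_trans (DB x Dx ord0).
apply: enorm_bound => [|i]; first exact: addr_ge0.
by rewrite !mxE (le_trans (ler_normB _ _))// lerD ?DB.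
Qed.

Lemma elt_diam_gt0 T : 0 < diam (elt T).
Proof.
have [x Tx] : elt T !=set0 by have [] := elt_polytopal hTh T.
exact: diam_gt0 (polytopal_open (elt_polytopal hTh T)) (@elt_bounded _ _ _ _ hTh T) Tx.
Qed.

Definition energy j (u v : wfun Th) : R :=
  diffusion_form k sub a j u v + stab_form k sub j u v + reaction_form sub c j u v.

Definition trace_defect (u : wfun Th) T e : mpoly n R := Qb k e (pev (u.1 T)) - u.2 e.

Lemma diffusion_formE j u v : diffusion_form k sub a j u v =
  \sum_(T | elem_in (sub j) T) \sum_i
    wdot a T (wgrad k u T ord0 i) (wgrad k v T ord0 i).
Proof.
apply: eq_bigr => T _.
have TO := elt_sub_domain hOm hTh (T := T); have [ma ba] := ha.
have wl : linear_form (fun p => \int[L n.+1]_(x in elt T) (a x * pev p x)).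
  apply: wint_linear.
  - exact: elt_measurable hTh T.
  - exact: (elt_bounded hTh).
  - by apply: measurable_funS ma => //; apply: open_measurable_rV; exact: (polytopal_open hOm).
  exists a1 => x /TO /ba /andP[h0 h1]; rewrite ger0_norm//.
  by apply: le_trans h0; exact: ltW.
transitivity (vint T (fun x => a x * pev (\sum_i
    wgrad k u T ord0 i * wgrad k v T ord0 i) x)).
  apply: eq_Rintegral => x _; rewrite pev_sum; congr (_ * _).
  by apply: eq_bigr => i _; rewrite pevM.
rewrite [LHS](lform_sum wl); apply: eq_bigr => i _.
by apply: eq_Rintegral => x _; rewrite pevM.
Qed.

Lemma stab_formE j u v : stab_form k sub j u v =
  \sum_(T | elem_in (sub j) T) (diam (elt T))^-1 * \sum_(e | face_of T e)
    fdot e (trace_defect u T e) (trace_defect v T e).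
Proof. by []. Qed.

Lemma reaction_formE j (u v : wfun Th) : reaction_form sub c j u v =
  \sum_(T | elem_in (sub j) T) wdot c T (u.1 T) (v.1 T).
Proof.
by apply: eq_bigr => T _; apply: eq_Rintegral => x _; rewrite mulrA.
Qed.

#[local] Opaque vdot fdot trace wdot wgrad Qb.

Lemma trace_defect_linear b u v T e :
  trace_defect (b *: u + v) T e = b *: trace_defect u T e + trace_defect v T e.
Proof.
have E1 : (b *: u + v).1 T = b *: u.1 T + v.1 T by rewrite /= !ffunE.
have E2 : (b *: u + v).2 e = b *: u.2 e + v.2 e by rewrite /= !ffunE.
by rewrite /trace_defect E1 E2 (Qb_linear hTh) scalerBr opprD addrACA.
Qed.

Lemma diffusion_psd j : psd_form (diffusion_form (Th := Th) k sub a j).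
Proof.
apply: (psd_ext (diffusion_formE j)).
apply: psd_sum => T _; apply: psd_sum => i _.
apply: (psd_comp (phi := fun u => wgrad k u T ord0 i)).
  by move=> b u v; exact: (wgrad_linear hTh).
exact: (wdot_psd T (ltW ha0) ha).
Qed.

Lemma stab_psd j : psd_form (stab_form (Th := Th) k sub j).
Proof.
apply: (psd_ext (stab_formE j)).
apply: psd_sum => T _; apply: psd_scale; first by rewrite invr_ge0 ltW// elt_diam_gt0.
apply: psd_sum => e _; apply: (psd_comp (phi := fun u => trace_defect u T e)).
  by move=> b u v; exact: trace_defect_linear.
exact: (fdot_psd hTh).
Qed.

Lemma reaction_psd j : psd_form (reaction_form (Th := Th) sub c j).
Proof.
apply: (psd_ext (reaction_formE j)).
apply: psd_sum => T _; apply: (psd_comp (phi := fun u : wfun Th => u.1 T)).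
  by move=> b u v; rewrite /= !ffunE.
exact: (wdot_psd T (lexx 0) hc).
Qed.

Lemma energy_psd j : psd_form (energy j).
Proof.
by apply: psd_add; [apply: psd_add; [exact: diffusion_psd|exact: stab_psd]|
  exact: reaction_psd].
Qed.

Lemma ler_term_sum (I : finType) (P : pred I) (F : I -> R) i :
  (forall i, 0 <= F i) -> P i -> F i <= \sum_(i | P i) F i.
Proof. by move=> F0 Pi; rewrite (bigD1 i)//= lerDl; apply: sumr_ge0. Qed.

Lemma energy_ge_grad j T i u : elem_in (sub j) T ->
  a0 * vdot T (wgrad k u T ord0 i) (wgrad k u T ord0 i) <= energy j u u.
Proof.
move=> Tj; have a00 := ltW ha0.
have wp T' := wdot_psd T' a00 ha.
have dE : diffusion_form k sub a j u u <= energy j u u.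
  rewrite /energy -addrA lerDl.
  by apply: addr_ge0; [exact: (psd_ge0 (stab_psd j))|exact: (psd_ge0 (reaction_psd j))].
apply: le_trans dE; rewrite diffusion_formE.
pose G T' i' := wdot a T' (wgrad k u T' ord0 i') (wgrad k u T' ord0 i').
have G0 T' i' : 0 <= G T' i' by exact: (psd_ge0 (wp T')).
apply: (le_trans (le_vdot_wdot T _ a00 ha)).
apply: (@le_trans _ _ (\sum_i' G T i')).
  exact: (@ler_term_sum _ xpredT (G T)).
apply: (@ler_term_sum _ _ (fun T' => \sum_i' G T' i')) => // T'.
by apply: sumr_ge0.
Qed.

Lemma energy_ge_defect j T e u : elem_in (sub j) T -> face_of T e ->
  (diam (elt T))^-1 * fdot e (trace_defect u T e) (trace_defect u T e) <= energy j u u.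
Proof.
move=> Tj Te.
have dE : stab_form k sub j u u <= energy j u u.
  rewrite /energy addrAC lerDr.
  by apply: addr_ge0; [exact: (psd_ge0 (diffusion_psd j))|exact: (psd_ge0 (reaction_psd j))].
apply: le_trans dE; rewrite stab_formE.
have d0 T' : 0 <= (diam (elt T'))^-1 by rewrite invr_ge0 ltW// elt_diam_gt0.
pose G T' e' := fdot e' (trace_defect u T' e') (trace_defect u T' e').
have G0 T' e' : 0 <= G T' e' by exact: (psd_ge0 (fdot_psd hTh e')).
apply: (@le_trans _ _ ((diam (elt T))^-1 * \sum_(e' | face_of T e') G T e')).
  by apply: ler_wpM2l => //; exact: (@ler_term_sum _ _ (G T)).
apply: (@ler_term_sum _ _ (fun T' => (diam (elt T'))^-1 *
  \sum_(e' | face_of T' e') G T' e')) => // T'.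
by apply: mulr_ge0 => //; apply: sumr_ge0.
Qed.

End energy_form.

(** * Error equations, decay of the energies and propagation of convergence *)

Section error_decay.
Context {R : realType}.
Variables (n : nat) (Om : set 'rV[R]_n.+1) (a c f g : 'rV[R]_n.+1 -> R) (a0 a1 c1 : R).
Variables (Th : @mesh R n.+1) (k M : nat) (sub : 'I_M -> set 'rV[R]_n.+1).
Hypotheses (n_gt0 : (0 < n)%N) (hOm : polytopal_domain Om).
Hypotheses (ha0 : 0 < a0) (ha : coefficient_bounds Om a a0 a1).
Hypotheses (hc : coefficient_bounds Om c 0 c1) (hTh : is_mesh Th Om).
Hypothesis hsub : is_decomposition Th Om sub.
Variables (u : 'I_M -> wfun Th) (lam : 'I_M -> 'I_M -> bfun Th).
Hypothesis hDD : DD_solution k Om sub a c f g u lam.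
Variables (beta : R) (un : nat -> 'I_M -> wfun Th) (lamn : nat -> 'I_M -> 'I_M -> bfun Th).
Hypotheses (hbeta : 0 < beta) (hIT : IT_sequence k Om sub a c f g beta un lamn).
Implicit Types (T : elem Th) (e : face Th).

Local Notation adj := (adjacent_sub sub).
Local Notation En := (energy a c k sub).

Definition err m j : wfun Th := un m j - u j.
Definition mult_err m i j : bfun Th := lamn m i j - lam i j.

Lemma GpairE i j (mu nu : bfun Th) : Gpair sub i j mu nu =
  \sum_(e | face_in (Gint sub i j) e) fdot e (mu e) (nu e).
Proof. by []. Qed.

#[local] Opaque vdot fdot trace wdot wgrad Qb Gpair.

Lemma err0E m j T : (err m j).1 T = (un m j).1 T - (u j).1 T.
Proof. by rewrite /= !ffunE. Qed.

Lemma errbE m j e : (err m j).2 e = (un m j).2 e - (u j).2 e.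
Proof. by rewrite /= !ffunE. Qed.

Lemma mult_errE m i j e : mult_err m i j e = lamn m i j e - lam i j e.
Proof. by rewrite /mult_err !ffunE. Qed.

Lemma err_Wh m j : in_Wh k sub j (err m j).
Proof.
have [[h1 h2] _] := IT_space hIT m j; have [[h1' h2'] _] := DD_space hDD j.
split=> [T Tj|e ej]; rewrite ?err0E ?errbE.
  by apply: PdegB; [exact: h1|exact: h1'].
by apply: PdegB; [exact: h2|exact: h2'].
Qed.

Lemma err_Gext m j e : face_in (Gext Om sub j) e -> (err m j).2 e = 0.
Proof.
move=> ej; have [_ h] := IT_space hIT m j; have [_ h'] := DD_space hDD j.
by rewrite errbE (h e ej) (h' e ej) subrr.
Qed.

Lemma err_Wh0 m j : in_Wh0 k Om sub j (err m j).
Proof. by split; [exact: err_Wh|move=> e; exact: err_Gext]. Qed.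

Lemma adj_neq i j : adj i j -> i != j. Proof. by case/andP. Qed.

Lemma Gint_sub_face' i j e : face_in (Gint sub i j) e -> sub_face sub j e.
Proof. by rewrite GintC; exact: (Gint_sub_face n_gt0 hTh hsub). Qed.

Lemma mult_err_deg m i j e : adj i j -> face_in (Gint sub i j) e ->
  Pdeg k.-1 (mult_err m i j e).
Proof.
move=> ij eG; rewrite mult_errE; apply: PdegB.
  exact: (IT_mult hIT m ij eG).
exact: (DD_mult hDD ij eG).
Qed.

(** The jump is itself an admissible multiplier; the continuity condition tested with it annihilates
    its squared norm. *)
Lemma solution_trace i j e : adj i j -> face_in (Gint sub i j) e ->
  (u i).2 e = (u j).2 e.
Proof.
move=> ij eG; apply/eqP; rewrite -subr_eq0; apply/eqP/(@fdot_eq0 _ _ _ _ hTh e).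
pose d : bfun Th := (u i).2 - (u j).2.
have dE e' : d e' = (u i).2 e' - (u j).2 e' by rewrite /d !ffunE.
have := DD_cont hDD (j := i) (mu := fun i' => if i' == j then d else 0) _.
rewrite (bigD1 j)//= eqxx big1 ?addr0; last first.
  move=> i' /andP[_ /negbTE ->]; rewrite GpairE big1// => e' _.
  by rewrite ffunE (lform0 (psd_linear_l _ (fdot_psd hTh e'))).
move=> h; have {h} : Gpair sub i j d d = 0.
  apply: h => i' ii' e' e'G; case: eqP => [i'j|_]; last by rewrite ffunE; exact: Pdeg0.
  rewrite i'j in e'G; rewrite dE; apply: PdegB; apply: (DD_space hDD _).1.2.
    exact: (Gint_sub_face n_gt0 hTh hsub e'G).
  exact: Gint_sub_face' e'G.
rewrite GpairE => s0; have : fdot e (d e) (d e) <= 0.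
  rewrite -[leRHS]s0 (bigD1 e)//= lerDl; apply: sumr_ge0 => e' _.
  exact: (psd_ge0 (fdot_psd hTh e')).
rewrite dE => le0; apply/eqP; rewrite eq_le le0/=.
exact: (psd_ge0 (fdot_psd hTh e)).
Qed.

(** Equal traces and opposite fluxes make the exact solution a fixed point of the multiplier update,
    which can therefore be subtracted. *)
Lemma mult_err_update m i j e : adj j i -> face_in (Gint sub j i) e ->
  mult_err m.+1 j i e + beta *: (err m.+1 j).2 e =
  beta *: (err m i).2 e - mult_err m i j e.
Proof.
move=> ji eG.
have flux : lam j i e = - lam i j e.
  by apply/eqP; rewrite -addr_eq0; apply/eqP; exact: (DD_flux hDD ji eG).
rewrite !mult_errE !errbE (IT_update hIT m ji eG) flux (solution_trace ji eG).
rewrite !scalerBr.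
move: (beta *: (un m i).2 e) (beta *: (un m.+1 j).2 e) (beta *: (u i).2 e).
move: (lamn m i j e) (lam i j e) => w t x y z.
by ring.
Qed.

(** The update identifies beta u_i^n - lambda_ij^n - beta u_j^(n+1) with lambda_ji^(n+1): the
    iterate solves the local equation of (DD) with its new multiplier, and the load cancels in the
    difference. *)
Lemma local_error m j v : in_Wh0 k Om sub j v ->
  En j (err m.+1 j) v = \sum_(i | adj j i) Gpair sub j i (mult_err m.+1 j i) v.2.
Proof.
move=> hv.
have Ep := energy_psd hOm hTh ha0 ha hc k sub j.
rewrite (lformB (psd_linear_l v Ep)).
pose P := \sum_(i | adj j i) Gpair sub j i (beta *: (un m i).2 - lamn m i j) v.2.
pose Q := \sum_(i | adj j i) Gpair sub j i (beta *: (un m.+1 j).2) v.2.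
pose S := \sum_(i | adj j i) Gpair sub j i (lam j i) v.2.
have K : \sum_(i | adj j i) Gpair sub j i (mult_err m.+1 j i) v.2 = P - Q - S.
  rewrite /P /Q /S -!sumrB; apply: eq_bigr => i ji.
  rewrite !GpairE -!sumrB; apply: eq_bigr => e eG.
  have fl := psd_linear_l (v.2 e) (fdot_psd hTh e).
  have fB p q : fdot e (p - q) (v.2 e) = fdot e p (v.2 e) - fdot e q (v.2 e).
    exact: (lformB fl).
  rewrite -!fB; congr fdot.
  rewrite mult_errE (IT_update hIT m ji eG) !ffunE scalerBr.
  by rewrite -!addrA; congr (_ + _); rewrite !addrA; congr (_ - _); exact: addrC.
rewrite K /energy.
have := DD_local hDD hv; have := IT_local hIT m hv.
rewrite -/P -/Q -/S; clear K; clearbody P Q S.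
move: (load _ _ _ _) (diffusion_form _ _ _ _ _ _) (stab_form _ _ _ _ _)
  (reaction_form _ _ _ _ _) (diffusion_form _ _ _ _ _ _) (stab_form _ _ _ _ _)
  (reaction_form _ _ _ _ _) => l d1 s1 r1 d2 s2 r2.
lra.
Qed.

#[local] Opaque energy.

(* By mult_err_update a step of the iteration replaces mult_err + beta err by the
   reflected quantity beta err - mult_err of the neighbour. *)
Definition iteration_energy m : R := \sum_j \sum_(i | adj j i)
  \sum_(e | face_in (Gint sub j i) e)
    fdot e (mult_err m j i e + beta *: (err m j).2 e)
           (mult_err m j i e + beta *: (err m j).2 e).

Lemma iteration_energy_ge0 m : 0 <= iteration_energy m.
Proof.
apply: sumr_ge0 => j _; apply: sumr_ge0 => i _; apply: sumr_ge0 => e _.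
exact: (psd_ge0 (fdot_psd hTh e)).
Qed.

(** Polarization, the origin of the factor 4 beta; [local_error] tested with the error turns the sum
    of the cross terms into the energy. *)
Lemma fdot_parallelogram e p q :
  fdot e (beta *: q - p) (beta *: q - p) =
  fdot e (p + beta *: q) (p + beta *: q) - 4 * beta * fdot e p q.
Proof.
have fp := fdot_psd hTh e.
have lD p' x y : fdot e p' (x + y) = fdot e p' x + fdot e p' y.
  exact: (lformD (psd_linear fp p')).
have lZ p' b x : fdot e p' (b *: x) = b * fdot e p' x by exact: (lformZ (psd_linear fp p')).
have rD p' x y : fdot e (x + y) p' = fdot e x p' + fdot e y p'.
  exact: (lformD (psd_linear_l p' fp)).
have rZ p' b x : fdot e (b *: x) p' = b * fdot e x p'.
  exact: (lformZ (psd_linear_l p' fp)).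
rewrite -(scaleN1r p) !(lD, lZ, rD, rZ) (psd_sym fp q p).
move: (fdot e p p) (fdot e p q) (fdot e q q) => x y z; ring.
Qed.

(** The index starts at [m.+1] because the initial guess satisfies no local equation. After the
    update each ordered pair carries the reflected quantity of its neighbour, so the pairs are
    relabelled by symmetry of adjacency. *)
Lemma iteration_energyS m : iteration_energy m.+2 =
  iteration_energy m.+1 - 4 * beta * \sum_j En j (err m.+1 j) (err m.+1 j).
Proof.
pose F j i := \sum_(e | face_in (Gint sub j i) e)
  fdot e (beta *: (err m.+1 j).2 e - mult_err m.+1 j i e)
         (beta *: (err m.+1 j).2 e - mult_err m.+1 j i e).
transitivity (\sum_j \sum_(i | adj j i) F i j).
  apply: eq_bigr => j _; apply: eq_bigr => i ji.
  rewrite /F GintC; apply: eq_bigr => e eG.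
  by rewrite (mult_err_update m.+1 ji); [|move: eG; rewrite GintC].
transitivity (\sum_j \sum_(i | adj j i) F j i).
  rewrite (exchange_big_dep xpredT)//=; apply: eq_bigr => i _.
  by apply: eq_bigl => j; rewrite adjacentC.
rewrite mulr_sumr -sumrB; apply: eq_bigr => j _.
rewrite (local_error m (err_Wh0 m.+1 j)) mulr_sumr -sumrB; apply: eq_bigr => i ji.
rewrite GpairE mulr_sumr -sumrB; apply: eq_bigr => e _.
exact: fdot_parallelogram.
Qed.

Lemma energy_cvg0 j : (fun m => En j (err m j) (err m j)) @ \oo --> (0 : R).
Proof.
have Ep j' := energy_psd hOm hTh ha0 ha hc k sub j'.
pose s m := 4 * beta * \sum_j En j (err m.+1 j) (err m.+1 j).
have E0 m j' : 0 <= En j' (err m j') (err m j') by exact: (psd_ge0 (Ep j')).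
have b4 : 0 < 4 * beta by rewrite mulr_gt0.
have s0 : s @ \oo --> (0 : R).
  apply: (@decreasing_increments_cvg0 _ (fun m => iteration_energy m.+1)).
  - by move=> m; exact: iteration_energy_ge0.
  - by move=> m; rewrite mulr_ge0 ?(ltW b4)//; apply: sumr_ge0.
  - by move=> m; exact: iteration_energyS.
have h : (fun m => (4 * beta)^-1 * s m) @ \oo --> (0 : R).
  have := cvgM (cvg_cst ((4 * beta)^-1) :
    (fun=> (4 * beta)^-1 : R) @ \oo --> (4 * beta)^-1) s0; rewrite mulr0; exact.
apply: (cvg0_shift (fun m => En j (err m j) (err m j))).1.
apply: (cvg0_squeeze _ h) => m; rewrite E0 /=.
rewrite /s mulrA mulVf ?gt_eqF// mul1r.
exact: (@ler_term_sum _ _ xpredT (fun j => En j (err m.+1 j) (err m.+1 j))).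
Qed.

(** Supported on one face, so that the local equation isolates the multiplier there. *)
Definition face_test e (q : mpoly n R) : wfun Th :=
  (0, [ffun e' => if e' == e then q else 0]).

Lemma face_test_Wh0 i j e q : j != i -> face_in (Gint sub j i) e -> Pdeg k.-1 q ->
  in_Wh0 k Om sub j (face_test e q).
Proof.
move=> ji eG qk; split; first split.
- by move=> T _; rewrite /= ffunE; exact: Pdeg0.
- by move=> e' _; rewrite /= ffunE; case: ifP => // _; exact: Pdeg0.
move=> e' e'ext; rewrite /= ffunE; case: eqP => // e'e; move: e'ext; rewrite e'e.
by move=> e'ext; have := Gint_not_Gext n_gt0 hOm hTh hsub j ji eG; rewrite e'ext.
Qed.

Lemma Gpair_face_test i j e (mu : 'I_M -> bfun Th) q : adj j i -> face_in (Gint sub j i) e ->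
  \sum_(i' | adj j i') Gpair sub j i' (mu i') (face_test e q).2 = fdot e (mu i e) q.
Proof.
move=> ji eG.
have f0 e' p : fdot e' p 0 = 0 by exact: (lform0 (psd_linear (fdot_psd hTh e') p)).
have tE e' : (face_test e q).2 e' = if e' == e then q else 0 by rewrite /= ffunE.
rewrite (bigD1 i)//= [X in _ + X]big1 ?addr0; last first.
  move=> i' /andP[ji' i'i]; rewrite GpairE big1// => e' e'G; rewrite tE.
  case: eqP => [e'e|_] //; rewrite e'e in e'G.
  by have := Gint_uniq n_gt0 hTh hsub (adj_neq ji') (adj_neq ji) e'G eG => /eqP;
    rewrite (negbTE i'i).
rewrite GpairE (bigD1 e)//= big1 ?addr0; first by rewrite tE eqxx.
by move=> e' /andP[_ e'e]; rewrite tE (negbTE e'e).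
Qed.

(** By Cauchy-Schwarz, vanishing energy makes the left side of [local_error] tend to 0 for a fixed
    test function; with [face_test] the right side is the pairing with an arbitrary [q] of
    P_(k-1). *)
Lemma mult_err_tends0 i j e : adj j i -> face_in (Gint sub j i) e ->
  tends0 (fun m => mult_err m j i e).
Proof.
move=> ji eG; apply: (tends0_shift (fun m => mult_err m j i e)).1.
apply: (tends0_psd (r := k.-1) (fdot_psd hTh e)).
- by move=> p _; exact: (@fdot_eq0 _ _ _ _ hTh e).
- by move=> m; exact: mult_err_deg.
move=> q qk; have vW := face_test_Wh0 (adj_neq ji) eG qk.
have Ep := energy_psd hOm hTh ha0 ha hc k sub j.
have h : (fun m => En j (err m.+1 j) (face_test e q)) @ \oo --> (0 : R).
  apply: (cvg0_shift (fun m => En j (err m j) (face_test e q))).2.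
  exact: (psd_cvg0 (face_test e q) Ep (energy_cvg0 j)).
rewrite (_ : (fun _ => _) = fun m => En j (err m.+1 j) (face_test e q)); first exact: h.
apply/funext => m.
by rewrite (local_error m vW) (Gpair_face_test (mult_err m.+1 j) q ji eG).
Qed.

Lemma trace_err_tends0 i j e : adj j i -> face_in (Gint sub j i) e ->
  tends0 (fun m => (err m i).2 e - (err m.+1 j).2 e).
Proof.
move=> ji eG.
have ij : adj i j by rewrite adjacentC.
have eG' : face_in (Gint sub i j) e by rewrite GintC.
have h1 : tends0 (fun m => mult_err m.+1 j i e).
  by apply: (tends0_shift (fun m => mult_err m j i e)).2; exact: mult_err_tends0.
have := tends0Z beta^-1 (tends0D h1 (mult_err_tends0 ij eG')).
apply: tends0_ext => m.
have -> : mult_err m.+1 j i e + mult_err m i j e =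
    beta *: ((err m i).2 e - (err m.+1 j).2 e).
  have -> : mult_err m.+1 j i e =
      beta *: (err m i).2 e - mult_err m i j e - beta *: (err m.+1 j).2 e.
    by rewrite -(mult_err_update m ji eG) addrK.
  by rewrite scalerBr addrAC subrK.
by rewrite scalerA mulVf ?gt_eqF// scale1r.
Qed.

(* Definite on polynomials: a vanishing gradient leaves a constant, which the mean
   over e0 kills. *)
Definition local_form T e0 (p q : mpoly n.+1 R) : R :=
  \sum_i vdot T (mderiv i p) (mderiv i q) +
  fdot e0 (trace e0 p) 1 * fdot e0 (trace e0 q) 1.

Lemma mean_linear e : linear_form (fun p => fdot e (trace e p) 1).
Proof.
apply: (linear_form_comp (l := fun p => fdot e p 1) (phi := trace e)).
  exact: trace_linear.
exact: (psd_linear_l 1 (fdot_psd hTh e)).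
Qed.

Lemma local_form_psd T e0 : psd_form (local_form T e0).
Proof.
apply: psd_add; last by apply: psd_rank1; exact: mean_linear.
apply: psd_sum => i _; apply: (psd_comp (B := vdot T) (phi := mderiv i)).
  by move=> b p q; rewrite mderivD mderivZ.
exact: (vdot_psd hTh).
Qed.

Lemma local_form_eq0 T e0 p : local_form T e0 p p = 0 -> p = 0.
Proof.
have v0 i : 0 <= vdot T (mderiv i p) (mderiv i p) by exact: (psd_ge0 (vdot_psd hTh T)).
have m0 : 0 <= fdot e0 (trace e0 p) 1 * fdot e0 (trace e0 p) 1.
  by rewrite -expr2 sqr_ge0.
have s0 : 0 <= \sum_i vdot T (mderiv i p) (mderiv i p) by exact: sumr_ge0.
move/eqP; rewrite /local_form paddr_eq0// => /andP[/eqP/psumr_eq0P d0 /eqP mean0].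
have pE : p = mcoeff mnm0 p *: 1.
  by apply: mpoly_const => i; apply: (@vdot_eq0 _ _ _ _ hTh T); exact: d0.
move: mean0; move: (mcoeff mnm0 p) pE => b -> /eqP.
rewrite mulf_eq0 orbb (lformZ (mean_linear e0)) mulf_eq0 => /orP[/eqP ->|].
  by rewrite scale0r.
have tr1 : trace e0 1 = 1.
  apply/eqP; rewrite -subr_eq0; apply/eqP/mpoly_eq0 => y.
  by rewrite pevB pev_trace !pev1 subrr.
rewrite tr1 => /eqP/(@fdot_eq0 _ _ _ _ hTh e0)/eqP.
by rewrite oner_eq0.
Qed.

(** Green's formula minus the definition of the weak gradient leaves the trace of v_0 minus v_b on
    the faces; [Qb] may be inserted because the test trace lies in P_(k-1). *)
Lemma grad_identity (v : wfun Th) T i q : Pdeg k q ->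
  vdot T (mderiv i (v.1 T)) (mderiv i q) =
  vdot T (wgrad k v T ord0 i) (mderiv i q) +
  \sum_(e | face_of T e) onormal T e ord0 i *
    fdot e (trace_defect k v T e) (trace e (mderiv i q)).
Proof.
move=> qk; have dq : Pdeg k.-1 (mderiv i q) by exact: Pdeg_mderiv.
rewrite (green_formula n_gt0 hTh) ((wgrad_spec hTh k v T i).2 _ dq).
rewrite /grad_functional -addrA; congr (_ + _).
rewrite -big_split; apply: eq_bigr => e _; rewrite /= -mulrDr; congr (_ * _).
have tq : Pdeg k.-1 (trace e (mderiv i q)) by exact: Pdeg_comp_affine.
have fl := psd_linear_l (trace e (mderiv i q)) (fdot_psd hTh e).
rewrite -((Qb_spec hTh k e (v.1 T)).2 _ tq) /trace_defect (lformB fl).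
by rewrite addrC subrK.
Qed.

Lemma grad_cvg0 j T i q : elem_in (sub j) T ->
  (fun m => vdot T (wgrad k (err m j) T ord0 i) q) @ \oo --> (0 : R).
Proof.
move=> Tj; apply: (psd_cvg0 q (vdot_psd hTh T)).
apply: (cvg0_squeeze _ (cvg0Z a0^-1 (energy_cvg0 j))) => m.
apply/andP; split; first exact: (psd_ge0 (vdot_psd hTh T)).
rewrite -(ler_pM2l ha0) mulrA mulfV ?gt_eqF// mul1r.
exact: (energy_ge_grad hOm hTh ha0 ha hc k i (err m j) Tj).
Qed.

Lemma defect_cvg0 j T e q : elem_in (sub j) T -> face_of T e ->
  (fun m => fdot e (trace_defect k (err m j) T e) q) @ \oo --> (0 : R).
Proof.
move=> Tj Te; apply: (psd_cvg0 q (fdot_psd hTh e)).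
apply: (cvg0_squeeze _ (cvg0Z (diam (elt T)) (energy_cvg0 j))) => m.
apply/andP; split; first exact: (psd_ge0 (fdot_psd hTh e)).
have d0 := elt_diam_gt0 hTh T.
rewrite -(@ler_pM2l _ (diam (elt T))^-1) ?invr_gt0// [leRHS]mulrA mulVf ?gt_eqF// mul1r.
exact: (energy_ge_defect hOm hTh ha0 ha hc k (err m j) Tj Te).
Qed.

Lemma elt_sub_face j T e : elem_in (sub j) T -> face_of T e -> sub_face sub j e.
Proof. by move=> Tj Te; apply/existsP; exists T; rewrite Tj. Qed.

Lemma defect_tends0 j T e : elem_in (sub j) T -> face_of T e ->
  tends0 (fun m => trace_defect k (err m j) T e).
Proof.
move=> Tj Te; apply: (tends0_psd (r := k.-1) (fdot_psd hTh e)).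
- by move=> p _; exact: (@fdot_eq0 _ _ _ _ hTh e).
- move=> m; apply: PdegB; first exact: (Qb_spec hTh k e _).1.
  exact: ((err_Wh m j).2 e (elt_sub_face Tj Te)).
by move=> q _; exact: defect_cvg0.
Qed.

(** [grad_identity] controls the gradient part of [local_form] by the energy, and the anchor [e0]
    controls the mean; the other faces follow from v_b = Q_b v_0 minus the defect. *)
Lemma local_cvg j T e0 : elem_in (sub j) T -> face_of T e0 ->
  tends0 (fun m => (err m j).2 e0) ->
  tends0 (fun m => (err m j).1 T) /\
  forall e, face_of T e -> tends0 (fun m => (err m j).2 e).
Proof.
move=> Tj Te0 b0.
have p0 : tends0 (fun m => (err m j).1 T).
  apply: (tends0_psd (r := k) (local_form_psd T e0)).
  - by move=> p _; exact: local_form_eq0.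
  - by move=> m; exact: ((err_Wh m j).1 T Tj).
  move=> q qk.
  have h1 : (fun m => \sum_i (vdot T (wgrad k (err m j) T ord0 i) (mderiv i q) +
      \sum_(e | face_of T e) onormal T e ord0 i *
      fdot e (trace_defect k (err m j) T e) (trace e (mderiv i q)))) @ \oo --> (0 : R).
    apply: cvg0_sum => i _; apply: cvg0D; first exact: grad_cvg0.
    by apply: cvg0_sum => e Te; apply: cvg0Z; exact: defect_cvg0.
  have h2 : (fun m => fdot e0 (trace e0 q) 1 *
      (fdot e0 (trace_defect k (err m j) T e0) 1 + fdot e0 ((err m j).2 e0) 1)) @ \oo
      --> (0 : R).
    apply: cvg0Z; apply: cvg0D; first exact: defect_cvg0.
    exact: (b0 _ (psd_linear_l 1 (fdot_psd hTh e0))).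
  have := cvg0D h1 h2.
  rewrite [X in X @ _ --> _ -> _](_ : _ = fun m => local_form T e0 ((err m j).1 T) q); first exact.
  apply/funext => m; rewrite /local_form; congr (_ + _).
    by apply: eq_bigr => i _; rewrite grad_identity.
  (* The constant 1 lies in P_(k-1), so [Qb] preserves the integral over [e0]. *)
  have one_deg : Pdeg k.-1 (1 : mpoly n R) by rewrite -(mpolyC1 n R); exact: PdegC.
  have E : fdot e0 (trace_defect k (err m j) T e0) 1 + fdot e0 ((err m j).2 e0) 1 =
      fdot e0 (trace e0 ((err m j).1 T)) 1.
    apply: etrans _ ((Qb_spec hTh k e0 _).2 _ one_deg).
    have fl := lformD (psd_linear_l 1 (fdot_psd hTh e0)).
    have := fl (trace_defect k (err m j) T e0) ((err m j).2 e0).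
    by rewrite {1}/trace_defect subrK => ->.
  by apply: etrans (mulrC _ _) _; congr (_ * _); exact: E.
split=> // e Te.
have q0 : tends0 (fun m => Qb k e (pev ((err m j).1 T))).
  by apply: (tends0_map (phi := fun p => Qb k e (pev p))) => // b p q; exact: (Qb_linear hTh).
apply: tends0_ext (tends0B q0 (defect_tends0 Tj Te)) => m.
by rewrite /trace_defect opprB addrC subrK.
Qed.

Definition elt_converges T := forall j, elem_in (sub j) T ->
  tends0 (fun m => (err m j).1 T) /\
  forall e, face_of T e -> tends0 (fun m => (err m j).2 e).

Lemma elt_converges_face T j e : elem_in (sub j) T -> face_of T e ->
  tends0 (fun m => (err m j).2 e) -> elt_converges T.
Proof.
move=> Tj Te e0 i Ti; rewrite (elem_in_uniq hTh hsub Ti Tj).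
exact: local_cvg Te e0.
Qed.

Lemma all_elts_converge T : elt_converges T.
Proof.
suff : ~~ `[< ~ elt_converges T >] by move/asboolP/contrapT.
apply: (no_closed_family n_gt0 hTh (B := fun T => `[< ~ elt_converges T >])).
move=> {}T e /asboolP nT Te.
have [j Tj] := elem_in_some hOm hTh hsub T.
have [[T' T'e ne]|eO] := face_alternative hTh Te; last first.
  (* On an outer face the iterate and the exact solution both equal [Qb k e g]. *)
  exfalso; apply: nT; apply: (elt_converges_face Tj Te) => l hl.
  have eG := boundary_face_Gext hOm hTh hsub Tj Te eO.
  rewrite (_ : (fun _ => _) = cst 0); first exact: cvg_cst.
  by apply/funext => m; rewrite err_Gext// (lform0 hl).
exists T'; last by rewrite T'e.
apply/asboolP => hT'; apply: nT; apply: (elt_converges_face Tj Te).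
have [i T'i] := elem_in_some hOm hTh hsub T'.
have ei := (hT' i T'i).2 e T'e.
have [ij|ji] := eqVneq j i; first by rewrite ij.
have [adji eG] := shared_adjacent hTh hsub Tj T'i ji Te T'e.
(* The neighbour at step [m] controls this side at step [m.+1], hence the shift. *)
apply: (tends0_shift (fun m => (err m j).2 e)).1.
apply: tends0_ext (tends0B ei (trace_err_tends0 adji eG)) => m.
by rewrite opprB addrC subrK.
Qed.

Lemma Wnorm_cvg0 j : (fun m => Wnorm sub j (err m j)) @ \oo --> (0 : R).
Proof.
apply: cvg0_sqrt; apply: cvg0D.
  apply: cvg0_sum => T Tj.
  rewrite (_ : (fun _ => _) = fun m => vdot T ((err m j).1 T) ((err m j).1 T)); last first.
    apply/funext => m; rewrite vdotE; apply: eq_Rintegral => x _; exact: expr2.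
  apply: (psd_tends0 (r := k) (vdot_psd hTh T)); last exact: (all_elts_converge Tj).1.
  by move=> m; exact: ((err_Wh m j).1 T Tj).
apply: cvg0_sum => e ej.
rewrite (_ : (fun _ => _) = fun m => fdot e ((err m j).2 e) ((err m j).2 e)); last first.
  apply/funext => m; rewrite fdotE; apply: eq_Rintegral => x _; exact: expr2.
have /existsP[T /andP[Tj Te]] := ej.
apply: (psd_tends0 (r := k.-1) (fdot_psd hTh e)); last exact: (all_elts_converge Tj).2.
by move=> m; exact: ((err_Wh m j).2 e ej).
Qed.

Lemma Lambda_norm_cvg0 j i : adj j i ->
  (fun m => Lambda_norm sub j i (mult_err m j i)) @ \oo --> (0 : R).
Proof.
move=> ji; apply: cvg0_sqrt.
rewrite (_ : (fun _ => _) = fun m => \sum_(e | face_in (Gint sub j i) e)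
  fdot e (mult_err m j i e) (mult_err m j i e)); last first.
  by apply/funext => m; exact: GpairE.
apply: cvg0_sum => e eG.
apply: (psd_tends0 (r := k.-1) (fdot_psd hTh e)); last exact: mult_err_tends0.
by move=> m; exact: mult_err_deg.
Qed.

End error_decay.

Theorem theorem6p2 (R : realType) (d : nat) (hd : d = 2%N \/ d = 3%N)
    (Om : set 'rV[R]_d) (hOm : polytopal_domain Om)
    (a c f g : 'rV[R]_d -> R) (a0 a1 c1 : R)
    (ha0 : 0 < a0) (ha : coefficient_bounds Om a a0 a1)
    (hc : coefficient_bounds Om c 0 c1) (hf : L2_domain Om f)
    (Th : @mesh R d) (hTh : is_mesh Th Om) (hg : L2_boundary Th Om g)
    (k : nat) (hk : (1 <= k)%N)
    (M : nat) (sub : 'I_M -> set 'rV[R]_d) (hsub : is_decomposition Th Om sub)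
    (u : 'I_M -> wfun Th) (lam : 'I_M -> 'I_M -> bfun Th)
    (hDD : DD_solution k Om sub a c f g u lam)
    (beta : R) (hbeta : 0 < beta)
    (un : nat -> 'I_M -> wfun Th) (lamn : nat -> 'I_M -> 'I_M -> bfun Th)
    (hIT : IT_sequence k Om sub a c f g beta un lamn) :
  forall j : 'I_M,
    (fun n => Wnorm sub j (un n j - u j)) @ \oo --> (0 : R) /\
    forall i : 'I_M, adjacent_sub sub j i ->
      (fun n => Lambda_norm sub j i (lamn n j i - lam j i)) @ \oo --> (0 : R).
Proof.
(* With [d] in successor form the face dimension [d.-1] reduces to [n]; its positivity is what makes
   the relative boundaries of the faces null sets. *)
have [n [dn n_gt0]] : exists n, d = n.+1 /\ (0 < n)%N.
  by case: hd => ->; [exists 1%N|exists 2%N].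
subst d => j; split.
  exact: (Wnorm_cvg0 n_gt0 hOm ha0 ha hc hTh hsub hDD hbeta hIT j).
move=> i ji.
exact: (Lambda_norm_cvg0 n_gt0 hOm ha0 ha hc hTh hsub hDD hbeta hIT ji).
Qed.
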